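(* Let $n\ge 2$, $d\ge 3$, $k\ge 3$ be integers, and let $v_d:\mathbb{P}^n\to\mathbb{P}^N$ be the $d$-uple Veronese embedding, $N=\binom{n+d}{d}-1$. Let $\Sigma_{k,d}(1)=\bigcup_{\mathbb{P}^1\subset\mathbb{P}^n}\sigma_k(v_d(\mathbb{P}^1))$ be the $1$-subsecant locus of $\sigma_k(v_d(\mathbb{P}^n))$. If $(k,d,n)\ne(3,4,2)$, then: (i) If $k\le\frac{d+1}{2}$, then $\sigma_k(v_d(\mathbb{P}^n))$ is smooth at every point of $\Sigma_{k,d}(1)\setminus\sigma_{k-1}(v_d(\mathbb{P}^n))$. (ii) If $k=\frac{d+2}{2}$ (which occurs only if $d$ is even), then $\Sigma_{k,d}(1)\subset\operatorname{Sing}(\sigma_k(v_d(\mathbb{P}^n)))$ but $\Sigma_{k,d}(1)\not\subset\sigma_{k-1}(v_d(\mathbb{P}^n))$. (iii) If $k\ge\frac{d+3}{2}$, then $\Sigma_{k,d}(1)\subset\sigma_{k-1}(v_d(\mathbb{P}^n))$ (and hence $\Sigma_{k,d}(1)$ lies in the singular locus of $\sigma_k(v_d(\mathbb{P}^n))$ unless $\sigma_k(v_d(\mathbb{P}^n))=\mathbb{P}^N$). If $(k,d,n)=(3,4,2)$, then: (iv) $\sigma_3(v_4(\mathbb{P}^2))$ is smooth at every point of $\Sigma_{3,4}(1)\setminus\sigma_2(v_4(\mathbb{P}^2))$.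
   Context: We work over $\mathbb{C}$. For a projective variety $X\subset\mathbb{P}^N$, the $k$-th secant variety $\sigma_k(X)\subset\mathbb{P}^N$ is the Zariski closure of the union of the linear spans $\langle x_1,\dots,x_k\rangle$ over all $x_1,\dots,x_k\in X$ (with reduced structure); $\sigma_1(X)=X$. $\operatorname{Sing}$ denotes the singular locus. The union defining $\Sigma_{k,d}(1)$ runs over all lines $\mathbb{P}^1\subset\mathbb{P}^n$, and $v_d(\mathbb{P}^1)$ is the image of the line under $v_d$. *)

(* Defs.v *)
From HB Require Import structures.
From mathcomp Require Import all_boot all_order all_algebra.
From mathcomp Require Import classical_sets reals complex.
From mathcomp Require Import mpoly.

Set Implicit Arguments.
Unset Strict Implicit.
Unset Printing Implicit Defensive.

Import GRing.Theory.

Local Open Scope ring_scope.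
Local Open Scope classical_set_scope.

(* A point of P^N is a line through the origin of K^(N+1), so equality of
   points of P^N is Leibniz equality.                                         *)
Record projpoint (K : closedFieldType) (N : nat) := ProjPoint {
  pline :> {vspace 'rV[K]_N.+1};
  _ : \dim pline == 1%N
}.

HB.instance Definition _ (K : closedFieldType) (N : nat) :=
  [isSub for @pline K N].

Section ProjectiveGeometry.

Variables (K : closedFieldType) (N : nat).

Implicit Types (X Z : set (projpoint K N)) (p : projpoint K N).
Implicit Types (f g : {mpoly K[N.+1]}).

Definition vanishes_at f p : Prop :=
  forall v : 'rV[K]_N.+1, v \in pline p -> f.@[v ord0] = 0.

Definition vanishes_on f X : Prop := forall p, X p -> vanishes_at f p.

Definition zariski_closure X : set (projpoint K N) :=
  [set p | forall (e : nat) f,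
     f \is e.-homog -> vanishes_on f X -> vanishes_at f p].

Definition zariski_closed X : Prop := zariski_closure X `<=` X.

Definition zariski_irreducible X : Prop :=
  X !=set0 /\
  forall A B, zariski_closed A -> zariski_closed B ->
    X `<=` A `|` B -> X `<=` A \/ X `<=` B.

(* The points x_1, ..., x_k are not required to be distinct.                  *)
Definition secant (k : nat) X : set (projpoint K N) :=
  zariski_closure
    [set y | exists x : 'I_k -> projpoint K N,
       (forall i, X (x i)) /\ (pline y <= \sum_(i < k) pline (x i))%VS].

(* For Z irreducible: the function field K(Z) contains r algebraically
   independent elements.  Its elements are the quotients of forms of the same
   degree whose denominator does not vanish identically on Z; f_1/g, ..., f_r/g
   are written with a common denominator, and an element of K(Z) is 0 iff it
   vanishes wherever its denominator does not.                                *)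
Definition alg_indep_functions Z (r : nat) : Prop :=
  exists (e : nat) (f : 'I_r -> {mpoly K[N.+1]}) (g : {mpoly K[N.+1]}),
    [/\ forall i, f i \is e.-homog,
        g \is e.-homog,
        ~ vanishes_on g Z
      & forall F : {mpoly K[r]},
          (forall (z : projpoint K N) (v : 'rV[K]_N.+1),
             Z z -> v \in pline z -> g.@[v ord0] != 0 ->
             F.@[fun i => (f i).@[v ord0] / g.@[v ord0]] = 0) ->
          F = 0].

(* dim Z = r for Z irreducible, dim Z being the transcendence degree of K(Z). *)
Definition irr_dim Z (r : nat) : Prop :=
  alg_indep_functions Z r /\
  forall s : nat, alg_indep_functions Z s -> (s <= r)%N.

(* dim_p X = r, the largest dimension of an irreducible closed subset of X
   through p (equivalently, of an irreducible component of X through p).      *)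
Definition local_dim X p (r : nat) : Prop :=
  (exists Z, [/\ zariski_closed Z, zariski_irreducible Z, Z `<=` X, Z p
               & irr_dim Z r]) /\
  (forall Z (s : nat),
     zariski_closed Z -> zariski_irreducible Z -> Z `<=` X -> Z p ->
     irr_dim Z s -> (s <= r)%N).

(* T is the linear subspace of K^(N+1) whose projectivization is the embedded
   Zariski tangent space T_p X in P^N.  All forms vanishing on X are used, i.e.
   X carries its reduced structure.                                           *)
Definition is_tangent_cone X p (T : {vspace 'rV[K]_N.+1}) : Prop :=
  forall w : 'rV[K]_N.+1,
    w \in T <->
    (forall (e : nat) f, f \is e.-homog -> vanishes_on f X ->
       forall v : 'rV[K]_N.+1, v \in pline p ->
         \sum_(i < N.+1) (f^`M(i)).@[v ord0] * w ord0 i = 0).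

(* p is in X and dim T_p X = dim_p X; the shift by one passes from the
   projective space to its affine cone.                                       *)
Definition smooth_at X p : Prop :=
  X p /\
  exists (r : nat) (T : {vspace 'rV[K]_N.+1}),
    [/\ local_dim X p r, is_tangent_cone X p T & \dim T = r.+1].

Definition Sing X : set (projpoint K N) := [set p | X p /\ ~ smooth_at X p].

End ProjectiveGeometry.

Section Veronese.

Variables (K : closedFieldType) (n d : nat).

Definition deg_monomials : seq 'X_{1..n.+1} :=
  [seq bmnm m | m <- enum {: 'X_{1..n.+1 < d.+1}}
              & mdeg (bmnm m) == d].

Definition veronese_N : nat := 'C(n + d, d).-1.

Lemma mem_deg_monomials (m : 'X_{1..n.+1}) :
  (m \in deg_monomials) = (mdeg m == d).
Proof.
apply/mapP/idP => [[b]|/eqP md]; first by rewrite mem_filter => /andP[? _] ->.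
have mb : (mdeg m < d.+1)%N by rewrite md.
by exists (BMultinom mb); rewrite // mem_filter mem_enum andbT; apply/eqP.
Qed.

Lemma uniq_deg_monomials : uniq deg_monomials.
Proof.
rewrite map_inj_in_uniq; first by apply/filter_uniq/enum_uniq.
by move=> x y _ _; apply: val_inj.
Qed.

Lemma size_deg_monomials : size deg_monomials = veronese_N.+1.
Proof.
rewrite /veronese_N prednK ?bin_gt0 ?leq_addl // addnC -size_basis.
apply/perm_size/uniq_perm.
- exact: uniq_deg_monomials.
- exact: uniq_basis.
- by move=> m; rewrite mem_deg_monomials basis_cover.
Qed.

(* The default value of nth is never used, by size_deg_monomials.             *)
Definition veronese_vec (v : 'rV[K]_n.+1) : 'rV[K]_veronese_N.+1 :=
  \row_j \prod_(i < n.+1) v ord0 i ^+ (nth 0%MM deg_monomials j) i.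

Lemma veronese_vec_neq0 (v : 'rV[K]_n.+1) : v != 0 -> veronese_vec v != 0.
Proof.
move=> v0; have [i vi] : exists i, v ord0 i != 0.
  by move/rV0Pn: v0.
pose m : 'X_{1..n.+1} := (U_(i) *+ d)%MM.
have mI : m \in deg_monomials by rewrite mem_deg_monomials mdegMn mdeg1 mul1n.
have jlt : (index m deg_monomials < veronese_N.+1)%N.
  by rewrite -size_deg_monomials index_mem.
apply/rV0Pn; exists (Ordinal jlt); rewrite mxE /= nth_index //.
apply/prodf_neq0 => l _; rewrite mulmnE mnm1E.
by case: (eqVneq i l) => [<-|_]; rewrite ?mul0n ?expr0 ?oner_neq0 ?mul1n ?expf_neq0.
Qed.

Lemma vpick_projpoint_neq0 (x : projpoint K n) : vpick (pline x) != 0.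
Proof.
rewrite vpick0 -dimv_eq0; have := valP x; rewrite /=.
by move=> /eqP ->.
Qed.

Lemma dim_veronese (x : projpoint K n) :
  \dim (<[veronese_vec (vpick (pline x))]>%VS) == 1%N.
Proof. by rewrite dim_vline veronese_vec_neq0 ?vpick_projpoint_neq0. Qed.

Definition veronese (x : projpoint K n) : projpoint K veronese_N :=
  ProjPoint (dim_veronese x).

Lemma veronese_vecZ (c : K) (v : 'rV[K]_n.+1) :
  veronese_vec (c *: v) = c ^+ d *: veronese_vec v.
Proof.
apply/rowP => j; rewrite !mxE.
under eq_bigr => i _ do rewrite mxE exprMn.
rewrite big_split /= prodrXr; congr (_ ^+ _ * _).
have /mem_nth : (j < size deg_monomials)%N by rewrite size_deg_monomials.
by move=> /(_ 0%MM); rewrite mem_deg_monomials mdegE => /eqP.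
Qed.

(* The value of veronese does not depend on the representative.               *)
Lemma veroneseE (x : projpoint K n) (v : 'rV[K]_n.+1) :
  v \in pline x -> v != 0 -> pline (veronese x) = <[veronese_vec v]>%VS.
Proof.
move=> vx v0 /=; have dx := eqP (valP x).
have u0 := vpick_projpoint_neq0 x; set u := vpick _ in u0 *.
have ex : <[u]>%VS = pline x.
  by apply/eqP; rewrite eqEdim -memvE memv_pick dim_vline u0 dx.
move: vx; rewrite -ex => /vlineP[c vE]; rewrite vE veronese_vecZ.
have c0 : c ^+ d != 0.
  by apply/expf_neq0; apply: contraNneq v0 => c0; rewrite vE c0 scale0r.
apply/eqP; rewrite eqEdim !dim_vline scaler_eq0 (negPf c0) leqnn andbT -memvE.
by apply/vlineP; exists (c ^+ d)^-1; rewrite scalerA mulVf ?scale1r.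
Qed.

Definition veronese_variety : set (projpoint K veronese_N) :=
  [set veronese x | x in [set: projpoint K n]].

(* v_d(P(L)); for \dim L = 2 this is v_d(P^1) for the line P^1 = P(L).        *)
Definition veronese_linear (L : {vspace 'rV[K]_n.+1}) :
    set (projpoint K veronese_N) :=
  [set veronese x | x in [set x : projpoint K n | (pline x <= L)%VS]].

Definition subsecant_lines (k : nat) : set (projpoint K veronese_N) :=
  \bigcup_(L in [set L : {vspace 'rV[K]_n.+1} | \dim L = 2%N])
    secant k (veronese_linear L).

End Veronese.

Arguments veronese_variety : clear implicits.
Arguments veronese_linear : clear implicits.
Arguments subsecant_lines : clear implicits.

(* Main.v *)
(* A vector of the ambient space of v_d(P^n) is a linear form on forms of degree d,
   and v_d(x) is the evaluation at x; a point p of sigma_k(v_d(P(L))), for a line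
   P(L), is a linear form on binary forms, that is a sequence s_0, ..., s_d.
   A binary form g of degree a apolar to p is a linear recurrence satisfied by s;
   perturbing its roots so that they become distinct exhibits p as a limit of sums
   of a powers.  Hence p lies in sigma_a as soon as it has a nonzero apolar form
   of degree a, which for 2 a > d always exists: this gives (iii).

   For the tangent spaces, write J for the ideal of P(L).  When 2 k = d + 2, the
   length k decompositions of p can be made to pass through any point of the line,
   so by Terracini T_p contains S^(d-1) L . V, of dimension (d + 1) + (n - 1) d,
   which exceeds k (n + 1) unless (k, n) = (3, 2).  When p is not in sigma_(k-1)
   the relevant catalecticant has rank exactly k at p, and differentiating its
   minors gives the upper bounds (J^2 + g J + g^2)^perp, of dimension k (n + 1), if
   2 k <= d + 1, and (J^2)^perp = S^(d-1) L . V if 2 k = d + 2.  On the other hand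
   dim sigma_k = k (n + 1) - 1 as soon as the parametrization by k points is
   immersive somewhere, and then dim T_p >= k (n + 1) everywhere; upper bounds on
   dimensions come from counting monomials. *)

Require Import Defs.
From HB Require Import structures.
From mathcomp Require Import all_boot all_order all_algebra.
From mathcomp Require Import boolp classical_sets reals complex.
From mathcomp Require Import mpoly zify.

Set Implicit Arguments.
Unset Strict Implicit.
Unset Printing Implicit Defensive.

Import GRing.Theory.

Local Open Scope ring_scope.
Local Open Scope classical_set_scope.

(** * Polynomials along curves *)

(** Limits are replaced by polynomial identities in one parameter [t], proved away from the roots of
    a non-zero [q] and then read at [t = 0]. The main obstacle is dimension, which is defined
    through algebraically independent functions. An upper bound needs a linear relation among $M^s$
    monomials in [s] functions; it comes from mapping them into a space of forms whose dimension
    grows like a smaller power of $M$. A lower bound needs one parameter point with injective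
    differential: a polynomial relation between suitable coordinates would then vanish along curves
    of every velocity. Smoothness uses such a point, made of [k] collinear points if [2 k <= d + 1]
    and of the coordinate points for $(k,d,n)=(3,4,2)$. Singularity uses upper bounds only: a
    tangent space too large for a variety parametrized by [k] points or, on $\sigma_{k-1}$, equal to
    the whole space, which is too large for any variety with a non-zero equation. For $(3,4,2)$ the
    numbers $(d+1)+(n-1)d$ and $k(n+1)$ are both 9, so the tangent space that is too large elsewhere
    has exactly the right size. *)

Section Curves.

Variables (K : fieldType) (K0 : [pchar K] =i pred0).

Lemma natf_inj : injective (fun i : nat => i%:R : K).
Proof.
have H i j : (i <= j)%N -> i%:R = j%:R :> K -> i = j.
  move=> ij e; apply/eqP; rewrite eqn_leq ij /= -subn_eq0.
  have := (pcharf0P K).1 K0 (j - i)%N; rewrite natrB // e subrr eqxx => <-.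
  by [].
move=> i j e; case: (leqP i j) => [|/ltnW] ij; first exact: H.
by apply/esym/H.
Qed.

(** The substitute for passing to the limit: an identity checked at almost all parameters of a
    polynomial curve holds at the special one too. Otherwise [q * h] would be a non-zero polynomial
    vanishing at all natural numbers, which are distinct in characteristic 0. *)
Lemma poly_root_off (q h : {poly K}) :
  q != 0 -> (forall t, q.[t] != 0 -> h.[t] = 0) -> h = 0.
Proof.
move=> q0 qh; apply/eqP; apply: contraT => h0.
have qh0 : q * h != 0 by rewrite mulf_neq0.
pose rs := [seq (i%:R : K) | i <- iota 0 (size (q * h))].
have := max_poly_roots qh0 (rs := rs).
rewrite size_map size_iota ltnn; apply.
  apply/allP => _ /mapP[i _ ->]; rewrite /root hornerM mulf_eq0.
  by case: (eqVneq q.[i%:R] 0) => //= /qh ->; rewrite eqxx.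
by rewrite map_inj_uniq ?iota_uniq //; exact: natf_inj.
Qed.

Lemma poly_nonroot (q : {poly K}) : q != 0 -> exists t, q.[t] != 0.
Proof.
move=> q0; apply: contrapT => h; have := q0.
by rewrite (poly_root_off (h := q) q0) ?eqxx // => t qt; case: h; exists t.
Qed.

Variable m : nat.
Implicit Types (F : {mpoly K[m]}) (P : 'rV[{poly K}]_m) (v w : 'rV[K]_m).

Definition curve_at P (t : K) : 'rV[K]_m := \row_j (P ord0 j).[t].

Definition along F P : {poly K} := mmap polyC (P ord0) F.

Lemma horner_along F P t : (along F P).[t] = F.@[(curve_at P t) ord0].
Proof.
rewrite /along mevalE /mmap horner_sum; apply: eq_bigr => mm _.
rewrite hornerCM /mmap1 horner_prod; congr (_ * _); apply: eq_bigr => i _.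
by rewrite horner_exp mxE.
Qed.

Lemma alongM F G P : along (F * G) P = along F P * along G P.
Proof. by rewrite /along rmorphM. Qed.

(** The differential of [F] at [v] applied to [w], in the exact shape that [is_tangent_cone]
    quantifies over. *)
Definition dird F v w : K := \sum_(i < m) F^`M(i).@[v ord0] * w ord0 i.

Lemma deriv_along F P :
  (along F P)^`() = \sum_(i < m) along F^`M(i) P * (P ord0 i)^`().
Proof.
rewrite /along.
have HM G H : (mmap polyC (P ord0) G)^`() =
    \sum_(i < m) mmap polyC (P ord0) G^`M(i) * (P ord0 i)^`() ->
  (mmap polyC (P ord0) H)^`() =
    \sum_(i < m) mmap polyC (P ord0) H^`M(i) * (P ord0 i)^`() ->
  (mmap polyC (P ord0) (G * H))^`() =
    \sum_(i < m) mmap polyC (P ord0) (G * H)^`M(i) * (P ord0 i)^`().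
  move=> eG eH; rewrite rmorphM derivM eG eH mulr_suml mulr_sumr -big_split.
  apply: eq_bigr => i _; rewrite mderivM rmorphD !rmorphM mulrDl.
  by rewrite mulrAC -!mulrA.
have HC c : (mmap polyC (P ord0) c%:MP)^`() =
    \sum_(i < m) mmap polyC (P ord0) (c%:MP)^`M(i) * (P ord0 i)^`().
  rewrite mmapC derivC big1 // => i _.
  by rewrite mderivC raddf0 mul0r.
have HX i : (mmap polyC (P ord0) 'X_i)^`() =
    \sum_(j < m) mmap polyC (P ord0) ('X_i)^`M(j) * (P ord0 j)^`().
  rewrite mmapX mmap1U (bigD1 i) //= big1 ?addr0; last first.
    by move=> j ji; rewrite mderivX mnm1E eq_sym (negPf ji) scale0r raddf0 mul0r.
  rewrite mderivX mnm1E eqxx scale1r.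
  have -> : (U_(i) - U_(i) = 0 :> 'X_{1..m})%MM.
    by apply/mnmP => j; rewrite mnmBE subnn mnm0E.
  by rewrite mpolyX0 rmorph1 mul1r.
elim/mpolyind: F => [|c mm p _ _ IH]; first by rewrite -mpolyC0; apply: HC.
have HA : (mmap polyC (P ord0) 'X_[mm])^`() =
    \sum_(i < m) mmap polyC (P ord0) ('X_[mm])^`M(i) * (P ord0 i)^`().
  rewrite mpolyXE_id; elim/big_ind: _ => [||i _].
  - by rewrite -mpolyC1; apply: HC.
  - by move=> x y; apply: HM.
  - elim: (mm i) => [|r IHr]; first by rewrite expr0 -mpolyC1; apply: HC.
    by rewrite exprS; apply: HM.
have := HM _ _ (HC c) HA; rewrite mul_mpolyC => HA'.
rewrite raddfD derivD HA' IH -big_split; apply: eq_bigr => i _ /=.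
by rewrite mderivD raddfD mulrDl.
Qed.

Lemma horner_deriv_along F P t :
  (along F P)^`().[t] =
  dird F (curve_at P t) (\row_j (P ord0 j)^`().[t]).
Proof.
rewrite deriv_along horner_sum; apply: eq_bigr => i _.
by rewrite hornerM horner_along mxE.
Qed.

Definition ray v w : 'rV[{poly K}]_m := \row_j ((v ord0 j)%:P + w ord0 j *: 'X).

Lemma ray_at v w t : curve_at (ray v w) t = v + t *: w.
Proof.
by apply/rowP => j; rewrite !mxE hornerD hornerC hornerZ hornerX mulrC.
Qed.

Lemma ray_deriv v w t : \row_j (ray v w ord0 j)^`().[t] = w.
Proof.
apply/rowP => j; rewrite !mxE derivD derivC add0r derivZ derivX hornerZ.
by rewrite hornerC mulr1.
Qed.

Lemma dirdE F v w : dird F v w = (along F (ray v w))^`().[0].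
Proof. by rewrite horner_deriv_along ray_deriv ray_at scale0r addr0. Qed.

(* Over an infinite field of characteristic 0, Taylor coefficients at 0 are
   read off iterated partial derivatives, all of which vanish identically. *)
Lemma mpoly_fun_eq0 F : (forall v : 'rV[K]_m, F.@[v ord0] = 0) -> F = 0.
Proof.
have step G i : (forall v : 'rV[K]_m, G.@[v ord0] = 0) ->
    forall v : 'rV[K]_m, G^`M(i).@[v ord0] = 0.
  move=> G0 v; have al0 : along G (ray v (delta_mx 0 i)) = 0.
    apply: (poly_root_off (oner_neq0 _)) => t _; by rewrite horner_along.
  have := dirdE G v (delta_mx 0 i); rewrite al0 derivC horner0.
  rewrite /dird (bigD1 i) //= big1 ?addr0 => [|j ji].
    by rewrite mxE !eqxx mulr1.
  by rewrite mxE (negPf ji) andbF mulr0.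
move=> F0; apply/mpolyP => mm; rewrite mcoeff0.
have D0 : forall v : 'rV[K]_m, (F^`M[mm]).@[v ord0] = 0.
  rewrite mderivm_foldr; elim: (flatten _) => [|i s IH] //=.
  exact: step.
have : (F^`M[mm])@_0 = 0.
  have := D0 0; rewrite mevalE.
  case: (boolP (0%MM \in msupp (F^`M[mm]))) => [in0|]; last first.
    by rewrite mcoeff_msupp negbK => /eqP.
  rewrite (bigD1_seq 0%MM) ?msupp_uniq //= big1 ?mulr1 => [|i _]; last first.
    by rewrite mnm0E expr0.
  rewrite big1 ?addr0 // => m' m'0.
  have [i m'i] : exists i, m' i != 0%N.
    apply: contrapT => h; case/eqP: m'0; apply/mnmP => i; rewrite mnm0E.
    by apply/eqP; apply: contraT => h'; case: h; exists i.
  by rewrite (bigD1 i) //= mxE expr0n (negPf m'i) mul0r mulr0.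
rewrite mcoeff_mderivm addm0 => /eqP.
rewrite -mulr_natr mulf_eq0 => /orP[/eqP //|].
rewrite ((pcharf0P K).1 K0) => /eqP e.
have : (0 < \prod_(i < m) (mm i) ^_ (mm i))%N.
  by rewrite prodn_gt0 // => i; rewrite ffact_gt0.
by rewrite e.
Qed.

Lemma mpoly_fun_neq0 F : F != 0 -> exists v : 'rV[K]_m, F.@[v ord0] != 0.
Proof.
move=> F0; apply: contrapT => h; case/eqP: F0; apply: mpoly_fun_eq0 => v.
by apply/eqP; apply: contraT => h'; case: h; exists v.
Qed.

Lemma mpoly_fun_inj F G :
  (forall v : 'rV[K]_m, F.@[v ord0] = G.@[v ord0]) -> F = G.
Proof.
move=> FG; apply/eqP; rewrite -subr_eq0; apply/eqP/mpoly_fun_eq0 => v.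
by rewrite mevalB FG subrr.
Qed.

Lemma meval_homogZ e F (c : K) v : F \is e.-homog ->
  F.@[(c *: v) ord0] = c ^+ e * F.@[v ord0].
Proof.
move=> /dhomogP Fe; rewrite !mevalE mulr_sumr; apply: eq_big_seq => mm /Fe em.
have -> : c ^+ e = \prod_(i < m) c ^+ mm i by rewrite prodrXr -mdegE em.
rewrite mulrCA; congr (_ * _).
under eq_bigr => i _ do rewrite mxE exprMn.
by rewrite big_split.
Qed.

Lemma homog_nonroot_neq0 e F v : F \is e.-homog -> (0 < e)%N ->
  F.@[v ord0] != 0 -> v != 0.
Proof.
move=> Fe e0; apply: contraNneq => ->; rewrite -(scale0r (0 : 'rV[K]_m)).
by rewrite (meval_homogZ _ _ Fe) expr0n eqn0Ngt e0 mul0r.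
Qed.

Lemma dhomog_mderiv e F i : F \is e.-homog -> F^`M(i) \is e.-1.-homog.
Proof.
move=> /dhomogP Fe; apply/dhomogP => mm; rewrite mcoeff_msupp mcoeff_deriv => h.
have : F@_(mm + U_(i)) != 0 by apply: contraNneq h => ->; rewrite mul0rn.
by rewrite -mcoeff_msupp => /Fe /= <-; rewrite mdegD mdeg1 addn1.
Qed.

Lemma dirdZl e F (c : K) v w : F \is e.-homog ->
  dird F (c *: v) w = c ^+ e.-1 * dird F v w.
Proof.
move=> Fe; rewrite /dird mulr_sumr; apply: eq_bigr => i _.
by rewrite (meval_homogZ _ _ (dhomog_mderiv i Fe)) mulrA.
Qed.

Lemma dirdZr F v (c : K) w : dird F v (c *: w) = c * dird F v w.
Proof.
rewrite /dird mulr_sumr; apply: eq_bigr => i _.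
by rewrite mxE mulrCA.
Qed.

Lemma dirdDr F v w1 w2 : dird F v (w1 + w2) = dird F v w1 + dird F v w2.
Proof.
by rewrite /dird -big_split; apply: eq_bigr => i _; rewrite mxE mulrDr.
Qed.

Lemma dird_sum (I : Type) (r : seq I) (c : I -> K) (G : I -> {mpoly K[m]}) (u y : 'rV[K]_m) :
  dird (\sum_(i <- r) c i *: G i) u y = \sum_(i <- r) c i * dird (G i) u y.
Proof.
rewrite /dird; under [RHS]eq_bigr => i _ do rewrite mulr_sumr.
rewrite [RHS]exchange_big; apply: eq_bigr => l _ /=.
rewrite (raddf_sum (mderiv l)) (raddf_sum (meval _)) /= mulr_suml.
by apply: eq_bigr => i _; rewrite mderivZ mevalZ mulrA.
Qed.

(** Euler's identity, obtained by differentiating $F(tv)=t^eF(v)$ at $t=1$. *)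
Lemma dird_euler e F v : F \is e.-homog -> dird F v v = e%:R * F.@[v ord0].
Proof.
move=> Fe.
have E : along F (ray 0 v) = F.@[v ord0] *: 'X^e.
  apply/eqP; rewrite -subr_eq0; apply/eqP.
  apply: (poly_root_off (oner_neq0 _)) => t _.
  rewrite hornerD hornerN horner_along ray_at add0r (meval_homogZ _ _ Fe).
  by rewrite hornerZ hornerXn mulrC subrr.
have := horner_deriv_along F (ray 0 v) 1.
rewrite ray_deriv ray_at add0r scale1r E derivZ derivXn hornerZ hornerMn.
by rewrite hornerXn expr1n => <-; rewrite mulrC.
Qed.

End Curves.

(** * Veronese vectors and secant cones *)

Section VeronesePairing.

Variables (K : closedFieldType) (K0 : [pchar K] =i pred0) (n d : nat).
Implicit Types (f : {mpoly K[n.+1]}) (v x y : 'rV[K]_n.+1).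

Local Notation N := (veronese_N n d).
Implicit Types (w : 'rV[K]_N.+1).

Definition mon (j : 'I_N.+1) : 'X_{1..n.+1} := nth 0%MM (deg_monomials n d) j.

Lemma mdeg_mon j : mdeg (mon j) = d.
Proof.
by apply/eqP; rewrite -mem_deg_monomials mem_nth // size_deg_monomials.
Qed.

Lemma mon_homog j : 'X_[mon j] \is [in K[n.+1], d.-homog].
Proof. by rewrite dhomogX; apply/eqP/mdeg_mon. Qed.

Lemma mon_inj : injective mon.
Proof.
move=> i j e; apply/val_inj/eqP => /=.
by rewrite -(nth_uniq 0%MM _ _ (uniq_deg_monomials n d)) ?size_deg_monomials //; apply/eqP.
Qed.

Lemma homog_mon f : f \is d.-homog ->
  f = \sum_(j < N.+1) f@_(mon j) *: 'X_[mon j].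
Proof.
move=> fd; apply/mpolyP => m; rewrite raddf_sum /=.
under eq_bigr => j _ do rewrite mcoeffZ mcoeffX.
have [md|md] := eqVneq (mdeg m) d; last first.
  rewrite (dhomog_nemf_coeff fd md) big1 // => j _.
  case: eqP => [e|_]; last by rewrite mulr0.
  by case/eqP: md; rewrite -e mdeg_mon.
have min : m \in deg_monomials n d by rewrite mem_deg_monomials md.
have jlt : (index m (deg_monomials n d) < N.+1)%N.
  by rewrite -(size_deg_monomials n d) index_mem.
have mE : mon (Ordinal jlt) = m by rewrite /mon nth_index.
rewrite (bigD1 (Ordinal jlt)) //= mE eqxx mulr1 big1 ?addr0 // => j /negPf jn.
by rewrite -[X in _ == X]mE (inj_eq mon_inj) jn mulr0.
Qed.

Definition pair w f : K := \sum_(j < N.+1) w ord0 j * f@_(mon j).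

Lemma pairDl w1 w2 f : pair (w1 + w2) f = pair w1 f + pair w2 f.
Proof.
by rewrite /pair -big_split; apply: eq_bigr => j _; rewrite mxE mulrDl.
Qed.

Lemma pairZl c w f : pair (c *: w) f = c * pair w f.
Proof.
by rewrite /pair mulr_sumr; apply: eq_bigr => j _; rewrite mxE mulrA.
Qed.

Lemma pair0l f : pair 0 f = 0.
Proof. by rewrite -(scale0r (0 : 'rV_N.+1)) pairZl mul0r. Qed.

Lemma pair_suml (I : Type) (r : seq I) (P : pred I) (E : I -> 'rV[K]_N.+1) f :
  pair (\sum_(i <- r | P i) E i) f = \sum_(i <- r | P i) pair (E i) f.
Proof. by elim/big_rec2: _ => [|i a b _ <-]; rewrite ?pair0l ?pairDl. Qed.

Lemma pairDr w f g : pair w (f + g) = pair w f + pair w g.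
Proof.
by rewrite /pair -big_split; apply: eq_bigr => j _; rewrite mcoeffD mulrDr.
Qed.

Lemma pairZr w c f : pair w (c *: f) = c * pair w f.
Proof.
by rewrite /pair mulr_sumr; apply: eq_bigr => j _; rewrite mcoeffZ mulrCA.
Qed.

Lemma pair0r w : pair w 0 = 0.
Proof. by rewrite -(scale0r (0 : {mpoly K[n.+1]})) pairZr mul0r. Qed.

Lemma pairBr w f g : pair w (f - g) = pair w f - pair w g.
Proof. by rewrite -scaleN1r pairDr pairZr mulN1r. Qed.

Lemma pair_sumr w (I : Type) (r : seq I) (P : pred I) (E : I -> {mpoly K[n.+1]}) :
  pair w (\sum_(i <- r | P i) E i) = \sum_(i <- r | P i) pair w (E i).
Proof. by elim/big_rec2: _ => [|i a b _ <-]; rewrite ?pair0r ?pairDr. Qed.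

Lemma pair_mon w j : pair w 'X_[mon j] = w ord0 j.
Proof.
rewrite /pair (bigD1 j) //= mcoeffX eqxx mulr1 big1 ?addr0 // => i ij.
by rewrite mcoeffX (inj_eq mon_inj) eq_sym (negPf ij) mulr0.
Qed.

Lemma pair_nondeg w : (forall f, f \is d.-homog -> pair w f = 0) -> w = 0.
Proof.
by move=> h; apply/rowP => j; rewrite -pair_mon h ?mxE // mon_homog.
Qed.

Lemma veronese_vec_mon x j : veronese_vec d x ord0 j = ('X_[mon j]).@[x ord0].
Proof. by rewrite mxE mevalX. Qed.

Lemma pair_veronese x f : f \is d.-homog -> pair (veronese_vec d x) f = f.@[x ord0].
Proof.
move=> fd; rewrite [in RHS](homog_mon fd) raddf_sum /=; apply: eq_bigr => j _.
by rewrite veronese_vec_mon mevalZ mulrC.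
Qed.

(** The differential of the affine Veronese map at [x] in direction [y], classically
    $d\,x^{d-1}y$. *)
Definition dver x y : 'rV[K]_N.+1 := \row_j dird 'X_[mon j] x y.

Lemma pair_dver x y f : f \is d.-homog -> pair (dver x y) f = dird f x y.
Proof.
move=> fd; rewrite [in RHS](homog_mon fd) dird_sum; apply: eq_bigr => j _.
by rewrite mxE mulrC.
Qed.

Lemma dverxx x : dver x x = d%:R *: veronese_vec d x.
Proof.
apply/rowP => j.
by rewrite mxE (dird_euler K0 _ (mon_homog j)) [RHS]mxE veronese_vec_mon.
Qed.

Definition vcurve (P : 'rV[{poly K}]_n.+1) : 'rV[{poly K}]_N.+1 :=
  \row_j along 'X_[mon j] P.

Lemma vcurve_at P t : curve_at (vcurve P) t = veronese_vec d (curve_at P t).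
Proof.
by apply/rowP => j; rewrite mxE [in LHS]mxE horner_along veronese_vec_mon.
Qed.

Lemma vcurve_deriv P t :
  \row_j (vcurve P ord0 j)^`().[t] =
  dver (curve_at P t) (\row_j (P ord0 j)^`().[t]).
Proof. by apply/rowP => j; rewrite !mxE horner_deriv_along. Qed.

End VeronesePairing.

Section CurveAt.

Variables (K : fieldType) (m : nat).
Implicit Types (P : 'rV[{poly K}]_m).

Lemma curve_at_sum (I : Type) (r : seq I) (A : pred I) (E : I -> 'rV[{poly K}]_m) t :
  curve_at (\sum_(i <- r | A i) E i) t = \sum_(i <- r | A i) curve_at (E i) t.
Proof.
apply/rowP => j; rewrite mxE !summxE horner_sum; apply: eq_bigr => i _.
by rewrite mxE.
Qed.

Lemma curve_atZ c P t : curve_at (c *: P) t = c.[t] *: curve_at P t.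
Proof. by apply/rowP => j; rewrite !mxE hornerM. Qed.

Lemma curve_at_const (v : 'rV[K]_m) t : curve_at (map_mx polyC v) t = v.
Proof. by apply/rowP => j; rewrite !mxE hornerC. Qed.

End CurveAt.

Section SecantCone.

Variables (K : closedFieldType) (n d : nat).
Hypothesis d_gt0 : (0 < d)%N.
Local Notation N := (veronese_N n d).
Implicit Types (F : {mpoly K[N.+1]}) (L : {vspace 'rV[K]_n.+1}).

(** Bare sums of Veronese vectors suffice to test a form: over a closed field a coefficient is
    absorbed into its point by a [d]-th root, and a zero vector stands for a missing point. *)
Definition vanS k L F : Prop := forall x : 'I_k -> 'rV[K]_n.+1,
  (forall l, x l \in L) -> F.@[(\sum_l veronese_vec d (x l)) ord0] = 0.

Definition inS k L (v : 'rV[K]_N.+1) : Prop :=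
  forall e F, F \is e.-homog -> vanS k L F -> F.@[v ord0] = 0.

Lemma closed_expr_root (a : K) : exists b, b ^+ d = a.
Proof.
have /closed_rootP[b] : size ('X^d - a%:P) != 1%N.
  by rewrite size_XnsubC // eqSS -lt0n.
rewrite /root !hornerE subr_eq0 => /eqP; by exists b.
Qed.

Lemma vanS_coef k L F : vanS k L F ->
  forall (a : 'I_k -> K) (x : 'I_k -> 'rV[K]_n.+1), (forall l, x l \in L) ->
  F.@[(\sum_l a l *: veronese_vec d (x l)) ord0] = 0.
Proof.
move=> FS a x xL.
have [b bE] : exists b : 'I_k -> K, forall l, b l ^+ d = a l.
  apply: (@fin_all_exists _ (fun _ => K) (fun l b => b ^+ d = a l)) => l.
  exact: closed_expr_root.
have := FS (fun l => b l *: x l) (fun l => memvZ _ (xL l)).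
by under eq_bigr => l _ do rewrite veronese_vecZ bE.
Qed.

Lemma veronese_vec0 : veronese_vec d (0 : 'rV[K]_n.+1) = 0.
Proof.
rewrite -(scale0r (0 : 'rV_n.+1)) veronese_vecZ.
by rewrite expr0n eqn0Ngt d_gt0 scale0r.
Qed.

Definition mkpt m (v : 'rV[K]_m.+1) (v0 : v != 0) : projpoint K m :=
  ProjPoint (introT eqP (etrans (dim_vline v) (congr1 nat_of_bool v0))).

Lemma pline_vpick m (p : projpoint K m) : pline p = <[vpick (pline p)]>%VS.
Proof.
apply/esym/eqP; rewrite eqEdim -memvE memv_pick dim_vline.
by rewrite vpick_projpoint_neq0 (eqP (valP p)).
Qed.

Lemma veronese_varietyE : veronese_variety K n d = veronese_linear K n d fullv.
Proof.
rewrite /veronese_variety /veronese_linear; congr (image _ _).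
by apply/seteqP; split => x //= _; exact: subvf.
Qed.

Section NonemptyLine.

Variables (k : nat) (L : {vspace 'rV[K]_n.+1}).
Hypotheses (k_gt0 : (0 < k)%N) (L0 : L != 0%VS).

(** Zariski closure adds no condition, so only the union of spans [B] matters. Zero vectors among
    the [x l] are not projective points and are replaced by a point of [L]; a zero sum is covered
    because it belongs to the line of every point. *)
Lemma vanS_secant e F : F \is e.-homog ->
  (vanishes_on F (secant k (veronese_linear K n d L)) <-> vanS k L F).
Proof.
move=> Fe.
pose B := [set y : projpoint K N | exists x : 'I_k -> projpoint K N,
  (forall i, veronese_linear K n d L (x i)) /\
  (pline y <= \sum_(i < k) pline (x i))%VS].
have FB : vanishes_on F (secant k (veronese_linear K n d L)) <-> vanishes_on F B.
  split=> [h p Bp|h p]; first by apply: h => e' G _; apply.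
  by move/(_ e F Fe h).
rewrite FB; split => [h x xL|FS y [x [xX ysum]] v vy].
  have u0 : vpick L != 0 by rewrite vpick0.
  set v := \sum_l _.
  have [v0|v0] := eqVneq v 0.
    have vu : veronese_vec d (vpick L) != 0 by apply: veronese_vec_neq0.
    rewrite v0; apply: (h (veronese d (mkpt u0))); last exact: mem0v.
    exists (fun=> veronese d (mkpt u0)); split.
      by move=> _; exists (mkpt u0) => //=; rewrite -memvE memv_pick.
    by rewrite (sumv_sup (Ordinal k_gt0)).
  apply: (h (mkpt v0)); last exact: memv_line.
  have zE l : exists z : projpoint K n, (pline z <= L)%VS /\
      veronese_vec d (x l) \in pline (veronese d z).
    have [xl0|xl0] := eqVneq (x l) 0.
      exists (mkpt u0); rewrite xl0 veronese_vec0 mem0v; split => //=.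
      by rewrite -memvE memv_pick.
    exists (mkpt xl0); split; first by rewrite /= -memvE.
    by rewrite (veroneseE _ _ xl0) /= ?memv_line.
  have [z zP] := fin_all_exists zE.
  exists (fun l => veronese d (z l)); split.
    by move=> l; exists (z l) => //; case: (zP l).
  rewrite /= -memvE; apply: memv_sumr => l _; by case: (zP l).
move/subvP: ysum => /(_ v vy) /memv_sumP[vs vsP ->].
have zE l : exists az : K * 'rV[K]_n.+1, az.2 \in L /\
    vs l = az.1 *: veronese_vec d az.2.
  have [z /= zL zx] := xX l.
  have := vsP l isT; rewrite -zx /= => /vlineP[a ->].
  exists (a, vpick (pline z)); split => //=.
  by apply: (subvP zL); exact: memv_pick.
have [az azP] := fin_all_exists zE.
under eq_bigr => l _ do rewrite (azP l).2.
apply: (vanS_coef FS (fun l => (az l).1) (x := fun l => (az l).2)) => l.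
by case: (azP l).
Qed.

Lemma secantE p : secant k (veronese_linear K n d L) p <->
  (forall v, v \in pline p -> inS k L v).
Proof.
split=> [h v vp e F Fe FS|h e F Fe FB v vp].
  apply: (h e F Fe) => //.
  have /vanS_secant := Fe; case=> _ /(_ FS) h1 q qB; apply: h1.
  by move=> e' G _; apply.
apply: (h v vp e F Fe); apply/(vanS_secant Fe) => q; apply; first exact: Fe.
exact: FB.
Qed.

Lemma inSZ c v : inS k L v -> inS k L (c *: v).
Proof. by move=> h e F Fe FS; rewrite (meval_homogZ _ _ Fe) (h e F Fe FS) mulr0. Qed.

Lemma secant_mkptE v (v0 : v != 0) :
  secant k (veronese_linear K n d L) (mkpt v0) <-> inS k L v.
Proof.
rewrite secantE; split => [|h u /= /vlineP[c ->]]; last exact: inSZ.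
by apply; exact: memv_line.
Qed.

Lemma secantP p : secant k (veronese_linear K n d L) p <->
  inS k L (vpick (pline p)).
Proof.
rewrite secantE; split => [|h u]; first by apply; exact: memv_pick.
by rewrite pline_vpick => /vlineP[c ->]; exact: inSZ.
Qed.

End NonemptyLine.

Lemma vanS_mono k k' L L' F : (k' <= k)%N -> (L' <= L)%VS ->
  vanS k L F -> vanS k' L' F.
Proof.
move=> kk LL FS x xL.
pose x' (l : 'I_k) := if insub (val l) is Some l' then x l' else 0.
have x'L l : x' l \in L.
  rewrite /x'; case: insubP => [l' _ _|_]; last exact: mem0v.
  by apply: (subvP LL).
have := FS x' x'L; set s := \sum_l _; set s' := \sum_l _ => FSx.
suff -> : s' = s by [].
rewrite /s; apply/esym; rewrite (bigID (fun l : 'I_k => (l < k')%N)) /= [X in _ + X]big1 ?addr0.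
  rewrite (big_ord_narrow kk) /=; apply: eq_bigr => l _; rewrite /x'.
  case: insubP => [l' _ e|]; last by rewrite /= ltn_ord.
  by congr (veronese_vec d (x _)); apply: val_inj.
by move=> l /negPf lk; rewrite /x' insubF // veronese_vec0.
Qed.

Lemma inS_mono k k' L L' v : (k' <= k)%N -> (L' <= L)%VS ->
  inS k' L' v -> inS k L v.
Proof. by move=> kk LL h e F Fe FS; apply: (h e F Fe); apply: vanS_mono FS. Qed.

End SecantCone.

(** * Annihilators, kernels and minors *)

Section LinearAlgebra.

Variable K : fieldType.

Lemma annihilator_exists m (U : {vspace 'rV[K]_m}) : (\dim U < m)%N ->
  exists2 c : 'cV[K]_m, c != 0 & forall w, w \in U -> w *m c = 0.
Proof.
move=> Um; pose B : 'M[K]_(\dim U, m) := \matrix_i (vbasis U)`_i.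
have [c cB c0] : exists2 c : 'rV_m, c *m B^T = 0 & c != 0.
  have : kermx B^T != 0.
    rewrite -mxrank_eq0 mxrank_ker -lt0n subn_gt0.
    by apply: leq_ltn_trans Um; rewrite mxrank_tr rank_leq_row.
  by case/rowV0Pn => c /sub_kermxP cB c0; exists c.
exists c^T => [|w wU]; first by rewrite trmx_eq0.
rewrite (coord_vbasis wU) mulmx_suml big1 // => i _.
rewrite -scalemxAl; have -> : (vbasis U)`_i = row i B by rewrite rowK.
rewrite -row_mul; have -> : B *m c^T = 0 by rewrite -[B]trmxK -trmx_mul cB trmx0.
by rewrite row0 scaler0.
Qed.

Lemma dim_le_forms m r (T : {vspace 'rV[K]_m}) (A : 'M[K]_(m, r)) :
  (forall w, w \in T -> w *m A = 0 -> w = 0) -> (\dim T <= r)%N.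
Proof.
move=> h; pose f : 'Hom('rV[K]_m, 'rV[K]_r) := linfun (mulmxr A).
have := limg_ker_dim f T.
have -> : (T :&: lker f)%VS = 0%VS.
  apply/eqP; rewrite -subv0; apply/subvP => w; rewrite memv_cap memv_ker lfunE /=.
  by move=> /andP[wT /eqP wA]; rewrite (h w wT wA) mem0v.
rewrite dimv0 add0n => <-; apply: leq_trans (dimvS (subvf _)) _.
by rewrite dimvf /dim /= mul1n.
Qed.

Lemma dim_ge_forms m r (T : {vspace 'rV[K]_m}) (A : 'M[K]_(m, r)) :
  (forall c : 'cV[K]_r, (forall w, w \in T -> w *m A *m c = 0) -> c = 0) ->
  (r <= \dim T)%N.
Proof.
move=> h; pose f : 'Hom('rV[K]_m, 'rV[K]_r) := linfun (mulmxr A).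
apply: (@leq_trans (\dim (f @: T)%VS)); last first.
  by rewrite -(limg_ker_dim f T) leq_addl.
rewrite leqNgt; apply/negP => /annihilator_exists[c c0 cU]; case/eqP: c0.
apply: h => w wT; have := cU (f w); rewrite lfunE /=; apply.
by have := memv_img f wT; rewrite lfunE.
Qed.

Lemma unit_minor m p (A : 'M[K]_(m, p)) r : (r <= \rank A)%N ->
  exists (f : 'I_r -> 'I_m) (g : 'I_r -> 'I_p), \det (mxsub f g A) != 0.
Proof.
move=> rA.
have row_minor m' p' (B : 'M[K]_(m', p')) : (r <= \rank B)%N ->
    exists f : 'I_r -> 'I_m', \rank (rowsub f B) = r.
  move=> rB; exists (fun i => maxrankfun B (widen_ord rB i)).
  have : row_free (rowsub (widen_ord rB) (rowsub (maxrankfun B) B)).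
    apply/row_freeP; have /row_freeP[C CE] := maxrowsub_free B.
    exists (colsub (widen_ord rB) C); rewrite -mxsub_mul CE.
    apply/matrixP => i j; rewrite !mxE; congr (_%:R); congr nat_of_bool.
  by rewrite -rowsub_comp /row_free => /eqP.
have [f fr] := row_minor _ _ A rA.
have [g gr] := row_minor _ _ (rowsub f A)^T (eq_leq (esym (etrans (mxrank_tr _) fr))).
exists f, g; rewrite -det_tr -unitfE -[_ \is a _]/(_ \in unitmx) -row_free_unit.
have -> : (mxsub f g A)^T = rowsub g (rowsub f A)^T.
  by apply/matrixP => i j; rewrite !mxE.
by rewrite /row_free gr.
Qed.

Lemma row_kernel (r m : nat) (M : 'M[K]_(r, m)) : (\rank M < r)%N ->
  exists c : 'I_r -> K, (exists i, c i != 0) /\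
    forall j, \sum_i c i * M i j = 0.
Proof.
move=> rM; have : kermx M != 0 by rewrite -mxrank_eq0 mxrank_ker -lt0n subn_gt0.
case/rowV0Pn => c /sub_kermxP cM /rV0Pn[i ci].
exists (c ord0); split; first by exists i.
by move=> j; have := congr1 (fun A : 'rV_m => A ord0 j) cM; rewrite !mxE.
Qed.

Lemma det0_row_kernel r (M : 'M[K]_r) : \det M = 0 ->
  exists c : 'I_r -> K, (exists i, c i != 0) /\ forall j, \sum_i c i * M i j = 0.
Proof.
move=> M0; apply: row_kernel; rewrite ltn_neqAle rank_leq_row andbT.
apply/negP => /eqP rM; have : M \in unitmx by rewrite -row_free_unit /row_free rM.
by rewrite unitmxE unitfE M0 eqxx.
Qed.

Lemma horner_det r (A : 'M[{poly K}]_r) t :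
  (\det A).[t] = \det (\matrix_(i, j) (A i j).[t]).
Proof.
rewrite -horner_evalE -det_map_mx; congr (\det _).
by apply/matrixP => i j; rewrite !mxE.
Qed.

End LinearAlgebra.

Section HomogDet.

Variables (R : comNzRingType) (m : nat).

Lemma dhomog_prod_ord r (e : 'I_r -> nat) (G : 'I_r -> {mpoly R[m]}) :
  (forall i, G i \is (e i).-homog) -> \prod_i G i \is (\sum_i e i)%N.-homog.
Proof.
move=> h; elim/big_rec2: _ => [|i a b _ IH]; first exact: dhomog1.
exact: dhomogM.
Qed.

Lemma dhomog_det r (e : 'I_r -> nat) (A : 'M[{mpoly R[m]}]_r) :
  (forall i j, A i j \is (e i).-homog) -> \det A \is (\sum_i e i)%N.-homog.
Proof.
move=> h; rewrite /determinant; apply: rpred_sum => s _.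
rewrite -signr_odd; case: (odd _); rewrite ?expr1 ?expr0 ?mulN1r ?mul1r ?rpredN.
  exact: dhomog_prod_ord.
exact: dhomog_prod_ord.
Qed.

End HomogDet.

(** * Catalecticants and tangent vectors *)

Section Catalecticant.

Variables (K : closedFieldType) (K0 : [pchar K] =i pred0) (n d : nat).
Hypothesis d_gt0 : (0 < d)%N.
Local Notation N := (veronese_N n d).
Implicit Types (L : {vspace 'rV[K]_n.+1}) (F : {mpoly K[N.+1]}).

Definition linform (f : {mpoly K[n.+1]}) : {mpoly K[N.+1]} :=
  \sum_(l < N.+1) f@_(mon l) *: 'X_l.

Lemma meval_linform f (v : 'rV[K]_N.+1) : (linform f).@[v ord0] = pair v f.
Proof.
rewrite /linform raddf_sum /=; apply: eq_bigr => l _.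
by rewrite mevalZ mevalXU mulrC.
Qed.

Lemma along_linform f (P : 'rV[{poly K}]_N.+1) :
  along (linform f) P = \sum_(l < N.+1) f@_(mon l) *: P ord0 l.
Proof.
rewrite /along /linform raddf_sum /=; apply: eq_bigr => l _.
by rewrite mmapZ mmapX mmap1U mul_polyC.
Qed.

Lemma linform_homog f : linform f \is 1.-homog.
Proof.
by apply: rpred_sum => l _; apply: rpredZ; rewrite dhomogX; apply/eqP/mdeg1.
Qed.

(** A form vanishing on [L] gives a linear equation of the secant variety of [L]; hence [v] only
    sees restrictions of forms to [L]. *)
Lemma inS_kills k L (v : 'rV[K]_N.+1) f : inS k L v -> f \is d.-homog ->
  (forall x, x \in L -> f.@[x ord0] = 0) -> pair v f = 0.
Proof.
move=> vS fd fL; rewrite -meval_linform; apply: (vS 1%N); first exact: linform_homog.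
move=> x xL; rewrite meval_linform pair_suml big1 // => l _.
by rewrite pair_veronese // fL.
Qed.

Section Minor.

Variables (k d1 d2 : nat) (f h : 'I_k.+1 -> {mpoly K[n.+1]}).
Hypotheses (ab : (d1 + d2 = d)%N) (fa : forall i, f i \is d1.-homog).
Hypothesis hb : forall i, h i \is d2.-homog.

(* A combination of the (k + 1)-minors of the catalecticant of bidegree (d1, d2). *)
Definition catdet : {mpoly K[N.+1]} := \det (\matrix_(i, j) linform (f i * h j)).

Lemma catdet_homog : catdet \is k.+1.-homog.
Proof.
have := @dhomog_det _ _ _ (fun _ => 1%N) (\matrix_(i, j) linform (f i * h j)).
rewrite sum1_card card_ord; apply=> i j; rewrite mxE; exact: linform_homog.
Qed.

Lemma meval_catdet (v : 'rV[K]_N.+1) : catdet.@[v ord0] = \det (\matrix_(i, j) pair v (f i * h j)).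
Proof.
rewrite /catdet -det_map_mx; congr (\det _); apply/matrixP => i j.
by rewrite !mxE /= meval_linform.
Qed.

(** At a sum of [k] point evaluations the catalecticant factors through $K^k$, because
    $(f_ih_j)(x)=f_i(x)h_j(x)$; its rank is then at most [k]. *)
Lemma catdet_vanS L : vanS k L catdet.
Proof.
move=> x _; rewrite meval_catdet.
set M := \matrix_(_, _) _; apply/eqP; apply: contraT => M0.
have ME : M = (\matrix_(i < k.+1, l < k) (f i).@[x l ord0]) *m
              (\matrix_(l < k, j < k.+1) (h j).@[x l ord0]).
  apply/matrixP => i j; rewrite !mxE pair_suml; apply: eq_bigr => l _.
  by rewrite !mxE pair_veronese ?mevalM // -ab dhomogM.
have := mxrankM_maxr (\matrix_(i < k.+1, l < k) (f i).@[x l ord0])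
          (\matrix_(l < k, j < k.+1) (h j).@[x l ord0]).
rewrite -ME mxrank_unit ?unitmxE ?unitfE // => /leq_trans/(_ (rank_leq_row _)).
by rewrite ltnn.
Qed.

(* At a point where the last row and the last column of the catalecticant
   minor vanish, its differential is the complementary minor times the
   corner entry. *)
Lemma catdet_tangent (p w : 'rV[K]_N.+1) :
  (forall j, pair p (f ord_max * h j) = 0) ->
  (forall i, pair p (f i * h ord_max) = 0) ->
  \det (\matrix_(i < k, j < k)
     pair p (f (lift ord_max i) * h (lift ord_max j))) != 0 ->
  dird catdet p w = 0 -> pair w (f ord_max * h ord_max) = 0.
Proof.
move=> prow pcol H0; rewrite dirdE.
pose M := \matrix_(i, j) along (linform (f i * h j)) (ray p w).
have -> : along catdet (ray p w) = \det M.
  rewrite /along /catdet -det_map_mx; congr (\det _).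
  by apply/matrixP => i j; rewrite !mxE.
have ME' i j : along (linform (f i * h j)) (ray p w) =
    (pair p (f i * h j))%:P + pair w (f i * h j) *: 'X.
  rewrite along_linform /pair raddf_sum /= scaler_suml -big_split.
  apply: eq_bigr => l _; rewrite mxE scalerDr -!mul_polyC -!polyCM /=.
  by rewrite !mulrA -!polyCM ![_@_ _ * _]mulrC.
have ME i j : M i j = (pair p (f i * h j))%:P + pair w (f i * h j) *: 'X.
  by rewrite mxE ME'.
have dE : \det M = 'X * \sum_j (pair w (f ord_max * h j))%:P * cofactor M ord_max j.
  rewrite (expand_det_row _ ord_max) mulr_sumr; apply: eq_bigr => j _.
  by rewrite ME prow polyC0 add0r -mul_polyC [_%:P * 'X]mulrC -mulrA.
rewrite dE derivM derivX mul1r hornerD hornerM hornerX mul0r addr0.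
(* For [j != ord_max] the cofactor still contains the last column, which vanishes at [t = 0]; only
   the corner term survives. *)
rewrite horner_sum (bigD1 ord_max) //= big1 ?addr0; last first.
  move=> j jm; rewrite hornerM hornerC /cofactor hornerM horner_det.
  rewrite [X in _ * (_ * X)](_ : _ = 0) ?mulr0 //.
  have [c jc] : exists c, ord_max = lift j c.
    have := unliftP j ord_max; case=> [c|] e; first by exists c.
    by rewrite -e eqxx in jm.
  rewrite (expand_det_col _ c) big1 // => i _; rewrite !mxE -jc ME'.
  by rewrite pcol polyC0 add0r hornerZ hornerX mulr0 mul0r.
rewrite hornerM hornerC /cofactor hornerM => /eqP.
rewrite mulf_eq0 => /orP[/eqP //|].
rewrite addnn -signr_odd odd_double expr0 hornerC => /eqP.
rewrite mul1r horner_det => H; case/eqP: H0; rewrite -H.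
congr (\det _); apply/matrixP => i j; rewrite !mxE ME'.
by rewrite hornerD hornerC hornerZ hornerX mulr0 addr0.
Qed.

End Minor.

Lemma horner_dird_along F (P W : 'rV[{poly K}]_N.+1) t :
  (\sum_i along F^`M(i) P * W ord0 i).[t] = dird F (curve_at P t) (curve_at W t).
Proof.
by rewrite horner_sum; apply: eq_bigr => i _; rewrite hornerM horner_along mxE.
Qed.

Lemma dird_curve_off F (P W : 'rV[{poly K}]_N.+1) q : q != 0 ->
  (forall t, q.[t] != 0 -> dird F (curve_at P t) (curve_at W t) = 0) ->
  forall t, dird F (curve_at P t) (curve_at W t) = 0.
Proof.
move=> q0 h t; rewrite -horner_dird_along [X in X.[t]](poly_root_off K0 q0) ?horner0 // => s qs.
by rewrite horner_dird_along h.
Qed.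

Lemma meval_curve_off F (P : 'rV[{poly K}]_N.+1) q : q != 0 ->
  (forall t, q.[t] != 0 -> F.@[(curve_at P t) ord0] = 0) ->
  forall t, F.@[(curve_at P t) ord0] = 0.
Proof.
move=> q0 h t; rewrite -horner_along [X in X.[t]](poly_root_off K0 q0) ?horner0 // => s qs.
by rewrite horner_along h.
Qed.

(* The coefficients a are arbitrary: the case a l0 = 0 follows from the case
   a l0 != 0 by letting a l0 vary. *)
Lemma terracini k F : vanS k fullv F ->
  forall (a : 'I_k -> K) (x : 'I_k -> 'rV[K]_n.+1) l0 y,
  dird F (\sum_l a l *: veronese_vec d (x l)) (dver d (x l0) y) = 0.
Proof.
move=> FS.
have nz (a : 'I_k -> K) x l0 y : a l0 != 0 ->
    dird F (\sum_l a l *: veronese_vec d (x l)) (dver d (x l0) y) = 0.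
  (* Only the point of index [l0] moves, in direction [y]; [F] vanishes identically along the
     resulting curve. *)
  move=> al0; pose y' l := if l == l0 then y else 0.
  pose P : 'rV[{poly K}]_N.+1 := \sum_l (a l)%:P *: vcurve d (ray (x l) (y' l)).
  have P_at t : curve_at P t = \sum_l a l *: veronese_vec d (x l + t *: y' l).
    rewrite curve_at_sum; apply: eq_bigr => l _.
    by rewrite curve_atZ hornerC vcurve_at ray_at.
  have FP : along F P = 0.
    apply: (poly_root_off K0 (oner_neq0 _)) => t _; rewrite horner_along P_at.
    by apply: (vanS_coef d_gt0 FS) => l; exact: memvf.
  have := horner_deriv_along F P 0; rewrite FP derivC hornerC P_at.
  under eq_bigr => l _ do rewrite scale0r addr0.
  have -> : \row_j (P ord0 j)^`().[0] = a l0 *: dver d (x l0) y.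
    apply/rowP => j; rewrite mxE summxE (raddf_sum (@deriv K)) horner_sum (bigD1 l0) //=.
    rewrite big1 ?addr0 => [|l ll0].
      rewrite mxE mul_polyC derivZ hornerZ [RHS]mxE; congr (_ * _).
      have := congr1 (fun r : 'rV_N.+1 => r ord0 j) (vcurve_deriv d (ray (x l0) (y' l0)) 0).
      by rewrite ray_deriv ray_at scale0r addr0 {1}mxE /y' eqxx.
    rewrite mxE mul_polyC derivZ hornerZ.
    have := congr1 (fun r : 'rV_N.+1 => r ord0 j) (vcurve_deriv d (ray (x l) (y' l)) 0).
    rewrite ray_deriv ray_at {1}mxE /y' (negPf ll0) => ->.
    rewrite mxE /dird big1 ?mulr0 // => i _; by rewrite mxE mulr0.
  by rewrite dirdZr => /esym/eqP; rewrite mulf_eq0 (negPf al0) => /eqP.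
move=> a x l0 y.
pose P : 'rV[{poly K}]_N.+1 := \sum_l
  ((a l)%:P + (l == l0)%:R *: 'X) *: map_mx polyC (veronese_vec d (x l)).
have P_at t : curve_at P t =
    \sum_l (a l + (l == l0)%:R * t) *: veronese_vec d (x l).
  rewrite curve_at_sum; apply: eq_bigr => l _.
  by rewrite curve_atZ curve_at_const hornerD hornerC hornerZ hornerX.
have q0 : ((a l0)%:P + 'X : {poly K}) != 0.
  by rewrite addrC -size_poly_eq0 size_XaddC.
have := dird_curve_off (P := P) (W := map_mx polyC (dver d (x l0) y)) q0 _ 0.
rewrite curve_at_const P_at.
under eq_bigr => l _ do rewrite mulr0 addr0.
apply=> t; rewrite hornerD hornerC hornerX => qt.
rewrite P_at curve_at_const; apply: nz.
by rewrite eqxx mul1r.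
Qed.

(** On Veronese vectors the linear form [dird F v] becomes a form [G] of degree [d] in [y]; its
    coefficients are the partial derivatives of [F] at [v], so they vanish with [G]. *)
Lemma dird_veronese_all e F (v : 'rV[K]_N.+1) : F \is e.-homog ->
  (forall y, dird F v (veronese_vec d y) = 0) -> forall w, dird F v w = 0.
Proof.
move=> Fe h w; pose G : {mpoly K[n.+1]} := \sum_j F^`M(j).@[v ord0] *: 'X_[mon j].
have G0 : G = 0.
  apply: (mpoly_fun_eq0 K0) => y; rewrite -(h y) raddf_sum; apply: eq_bigr => j _ /=.
  by rewrite mevalZ veronese_vec_mon.
rewrite /dird big1 // => j _; suff -> : F^`M(j).@[v ord0] = 0 by rewrite mul0r.
have := congr1 (mcoeff (mon j)) G0; rewrite mcoeff0 raddf_sum /= (bigD1 j) //=.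
rewrite mcoeffZ mcoeffX eqxx mulr1 big1 ?addr0 // => i ij.
by rewrite mcoeffZ mcoeffX (inj_eq (@mon_inj _ _)) (negPf ij) mulr0.
Qed.

(* sigma_(k+1) contains the join of p with the Veronese variety, which spans the
   ambient space. *)
Lemma tangent_full k e F (p : 'rV[K]_N.+1) : F \is e.-homog -> vanS k.+1 fullv F ->
  inS k fullv p -> forall w, dird F p w = 0.
Proof.
move=> Fe FS pS; apply: (dird_veronese_all Fe) => y.
pose G : {mpoly K[N.+1]} := \sum_j veronese_vec d y ord0 j *: F^`M(j).
have GE (v : 'rV[K]_N.+1) : G.@[v ord0] = dird F v (veronese_vec d y).
  rewrite raddf_sum; apply: eq_bigr => j _ /=; by rewrite mevalZ mulrC.
rewrite -GE; apply: (pS e.-1).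
  by apply: rpred_sum => j _; apply/rpredZ/dhomog_mderiv.
move=> x _; rewrite GE.
(* The point [y] is added with coefficient 0, so the sum stays that of the [k] given points, yet
   Terracini gives the tangent directions at [y], among them [dver d y y], a multiple of the
   Veronese vector. *)
pose x' (l : 'I_k.+1) := if unlift ord_max l is Some i then x i else y.
pose a (l : 'I_k.+1) : K := (l != ord_max)%:R.
have := terracini FS a x' ord_max y; rewrite {2}/x' unlift_none (dverxx K0) dirdZr.
move=> /eqP; rewrite mulf_eq0 ((pcharf0P K).1 K0) eqn0Ngt d_gt0 /= => /eqP.
rewrite big_ord_recr /= {2}/a eqxx scale0r addr0 => <-; congr (dird F _ _).
apply: eq_bigr => l _.
have -> : widen_ord (leqnSn k) l = lift ord_max l 
  by apply: val_inj; rewrite /= /bump leqNgt ltn_ord.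
by rewrite /a /x' eq_sym neq_lift scale1r liftK.
Qed.

End Catalecticant.

(** * Binary forms and apolarity *)

Section LinearRecurrence.

Variables (K : closedFieldType) (K0 : [pchar K] =i pred0).

Lemma vandermonde_solve a (rho : 'I_a -> K) (s : nat -> K) :
  \det (Vandermonde a (\row_l rho l)) != 0 ->
  exists c : 'I_a -> K, forall j, (j < a)%N -> s j = \sum_l c l * rho l ^+ j.
Proof.
move=> V0; pose V := Vandermonde a (\row_l rho l).
have Vu : V \in unitmx by rewrite unitmxE unitfE.
pose c := invmx V *m (\col_(j < a) s j).
exists (fun l => c l ord0) => j ja.
have := congr1 (fun M : 'cV_a => M (Ordinal ja) ord0) (mulKVmx Vu (\col_(j < a) s j)).
rewrite -/c [in RHS]mxE => <-; rewrite mxE; apply: eq_bigr => l _.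
by rewrite !mxE mulrC.
Qed.

(* The sequence satisfies the linear recurrence with characteristic polynomial
   prod_l (X - r_l).  Perturbing the roots to r_l + l t, which are distinct for
   almost all t, while keeping the a initial values deforms it to power sums. *)
Lemma recurrence_deform (a d : nat) (r : 'I_a -> K) (s : nat -> K) :
  (a <= d)%N ->
  (forall j, (j <= d - a)%N ->
     \sum_(i < d.+1) ((\prod_l ('X - (r l)%:P)) * 'X^j)`_i * s i = 0) ->
  exists (S : nat -> {poly K}) (q : {poly K}),
    [/\ q != 0, forall i, (i <= d)%N -> (S i).[0] = s i &
      forall t, q.[t] != 0 -> exists c : 'I_a -> K,
        forall i, (S i).[t] = \sum_l c l * (r l + l%:R * t) ^+ i].
Proof.
move=> ad rec.
pose rho (l : 'I_a) : {poly K} := (r l)%:P + l%:R *: 'X.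
have rhoE l t : (rho l).[t] = r l + l%:R * t.
  by rewrite hornerD hornerC hornerZ hornerX.
pose G : {poly {poly K}} := \prod_l ('X - (rho l)%:P).
have Gm : G \is monic by apply: monic_prod => l _; apply: monicXsubC.
have sG : size G = a.+1.
  by rewrite size_prod_XsubC /index_enum -enumT size_enum_ord.
pose ev (t : K) : {poly {poly K}} -> {poly K} := map_poly (horner_eval t).
have evG t : ev t G = \prod_l ('X - (r l + l%:R * t)%:P).
  rewrite /ev rmorph_prod; apply: eq_bigr => l _.
  by rewrite rmorphB /= map_polyX map_polyC /= /horner_eval rhoE.
(* The remainder of $X^i$ modulo the characteristic polynomial expresses the term of index [i]
   through the first [a] terms. As [G] is monic over [{poly K}], this expression is polynomial in
   [t]. *)
pose M i := Pdiv.Ring.rmodp 'X^i G; pose Q i := Pdiv.Ring.rdivp 'X^i G.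
have QM i : 'X^i = Q i * G + M i by exact: Pdiv.RingMonic.rdivp_eq.
have evQM t i : 'X^i = ev t (Q i) * ev t G + ev t (M i).
  by rewrite -rmorphM -rmorphD -QM /ev rmorphXn /= map_polyX.
have sM i : (size (M i) <= a)%N.
  by rewrite -ltnS -sG Pdiv.Ring.ltn_rmodp monic_neq0.
have sevM t i : (size (ev t (M i)) <= a)%N.
  by apply: leq_trans (size_poly _ _) _.
pose S i := \sum_(j < a) (M i)`_j * (s j)%:P.
have SE i t : (S i).[t] = \sum_(j < a) (ev t (M i))`_j * s j.
  rewrite horner_sum; apply: eq_bigr => j _.
  by rewrite hornerM hornerC coef_map.
pose q := \det (Vandermonde a (\row_l rho l)).
exists S, q; split.
- rewrite /q det_Vandermonde; apply/prodf_neq0 => i _; apply/prodf_neq0 => j ij.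
  apply/eqP => e; have := congr1 (fun p : {poly K} => p`_1) e.
  rewrite !mxE coefB !coefD !coefC !coefZ !coefX /= ?coef0 !mulr1 !add0r => /eqP.
  rewrite subr_eq0 => /eqP/(natf_inj K0) ji.
  by rewrite ji ltnn in ij.
- move=> i id; rewrite SE.
  pose lin (f : {poly K}) := \sum_(j < d.+1) f`_j * s j.
  have linD f g : lin (f + g) = lin f + lin g.
    by rewrite /lin -big_split; apply: eq_bigr => j _; rewrite coefD mulrDl.
  have eG0 : ev 0 G = \prod_l ('X - (r l)%:P).
    by rewrite evG; apply: eq_bigr => l _; rewrite mulr0 addr0.
  have linM (f : {poly K}) : (size f <= (d - a).+1)%N -> lin (f * ev 0 G) = 0.
    move=> sf; rewrite -{1}[f]coefK poly_def mulr_suml.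
    have lin_sum (E : 'I_(size f) -> {poly K}) :
        lin (\sum_(j < size f) E j) = \sum_(j < size f) lin (E j).
      rewrite /lin; under eq_bigr => j _ do rewrite coef_sum mulr_suml.
      by rewrite exchange_big.
    rewrite lin_sum big1 // => j _.
    have jd : (j <= d - a)%N by rewrite -ltnS (leq_trans (ltn_ord j)).
    transitivity (f`_j * lin ((\prod_l ('X - (r l)%:P)) * 'X^j)).
      rewrite /lin mulr_sumr; apply: eq_bigr => l _.
      by rewrite -scalerAl coefZ mulrA eG0 ['X^j * _]mulrC.
    by rewrite /lin rec // mulr0.
  have linX : lin 'X^i = s i.
    rewrite /lin (bigD1 (Ordinal (id : (i < d.+1)%N))) //= coefXn eqxx mul1r.
    rewrite big1 ?addr0 // => j ji; rewrite coefXn.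
    by rewrite -[(j == i :> nat)]/(j == Ordinal (id : (i < d.+1)%N)) (negPf ji) mul0r.
  rewrite -linX (evQM 0 i) linD linM ?add0r.
    rewrite /lin; have ad1 : (a <= d.+1)%N by apply: leqW.
    rewrite (big_ord_widen _ (fun j => (ev 0 (M i))`_j * s j) ad1) big_mkcond.
    apply: eq_bigr => j _; case: ltnP => // aj.
    by rewrite nth_default ?mul0r // (leq_trans (sevM 0 i)).
  have [->|Q0] := eqVneq (ev 0 (Q i)) 0; first by rewrite size_poly0.
  have Gm0 : ev 0 G \is monic by apply: monic_map.
  have : (size (ev 0 (Q i) * ev 0 G)%R <= d.+1)%N.
    have -> : ev 0 (Q i) * ev 0 G = 'X^i - ev 0 (M i).
      by rewrite (evQM 0 i) addrK.
    apply: leq_trans (size_polyD _ _) _.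
    by rewrite size_polyXn size_polyN geq_max ltnS id (leq_trans (sevM 0 i)) // leqW.
  rewrite size_Mmonic // [X in (_ + X)%N](_ : _ = a.+1); last first.
    by rewrite eG0 size_prod_XsubC /index_enum -enumT size_enum_ord.
  by rewrite addnS /= => h; rewrite -subSn // leq_subRL 1?addnC // leqW.
move=> t qt.
have V0 : \det (Vandermonde a (\row_l (r l + l%:R * t))) != 0.
  apply: contraNneq qt => e; rewrite /q horner_det -[X in _ == X]e; apply/eqP.
  by congr (\det _); apply/matrixP => i j; rewrite !mxE horner_exp rhoE.
have [c cE] := vandermonde_solve s V0; exists c => i.
rewrite SE; under eq_bigr => j _ do rewrite cE //.
under eq_bigr => j _ do rewrite mulr_sumr.
rewrite exchange_big; apply: eq_bigr => l _ /=.
(* At a root of [G] a power equals the value of its remainder, so power sums satisfy the same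
   recurrence. *)
have -> : (r l + l%:R * t) ^+ i = (ev t (M i)).[r l + l%:R * t].
  have := congr1 (fun p => p.[r l + l%:R * t]) (evQM t i).
  rewrite hornerD hornerM [(ev t G).[_]](_ : _ = 0) ?mulr0 ?add0r ?hornerXn //.
  by rewrite evG horner_prod (bigD1 l) //= hornerXsubC subrr mul0r.
rewrite (horner_coef_wide _ (sevM t i)) mulr_sumr; apply: eq_bigr => j _.
by rewrite mulrCA.
Qed.

End LinearRecurrence.

Section SizeAlong.

Variables (K : fieldType) (m : nat).

Lemma size_prod_leq_sum (I : Type) (r : seq I) (F : I -> {poly K}) (e : I -> nat) :
  (forall i, size (F i) <= (e i).+1)%N ->
  (size (\prod_(i <- r) F i)%R <= (\sum_(i <- r) e i).+1)%N.
Proof.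
move=> h; elim/big_rec2: _ => [|i a b _ IH]; first by rewrite size_poly1.
apply: leq_trans (size_polyMleq _ _) _.
have := leq_add (h i) IH; rewrite addSn addnS.
by case: (_ + _)%N.
Qed.

Lemma size_ray_exp (v w : 'rV[K]_m) i e : (size ((ray v w ord0 i) ^+ e)%R <= e.+1)%N.
Proof.
apply: leq_trans (size_poly_exp_leq _ _) _; rewrite ltnS.
have s2 : (size (ray v w ord0 i) <= 2)%N.
  rewrite mxE; apply: leq_trans (size_polyD _ _) _.
  rewrite geq_max (leq_trans (size_polyC_leq1 _)) //=.
  by rewrite (leq_trans (size_scale_leq _ _)) // size_polyX.
by rewrite -[X in (_ <= X)%N]mul1n leq_mul2r; case: (size _) s2 => [|[|[]]] //= _; rewrite orbT.
Qed.

Lemma size_along e (f : {mpoly K[m]}) v w : f \is e.-homog ->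
  (size (along f (ray v w)) <= e.+1)%N.
Proof.
move=> /dhomogP fe; rewrite /along /mmap big_seq.
apply: (big_ind (fun p : {poly K} => size p <= e.+1)%N).
- by rewrite size_poly0.
- by move=> p q sp sq; rewrite (leq_trans (size_polyD _ _)) // geq_max sp.
move=> mm /fe /= mme; rewrite mul_polyC (leq_trans (size_scale_leq _ _)) //.
rewrite -[X in (_ <= X.+1)%N]mme mdegE; apply: size_prod_leq_sum => i.
exact: size_ray_exp.
Qed.

End SizeAlong.

(** * Coordinates adapted to a line *)

Section Frame.

Variables (K : closedFieldType) (K0 : [pchar K] =i pred0) (n d : nat).
Hypotheses (n_gt0 : (0 < n)%N) (d_gt0 : (0 < d)%N).
Local Notation N := (veronese_N n d).
Variables (U : 'M[K]_n.+1) (Uu : U \in unitmx).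
Implicit Types (f g h : {mpoly K[n.+1]}) (p w : 'rV[K]_N.+1) (v : 'rV[K]_n.+1).

(* The basis of linear forms dual to the rows of U. *)
Definition xi (j : 'I_n.+1) : {mpoly K[n.+1]} := \sum_l invmx U l j *: 'X_l.

Lemma meval_xi j v : (xi j).@[v ord0] = (v *m invmx U) ord0 j.
Proof.
rewrite mxE raddf_sum; apply: eq_bigr => l _ /=.
by rewrite mevalZ mevalXU mulrC.
Qed.

Lemma xi_homog j : xi j \is 1.-homog.
Proof.
by apply: rpred_sum => l _; apply: rpredZ; rewrite dhomogX; apply/eqP/mdeg1.
Qed.

Lemma xi_row i j : (xi j).@[(row i U) ord0] = (i == j)%:R.
Proof. by rewrite meval_xi -row_mul mulmxV // !mxE. Qed.

Lemma xi_coord v : v = \sum_j (xi j).@[v ord0] *: row j U.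
Proof.
rewrite -[LHS](mulmxKV Uu) mulmx_sum_row; apply: eq_bigr => j _.
by rewrite meval_xi.
Qed.

Lemma xi_lin j (a b : K) v v' : (xi j).@[(a *: v + b *: v') ord0] =
  a * (xi j).@[v ord0] + b * (xi j).@[v' ord0].
Proof. by rewrite !meval_xi mulmxDl -!scalemxAl !mxE. Qed.

Definition i1 : 'I_n.+1 := inord 1.

Lemma i1E : (i1 : nat) = 1%N.
Proof. by rewrite /i1 inordK. Qed.

Lemma i1_neq0 : (i1 == ord0) = false.
Proof. by apply/negP => /eqP /(congr1 val); rewrite /= i1E. Qed.

Local Notation u0 := (row ord0 U).
Local Notation u1 := (row i1 U).
Local Notation onL a b := (a *: u0 + b *: u1).

Lemma xi0_onL (a b : K) : (xi ord0).@[(onL a b) ord0] = a.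
Proof. by rewrite xi_lin !xi_row eqxx i1_neq0 mulr1 mulr0 addr0. Qed.

Lemma xi1_onL (a b : K) : (xi i1).@[(onL a b) ord0] = b.
Proof. by rewrite xi_lin !xi_row eqxx eq_sym i1_neq0 mulr1 mulr0 add0r. Qed.

Lemma xij_onL (a b : K) (j : 'I_n.+1) : (1 < j)%N -> (xi j).@[(onL a b) ord0] = 0.
Proof.
move=> j1; rewrite xi_lin !xi_row.
have -> : (ord0 == j) = false by apply/negP => /eqP e; rewrite -e in j1.
have -> : (i1 == j) = false by apply/negP => /eqP e; rewrite -e i1E in j1.
by rewrite !mulr0 addr0.
Qed.

Definition bmon e i : {mpoly K[n.+1]} := xi ord0 ^+ (e - i) * xi i1 ^+ i.

Lemma bmon_homog e i : (i <= e)%N -> bmon e i \is e.-homog.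
Proof.
move=> ie; rewrite -[X in X.-homog](subnK ie) /bmon -{2}(mul1n (e - i)%N).
by rewrite -{4}(mul1n i); apply: dhomogM; apply: dhomogMn; exact: xi_homog.
Qed.

Lemma bmon_onL e i (a b : K) : (bmon e i).@[(onL a b) ord0] = a ^+ (e - i) * b ^+ i.
Proof. by rewrite mevalM !rmorphXn /= xi0_onL xi1_onL. Qed.

Lemma bmonM e e' i i' : (i <= e)%N -> (i' <= e')%N ->
  bmon e i * bmon e' i' = bmon (e + e') (i + i').
Proof.
move=> ie ie'; rewrite /bmon mulrACA -!exprD; congr (_ ^+ _ * _).
by rewrite addnBA // addnBAC // subnDA.
Qed.

Definition bcoef f i : K := (along f (ray u0 u1))`_i.

Lemma along_bmon e i : along (bmon e i) (ray u0 u1) = 'X^i.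
Proof.
apply/eqP; rewrite -subr_eq0; apply/eqP.
apply: (poly_root_off K0 (oner_neq0 _)) => t _.
rewrite hornerD hornerN horner_along ray_at -[u0]scale1r bmon_onL expr1n mul1r.
by rewrite hornerXn subrr.
Qed.

(** For [a != 0] this is homogeneity after dividing by [a]; both sides being polynomial in [a], the
    value [a = 0] follows. *)
Lemma bin_eval e f (a b : K) : f \is e.-homog ->
  f.@[(onL a b) ord0] = \sum_(i < e.+1) bcoef f i * (a ^+ (e - i) * b ^+ i).
Proof.
move=> fe.
have H t : t != 0 -> f.@[(onL t b) ord0] =
    \sum_(i < e.+1) bcoef f i * (t ^+ (e - i) * b ^+ i).
  move=> t0; have -> : onL t b = t *: (u0 + (b / t) *: u1).
    by rewrite scalerDr scalerA mulrCA mulfV // mulr1.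
  rewrite (meval_homogZ _ _ fe) -ray_at -horner_along.
  rewrite (horner_coef_wide _ (size_along _ _ fe)) mulr_sumr.
  apply: eq_bigr => i _; rewrite mulrCA; congr (_ * _).
  have ie : (i <= e)%N by rewrite -ltnS.
  rewrite exprMn exprVn -{1}(subnK ie) exprD -mulrA; congr (_ * _).
  by rewrite mulrCA mulfV ?mulr1 // expf_neq0.
pose Q : {poly K} := \sum_(i < e.+1) (bcoef f i * b ^+ i) *: 'X^(e - i).
have : along f (ray (b *: u1) u0) - Q = 0.
  apply: (poly_root_off K0 (q := 'X)) => [|t]; first by rewrite polyX_eq0.
  rewrite hornerX => t0; rewrite hornerD hornerN horner_along ray_at addrC.
  rewrite addrC [b *: u1 + _]addrC H // horner_sum; apply/eqP.
  rewrite subr_eq0; apply/eqP; apply: eq_bigr => i _.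
  by rewrite hornerZ hornerXn -mulrA [b ^+ i * _]mulrC.
move/(congr1 (fun q : {poly K} => q.[a])); rewrite horner0 hornerD hornerN.
move/eqP; rewrite subr_eq0 horner_along ray_at [b *: u1 + _]addrC => /eqP ->.
rewrite horner_sum; apply: eq_bigr => i _.
by rewrite hornerZ hornerXn -mulrA [b ^+ i * _]mulrC.
Qed.

Definition vanL f := forall a b : K, f.@[(onL a b) ord0] = 0.

Lemma bin_reduce e f : f \is e.-homog ->
  vanL (f - \sum_(i < e.+1) bcoef f i *: bmon e i).
Proof.
move=> fe a b; apply/eqP; rewrite mevalB subr_eq0; apply/eqP.
rewrite (bin_eval _ _ fe) (raddf_sum (meval _)) /=; apply: eq_bigr => i _.
by rewrite mevalZ bmon_onL.
Qed.

(** Membership in the linear span of the rational normal curve of the line: as a functional, [p]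
    factors through restriction to the line. *)
Definition killsL p := forall f, f \is d.-homog -> vanL f -> pair p f = 0.

Lemma pair_bin p f : killsL p -> f \is d.-homog ->
  pair p f = \sum_(i < d.+1) bcoef f i * pair p (bmon d i).
Proof.
move=> pL fd.
have hd : f - \sum_(i < d.+1) bcoef f i *: bmon d i \is d.-homog.
  apply: rpredB => //; apply: rpred_sum => i _; apply: rpredZ.
  by apply: bmon_homog; rewrite -ltnS.
have /eqP := pL _ hd (bin_reduce fd).
rewrite pairBr pair_sumr subr_eq0 => /eqP ->.
by apply: eq_bigr => i _; rewrite pairZr.
Qed.

(** The functional taking the coefficient of index [i] of the restriction to the line. *)
Definition bvec i : 'rV[K]_N.+1 := \row_j bcoef 'X_[mon j] i.

Lemma kills_bvec p : killsL p ->
  p = \sum_(i < d.+1) pair p (bmon d i) *: bvec i.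
Proof.
move=> pL; apply/rowP => j; rewrite -pair_mon pair_bin ?mon_homog // summxE.
by apply: eq_bigr => i _; rewrite !mxE mulrC.
Qed.

Lemma veronese_bvec (t : K) :
  veronese_vec d (u0 + t *: u1) = \sum_(i < d.+1) t ^+ i *: bvec i.
Proof.
apply/rowP => j; rewrite veronese_vec_mon -{1}[u0]scale1r (bin_eval _ _ (mon_homog K j)).
rewrite summxE; apply: eq_bigr => i _.
by rewrite !mxE expr1n mul1r mulrC.
Qed.

Lemma bcoef_bmonM e f i j : (i <= e)%N ->
  bcoef (f * bmon e i) j = (along f (ray u0 u1) * 'X^i)`_j.
Proof. by move=> ie; rewrite /bcoef alongM along_bmon. Qed.

(** Apolarity of [g] is the recurrence for the sequence [pair p (bmon d i)], so [recurrence_deform]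
    applies. The factorization of [along g] into [e] linear factors says that [g] has no root at
    infinity, that is at [u1]. *)
Lemma apolar_deform e p g c (r : 'I_e -> K) : killsL p -> (e <= d)%N ->
  g \is e.-homog -> c != 0 ->
  along g (ray u0 u1) = c *: \prod_l ('X - (r l)%:P) ->
  (forall h, h \is (d - e).-homog -> pair p (g * h) = 0) ->
  exists (P : 'rV[{poly K}]_N.+1) (q : {poly K}),
    [/\ q != 0, curve_at P 0 = p &
      forall t, q.[t] != 0 -> exists c : 'I_e -> K,
        curve_at P t =
        \sum_l c l *: veronese_vec d (u0 + (r l + l%:R * t) *: u1)].
Proof.
move=> pL ad ge c0 gE pg.
have rec j : (j <= d - e)%N ->
    \sum_(i < d.+1) ((\prod_l ('X - (r l)%:P)) * 'X^j)`_i * pair p (bmon d i) = 0.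
  move=> jd; set s := \sum_(i < d.+1) _.
  have gd : g * bmon (d - e) j \is d.-homog.
    by rewrite -[X in X.-homog](subnKC ad); apply: dhomogM => //; exact: bmon_homog.
  have : pair p (g * bmon (d - e) j) = c * s.
    rewrite (pair_bin pL gd) mulr_sumr; apply: eq_bigr => i _.
    by rewrite bcoef_bmonM // gE -scalerAl coefZ -mulrA.
  rewrite pg; last exact: bmon_homog.
  by move=> /esym/eqP; rewrite mulf_eq0 (negPf c0) => /eqP.
have [S [q [q0 S0 Sq]]] :=
  @recurrence_deform K K0 e d r (fun i => pair p (bmon d i)) ad rec.
exists (\sum_(i < d.+1) S i *: map_mx polyC (bvec i)), q; split => //.
  rewrite curve_at_sum [RHS](kills_bvec pL); apply: eq_bigr => i _.
  by rewrite curve_atZ curve_at_const S0 // -ltnS.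
move=> t /Sq [b bE]; exists b; rewrite curve_at_sum.
under [RHS]eq_bigr => l _ do rewrite veronese_bvec scaler_sumr.
rewrite exchange_big; apply: eq_bigr => i _ /=.
rewrite curve_atZ curve_at_const bE scaler_suml; apply: eq_bigr => l _.
by rewrite scalerA.
Qed.

End Frame.

Section LineFrames.

Variables (K : closedFieldType) (n : nat).
Hypothesis n_gt0 : (0 < n)%N.
Implicit Types (L : {vspace 'rV[K]_n.+1}).

Definition frame_of L (U : 'M[K]_n.+1) : Prop :=
  U \in unitmx /\
  forall x, x \in L <-> exists a b, x = a *: row ord0 U + b *: row (i1 n) U.

(** Both frame vectors can be prescribed: [u] is at parameter [t = 0] of the line and [v] at
    infinity. Later [v] avoids the roots of an apolar form and [u] is a point of interest. *)
Lemma line_frame L u v : \dim L = 2%N -> u \in L -> v \in L -> v != 0 ->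
  u \notin <[v]>%VS ->
  exists U, [/\ frame_of L U, row ord0 U = u & row (i1 n) U = v].
Proof.
move=> dL uL vL v0 uv.
have u0 : u != 0 by apply: contraNneq uv => ->; rewrite mem0v.
have uvI : (<[u]> :&: <[v]> = 0)%VS.
  apply/eqP; rewrite -subv0; apply/subvP => x; rewrite memv_cap memv0.
  move=> /andP[/vlineP[c ->] cu]; rewrite scaler_eq0 (negPf u0) orbF.
  apply: contraR uv => c0; have := memvZ c^-1 cu.
  by rewrite scalerA mulVf // scale1r.
have LE : (<[u]> + <[v]>)%VS = L.
  apply/eqP; rewrite eqEdim subv_add -!memvE uL vL /= dL.
  by rewrite dimv_disjoint_sum // !dim_vline u0 v0.
pose X := [:: u; v] ++ vbasis (L^C)%VS.
have sX : size X = n.+1.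
  rewrite size_cat (size_tuple (vbasis _)) dimv_compl dL dimvf /dim /= mul1n.
  by rewrite subnKC.
pose U : 'M[K]_n.+1 := \matrix_i X`_i.
have spanX x : exists c : 'rV[K]_n.+1, x = c *m U.
  have : x \in (L + L^C)%VS by rewrite addv_complf memvf.
  move=> /memv_addP[y yL [z zC ->]].
  move: yL; rewrite -LE => /memv_addP[_ /vlineP[a ->] [_ /vlineP[b ->] ->]].
  (* The basis of the complement starts at index 2, whence the shift; the default 0 of [insub] is
     never reached. *)
  pose c : 'rV[K]_n.+1 := \row_i (if i == 0 :> nat then a else
    if i == 1 :> nat then b else
    if insub (i - 2)%N is Some l then coord (vbasis (L^C)%VS) l z else 0).
  exists c; rewrite mulmx_sum_row.
  under eq_bigr => i _ do rewrite rowK [c _ _]mxE.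
  pose G (i : nat) := (if i == 0 :> nat then a else
    if i == 1 :> nat then b else
    if insub (i - 2)%N is Some l then coord (vbasis (L^C)%VS) l z else 0) *: X`_i.
  have tailE m : m = (\dim (L^C)%VS + 2)%N -> \sum_(2 <= i < m) G i = z.
    move=> ->; rewrite -{1}[2%N]add0n big_addn addnK big_mkord.
    rewrite [RHS](coord_vbasis zC); apply: eq_bigr => i _.
    rewrite /G addn2 /= !subSS subn0 (insubT (fun m => m < _)%N (ltn_ord i)) /=.
    by congr (coord _ _ _ *: _); apply: val_inj.
  rewrite -(big_mkord xpredT G) big_ltn // big_ltn // addrA tailE //.
  by rewrite -[LHS]sX size_cat (size_tuple (vbasis _)) addnC.
have Uu : U \in unitmx.
  have [C CE] := fin_all_exists (fun i : 'I_n.+1 => spanX (delta_mx 0 i)).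
  have : (\matrix_i C i) *m U = 1%:M.
    by apply/row_matrixP => i; rewrite row_mul rowK -CE rowE mulmx1.
  by case/mulmx1_unit.
have r0 : row ord0 U = u by rewrite rowK.
have r1 : row (i1 n) U = v by rewrite rowK i1E.
exists U; split => //; split => // x; rewrite r0 r1; split => [|[a [b ->]]].
  rewrite -LE => /memv_addP[_ /vlineP[a ->] [_ /vlineP[b ->] ->]].
  by exists a, b.
by rewrite memvD ?memvZ.
Qed.

Lemma line_frame2 L v : \dim L = 2%N -> v \in L -> v != 0 ->
  exists u, [/\ u \in L, u != 0 & u \notin <[v]>%VS].
Proof.
move=> dL vL v0; apply: contrapT => h.
have : (L <= <[v]>)%VS.
  apply/subvP => u uL; apply: contrapT => /negP uv; apply: h; exists u; split => //.
  by apply: contraNneq uv => ->; rewrite mem0v.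
by move/dimvS; rewrite dL dim_vline v0.
Qed.

Lemma frame1 L v : \dim L = 2%N -> v \in L -> v != 0 ->
  exists U, frame_of L U /\ row (i1 n) U = v.
Proof.
move=> dL vL v0; have [u [uL u0 uv]] := line_frame2 dL vL v0.
by have [U [FU _ r1]] := line_frame dL uL vL v0 uv; exists U.
Qed.

Lemma frame0 L v : \dim L = 2%N -> v \in L -> v != 0 ->
  exists U, frame_of L U /\ row ord0 U = v.
Proof.
move=> dL vL v0; have [u [uL u0 uv]] := line_frame2 dL vL v0.
have vu : v \notin <[u]>%VS.
  apply: contraNN uv => /vlineP[c vE]; have c0 : c != 0.
    by apply: contraNneq v0 => c0; rewrite vE c0 scale0r.
  by apply/vlineP; exists c^-1; rewrite vE scalerA mulVf // scale1r.
by have [U [FU r0 _]] := line_frame dL vL uL u0 vu; exists U.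
Qed.

Lemma line_neq0 L : \dim L = 2%N -> L != 0%VS.
Proof. by move=> dL; rewrite -dimv_eq0 dL. Qed.

Lemma frame_exists L : \dim L = 2%N -> exists U, frame_of L U.
Proof.
move=> dL; have v0 : vpick L != 0 by rewrite vpick0 line_neq0.
by have [U [FU _]] := frame1 dL (memv_pick L) v0; exists U.
Qed.

Lemma frame_line (U : 'M[K]_n.+1) : U \in unitmx ->
  exists L, \dim L = 2%N /\ frame_of L U.
Proof.
move=> Uu; exists (<[row ord0 U]> + <[row (i1 n) U]>)%VS.
have u0 : row ord0 U != 0.
  apply/eqP => e; have := xi_row Uu ord0 ord0.
  by rewrite e meval_xi mul0mx mxE eqxx => /esym/eqP; rewrite oner_eq0.
have u1 : row (i1 n) U != 0.
  apply/eqP => e; have := xi_row Uu (i1 n) (i1 n).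
  by rewrite e meval_xi mul0mx mxE eqxx => /esym/eqP; rewrite oner_eq0.
split.
  rewrite dimv_disjoint_sum ?dim_vline ?u0 ?u1 //.
  apply/eqP; rewrite -subv0; apply/subvP => x; rewrite memv_cap memv0.
  move=> /andP[/vlineP[a xa] /vlineP[b xb]].
  have := xi0_onL n_gt0 Uu a 0; rewrite scale0r addr0 -xa xb.
  have := xi0_onL n_gt0 Uu 0 b; rewrite scale0r add0r => -> e.
  by rewrite -xb xa -e scale0r.
split=> // x; split => [|[a [b ->]]].
  by move=> /memv_addP[_ /vlineP[a ->] [_ /vlineP[b ->] ->]]; exists a, b.
by apply: memv_add; apply: memvZ; apply: memv_line.
Qed.

End LineFrames.

(** * Apolar forms on a line *)

Section Apolarity.

Variables (K : closedFieldType) (K0 : [pchar K] =i pred0) (n d : nat).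
Hypotheses (n_gt0 : (0 < n)%N) (d_gt0 : (0 < d)%N).
Local Notation N := (veronese_N n d).
Implicit Types (L : {vspace 'rV[K]_n.+1}) (f g h : {mpoly K[n.+1]}).
Implicit Types (p w : 'rV[K]_N.+1) (U : 'M[K]_n.+1).

Lemma frame_onL L U a b : frame_of L U -> a *: row ord0 U + b *: row (i1 n) U \in L.
Proof. by move=> [_ UL]; apply/UL; exists a, b. Qed.

Lemma vanL_frame L U f : frame_of L U -> vanL U f ->
  forall x, x \in L -> f.@[x ord0] = 0.
Proof. by move=> [_ UL] fU x /UL[a [b ->]]. Qed.

Lemma inS_killsL k L U p : frame_of L U -> inS k L p -> killsL U p.
Proof.
move=> FU pS f fd fU; apply: (inS_kills pS) => //; exact: (vanL_frame FU).
Qed.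

(** The value of [g] at the point at infinity is the coefficient of $t^e$, so its non-vanishing
    makes the dehomogenized [g] have exactly [e] roots. *)
Lemma apolar_split e g U : U \in unitmx -> g \is e.-homog ->
  g.@[(row (i1 n) U) ord0] != 0 ->
  exists (c : K) (r : 'I_e -> K), c != 0 /\
    along g (ray (row ord0 U) (row (i1 n) U)) = c *: \prod_l ('X - (r l)%:P).
Proof.
move=> Uu ge; set A := along _ _.
have := bin_eval K0 U 0 1 ge; rewrite scale0r add0r scale1r => ->.
rewrite big_ord_recr /= big1 => [|i _]; last first.
  by rewrite expr0n subn_eq0 leqNgt ltn_ord mul0r mulr0.
rewrite add0r subnn expr0 expr1n !mulr1 -/(bcoef U g e) => c0.
have sA : size A = e.+1.
  apply/eqP; rewrite eqn_leq size_along //=; rewrite ltnNge.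
  by apply: contra c0 => h; rewrite /bcoef nth_default.
have [r rE] := closed_field_poly_normal A.
have A0 : A != 0 by rewrite -size_poly_eq0 sA.
have sr : size r = e.
  apply/eqP; rewrite -eqSS -sA rE size_scale ?lead_coef_eq0 //.
  by rewrite size_prod_XsubC.
exists (lead_coef A), (fun l => r`_l); split; first by rewrite lead_coef_eq0.
by rewrite {1}rE (big_nth 0) sr big_mkord.
Qed.

Lemma apolar_border_rank L e p g x : \dim L = 2%N -> (0 < e <= d)%N ->
  (forall f, f \is d.-homog -> (forall x, x \in L -> f.@[x ord0] = 0) -> pair p f = 0) ->
  g \is e.-homog -> x \in L -> g.@[x ord0] != 0 ->
  (forall h, h \is (d - e).-homog -> pair p (g * h) = 0) ->
  inS e L p.
Proof.
move=> dL /andP[e0 ed] pL ge xL gx pg.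
have x0 : x != 0 by apply: (homog_nonroot_neq0 ge _ gx).
have [U [FU r1]] := frame1 n_gt0 dL xL x0; have [Uu _] := FU.
have pU : killsL U p by move=> f fd fU; apply: pL => //; exact: (vanL_frame FU).
have [c [r [c0 gE]]] : exists (c : K) (r : 'I_e -> K), c != 0 /\
    along g (ray (row ord0 U) (row (i1 n) U)) = c *: \prod_l ('X - (r l)%:P).
  by apply: apolar_split; rewrite ?r1.
have [P [q [q0 P0 Pq]]] := apolar_deform K0 n_gt0 Uu pU ed ge c0 gE pg.
move=> e' F Fe FS; rewrite -P0; apply: (meval_curve_off K0 q0) => t /Pq[b ->].
apply: (vanS_coef d_gt0 FS) => l; rewrite -[row ord0 U]scale1r.
exact: frame_onL.
Qed.

Lemma apolar_bin L U p g e : frame_of L U -> killsL U p -> (e <= d)%N ->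
  g \is e.-homog -> (forall j, (j <= d - e)%N -> pair p (g * bmon U (d - e) j) = 0) ->
  forall h, h \is (d - e).-homog -> pair p (g * h) = 0.
Proof.
move=> [Uu _] pU ed ge gj h hd.
pose b := \sum_(i < (d - e).+1) bcoef U h i *: bmon U (d - e) i.
have bd : b \is (d - e).-homog.
  apply: rpred_sum => i _; apply: rpredZ; apply: bmon_homog; by rewrite -ltnS.
have -> : h = (h - b) + b by rewrite subrK.
rewrite mulrDr pairDr pU ?add0r.
- rewrite mulr_sumr pair_sumr big1 // => i _.
  by rewrite -scalerAr pairZr gj ?mulr0 // -ltnS.
- by rewrite -[X in X.-homog](subnKC ed) dhomogM // rpredB.
by move=> a a'; rewrite mevalM bin_reduce ?mulr0.
Qed.

(** The shift [s = 1] serves combinations divisible by the second coordinate, which vanish at the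
    first frame vector; the other uses have [s = 0]. *)
Lemma bmon_comb_neq0 U e s r (c : 'I_r -> K) : U \in unitmx -> (exists i, c i != 0) ->
  exists t, (\sum_(i < r) c i *: bmon U e (s + i)).@[
    (row ord0 U + t *: row (i1 n) U) ord0] != 0.
Proof.
move=> Uu [i ci]; set g := \sum_(_ < _) _.
have : along g (ray (row ord0 U) (row (i1 n) U)) != 0.
  rewrite /along raddf_sum /=.
  under eq_bigr => j _ do rewrite mmapZ -/(along _ _) along_bmon // mul_polyC.
  apply: contraNneq ci => /(congr1 (fun q : {poly K} => q`_(s + i))).
  rewrite coef0 coef_sum (bigD1 i) //= coefZ coefXn eqxx mulr1 big1 ?addr0 => [->//|].
  move=> j ji; rewrite coefZ coefXn eqn_add2l eq_sym.
  by rewrite -[(j == i :> nat)]/(j == i) (negPf ji) mulr0.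
by move/(poly_nonroot K0) => [t]; rewrite horner_along ray_at => gt; exists t.
Qed.

Lemma apolar_of_coef L U p e (c : 'I_e.+1 -> K) : frame_of L U -> killsL U p ->
  (e <= d)%N -> (exists i, c i != 0) ->
  (forall j, (j <= d - e)%N -> \sum_i c i * pair p (bmon U d (i + j)) = 0) ->
  exists g x, [/\ g \is e.-homog, x \in L, g.@[x ord0] != 0 &
    forall h, h \is (d - e).-homog -> pair p (g * h) = 0].
Proof.
move=> FU pU ed c0 cp; have [Uu _] := FU.
pose g := \sum_(i < e.+1) c i *: bmon U e i.
have ge : g \is e.-homog.
  by apply: rpred_sum => i _; apply: rpredZ; apply: bmon_homog; rewrite -ltnS.
have [t gt] := bmon_comb_neq0 e 0 Uu c0.
exists g, (row ord0 U + t *: row (i1 n) U); split => //.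
  by rewrite -[row ord0 U]scale1r; exact: frame_onL.
apply: (apolar_bin FU pU ed ge) => j jd; rewrite -[RHS](cp j jd).
rewrite mulr_suml pair_sumr; apply: eq_bigr => i _.
by rewrite -scalerAl pairZr bmonM ?subnKC // -ltnS.
Qed.

Lemma apolar_exists L U p e : frame_of L U -> killsL U p -> (e <= d)%N ->
  (\rank (\matrix_(i < e.+1, j < (d - e).+1)
     pair p (bmon U e i * bmon U (d - e) j)) < e.+1)%N ->
  exists g x, [/\ g \is e.-homog, x \in L, g.@[x ord0] != 0 &
    forall h, h \is (d - e).-homog -> pair p (g * h) = 0].
Proof.
move=> FU pU ed; case/row_kernel => c [c0 cM].
apply: (apolar_of_coef FU pU ed c0) => j jd.
rewrite -[RHS](cM (Ordinal (jd : (j < (d - e).+1)%N))); apply: eq_bigr => i _.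
by rewrite mxE bmonM ?subnKC // -ltnS.
Qed.

Lemma binary_border_rank L k p k' : \dim L = 2%N -> (0 < k <= d)%N -> (d < 2 * k)%N ->
  inS k' L p -> inS k L p.
Proof.
move=> dL /andP[k0 kd] dk pS; have [U FU] := frame_exists n_gt0 dL.
have pU := inS_killsL FU pS.
have [|g [x [gk xL gx pg]]] := apolar_exists FU pU kd.
  by apply: leq_ltn_trans (rank_leq_col _) _; rewrite ltnS ltn_subLR // addnn -mul2n.
apply: (apolar_border_rank dL _ _ gk xL gx pg); rewrite ?k0 //.
by move=> f; apply: inS_kills pS.
Qed.

(* Since 2 k = d + 2, p has a decomposition of length k, possibly degenerate,
   through any prescribed point x of the line: the apolar form g of degree k can
   be chosen to vanish at x. *)
Lemma tangent_line L k e F p x y : \dim L = 2%N -> (1 < k)%N -> (2 * k = d + 2)%N ->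
  (forall f, f \is d.-homog -> (forall x, x \in L -> f.@[x ord0] = 0) -> pair p f = 0) ->
  F \is e.-homog -> vanS k fullv F -> x \in L -> x != 0 ->
  dird F p (dver d x y) = 0.
Proof.
move=> dL k1 dk pL Fe FS xL x0.
have kd : (k <= d)%N by lia.
have [U [FU r0]] := frame0 n_gt0 dL xL x0; have [Uu _] := FU.
have kills V : frame_of L V -> killsL V p.
  by move=> FV f fd fV; apply: pL => //; exact: (vanL_frame FV).
(* Dropping the monomial of index 0 forces every combination to vanish at [x], the first frame
   vector. There remain [k] rows against [d - k + 1 = k - 1] columns, so a kernel vector exists. *)
pose M := \matrix_(i < k, j < (d - k).+1) pair p (bmon U k i.+1 * bmon U (d - k) j).
have [c [c0 cM]] : exists c : 'I_k -> K, (exists i, c i != 0) /\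
    forall j, \sum_i c i * M i j = 0.
  by apply: row_kernel; apply: leq_ltn_trans (rank_leq_col _) _; lia.
pose g := \sum_(i < k) c i *: bmon U k i.+1.
have gk : g \is k.-homog.
  by apply: rpred_sum => i _; apply: rpredZ; apply: bmon_homog.
have [t gt] := bmon_comb_neq0 k 1 Uu c0.
have pg : forall h, h \is (d - k).-homog -> pair p (g * h) = 0.
  apply: (apolar_bin FU (kills _ FU) kd gk) => j jd.
  have := cM (Ordinal (jd : (j < (d - k).+1)%N)) => <-.
  rewrite mulr_suml pair_sumr; apply: eq_bigr => i _.
  by rewrite -scalerAl pairZr mxE.
set x' := row ord0 U + _ in gt.
have x'L : x' \in L by rewrite /x' -[row ord0 U]scale1r; exact: frame_onL.
have gx : g.@[x ord0] = 0.
  rewrite /g raddf_sum big1 // => i _ /=; rewrite mevalZ -r0.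
  have := bmon_onL n_gt0 Uu k i.+1 1 0; rewrite scale1r scale0r addr0 => ->.
  by rewrite expr0n mulr0 mulr0.
have x'0 : x' != 0 by apply: (homog_nonroot_neq0 gk _ gt); exact: ltnW.
have xx' : x \notin <[x']>%VS.
  apply/negP => /vlineP[b xE]; have b0 : b != 0.
    by apply: contraNneq x0 => b0; rewrite xE b0 scale0r.
  move/eqP: gx; rewrite xE (meval_homogZ _ _ gk) mulf_eq0 expf_eq0 (negPf b0).
  by rewrite andbF (negPf gt).
(* In the new frame [x] is at parameter 0, hence a root of [g], and [x'], where [g] does not vanish,
   is at infinity. *)
have [V [FV V0 V1]] := line_frame n_gt0 dL xL x'L x'0 xx'; have [Vu _] := FV.
have [b [r [b0 gE]]] : exists (b : K) (r : 'I_k -> K), b != 0 /\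
    along g (ray (row ord0 V) (row (i1 n) V)) = b *: \prod_l ('X - (r l)%:P).
  by apply: apolar_split; rewrite ?V1.
have [l0 rl0] : exists l, r l = 0.
  have := congr1 (fun q : {poly K} => q.[0]) gE.
  rewrite horner_along ray_at scale0r addr0 V0 gx hornerZ => /esym/eqP.
  rewrite mulf_eq0 (negPf b0) horner_prod => /prodf_eq0[l _].
  by rewrite hornerXsubC sub0r oppr_eq0 => /eqP rl; exists l.
have [P [q [q0 P0 Pq]]] := apolar_deform K0 n_gt0 Vu (kills _ FV) kd gk b0 gE pg.
(* The deformation moves the root 0 of index [l0] to [l0 * t], so the tangent vector must travel
   with it; at [t = 0] it is the one at [x] again. *)
pose W : 'rV[{poly K}]_N.+1 := \row_j \sum_i
  along ('X_[mon j])^`M(i) (ray x (l0%:R *: x')) * (y ord0 i)%:P.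
have W_at s : curve_at W s = dver d (x + (l0%:R * s) *: x') y.
  apply/rowP => j; rewrite !mxE horner_sum; apply: eq_bigr => i _.
  by rewrite hornerM hornerC horner_along ray_at scalerA [s * _]mulrC.
have := dird_curve_off K0 (P := P) (W := W) q0 _ 0.
rewrite P0 W_at mulr0 scale0r addr0; apply => s /Pq[cs ->].
rewrite W_at V0 V1.
have := terracini K0 d_gt0 FS cs (fun l => x + (r l + l%:R * s) *: x') l0 y.
by rewrite rl0 add0r.
Qed.

Lemma pair_bvec U i f : U \in unitmx -> f \is d.-homog ->
  pair (bvec d U i) f = bcoef U f i.
Proof.
move=> Uu fd; rewrite [in RHS](homog_mon fd) /bcoef /along raddf_sum coef_sum.
apply: eq_bigr => j _ /=.
by rewrite mxE mmapZ mul_polyC coefZ mulrC.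
Qed.

(** The witness for the non-inclusion in (ii), with [k] one less than there. The middle coefficient
    is apolar to the power [k.+1] of the second coordinate, while its square catalecticant is a
    permutation matrix, turned into the identity by reversing the index of [h]. *)
Lemma bvec_middle U L k : frame_of L U -> d = (2 * k)%N -> (0 < k)%N ->
  inS k.+1 L (bvec d U k) /\ ~ inS k fullv (bvec d U k).
Proof.
move=> FU dE k0; have [Uu UL] := FU; split.
  have dL : \dim L = 2%N.
    have [L' [dL' [_ UL']]] := frame_line n_gt0 Uu.
    suff -> : L = L' by [].
    by apply/vspaceP => x; apply/idP/idP => [/UL/UL'|/UL'/UL].
  have u1L : row (i1 n) U \in L.
    rewrite -[X in X \in _]scale1r -[X in X \in _]add0r -(scale0r (row ord0 U)).
    exact: frame_onL.
  apply: (apolar_border_rank (g := bmon U k.+1 k.+1) (x := row (i1 n) U) dL) => //.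
  - by lia.
  - move=> f fd fL; rewrite pair_bvec // /bcoef.
    suff -> : along f (ray (row ord0 U) (row (i1 n) U)) = 0 by rewrite coef0.
    apply: (poly_root_off K0 (oner_neq0 _)) => t _; rewrite horner_along ray_at.
    by apply: fL; rewrite -[row ord0 U]scale1r; exact: frame_onL.
  - exact: bmon_homog.
  - have := bmon_onL n_gt0 Uu k.+1 k.+1 0 1; rewrite scale0r scale1r add0r => ->.
    by rewrite subnn expr0 expr1n mulr1 oner_neq0.
  move=> h hd; rewrite pair_bvec //; last first.
    have kd : (k.+1 <= d)%N by lia.
    by rewrite -[X in X.-homog](subnKC kd) dhomogM // bmon_homog.
  by rewrite mulrC bcoef_bmonM // coefMXn ltnSn.
move=> pS; pose f (i : 'I_k.+1) := bmon U k i.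
pose h (j : 'I_k.+1) := bmon U k (k - j).
have fk i : f i \is k.-homog by apply: bmon_homog; rewrite -ltnS.
have hk i : h i \is k.-homog by apply: bmon_homog; rewrite leq_subr.
have kk : (k + k = d)%N by lia.
have := pS _ _ (catdet_homog d f h) (catdet_vanS kk fk hk (L := fullv)).
rewrite meval_catdet.
have -> : \matrix_(i, j) pair (bvec d U k) (f i * h j) = 1%:M.
  apply/matrixP => i j; rewrite [LHS]mxE [RHS]mxE.
  have ik : (i <= k)%N by rewrite -ltnS.
  have jk : (j <= k)%N by rewrite -ltnS.
  rewrite bmonM ?leq_subr // kk pair_bvec //; last by apply: bmon_homog; lia.
  rewrite /bcoef along_bmon // coefXn; congr (nat_of_bool _)%:R.
  by rewrite -val_eqE /=; apply/eqP/eqP; lia.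
by rewrite det1 => /eqP; rewrite oner_eq0.
Qed.

End Apolarity.

(** * Dimension bounds by counting monomials *)

Section BinomialBounds.

Lemma leq_expl a b e : (a <= b)%N -> (a ^ e <= b ^ e)%N.
Proof. by case: e => // e ab; rewrite leq_exp2r. Qed.

Lemma bin_leq_exp a b : ('C(a + b, b) <= a.+1 ^ b)%N.
Proof.
elim: b => [|b IH]; first by rewrite bin0.
have := mul_bin_diag (a + b).+1 b => /= E.
rewrite -(leq_pmul2l (ltn0Sn b)) addnS -E expnS mulnA.
by apply: leq_mul => //; rewrite mulSn mulnS; lia.
Qed.

(** Bounds the Hilbert function of a hypersurface of degree [c] in [m + 2] variables: multiples of
    its equation have codimension of order $E^m$ only. *)
Lemma bin_diff_leq m E c : (c <= E)%N ->
  ('C(m.+1 + E, m.+1) <= 'C(m.+1 + (E - c), m.+1) + c * 'C(m + E, m))%N.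
Proof.
elim: c => [|c IH] cE; first by rewrite subn0 mul0n addn0.
apply: leq_trans (IH (ltnW cE)) _.
have -> : (E - c = (E - c.+1).+1)%N by rewrite subnSK.
rewrite mulSn addnS binS addnA leq_add2r leq_add2l addSnnS.
by apply: leq_bin2l; rewrite subnSK // leq_add2l leq_subr.
Qed.

End BinomialBounds.

Section Relations.

Variables (K : closedFieldType) (m : nat).

Lemma homog_relation (I : finType) (P : I -> {mpoly K[m.+1]}) E :
  (forall i, P i \is E.-homog) -> ('C(m + E, m) < #|I|)%N ->
  exists c : I -> K, (exists i, c i != 0) /\ \sum_i c i *: P i = 0.
Proof.
move=> PE cI; pose M := \matrix_(i < #|I|, j < (veronese_N m E).+1)
  (P (enum_val i))@_(mon j).
have [c [[i ci] cM]] : exists c : 'I_#|I| -> K, (exists i, c i != 0) /\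
    forall j, \sum_i c i * M i j = 0.
  apply: row_kernel; apply: leq_ltn_trans (rank_leq_col _) _.
  by rewrite /veronese_N prednK ?bin_gt0 ?leq_addl // -bin_sub ?leq_addl // addnK.
exists (fun i => c (enum_rank i)); split.
  by exists (enum_val i); rewrite enum_valK.
set S := \sum_(_ : I) _.
have SE : S \is E.-homog by apply: rpred_sum => j _; apply: rpredZ.
rewrite (homog_mon SE) big1 // => j _; suff -> : S@_(mon j) = 0 by rewrite scale0r.
rewrite -[RHS](cM j) raddf_sum /= (reindex (@enum_val I predT)) /=; last first.
  by apply: onW_bij; exact: enum_val_bij.
by apply: eq_bigr => l _; rewrite enum_valK mcoeffZ mxE.
Qed.

End Relations.

Section Box.

Variables (K : closedFieldType) (N s M e : nat).
Variables (f : 'I_s -> {mpoly K[N.+1]}) (g : {mpoly K[N.+1]}).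
Hypotheses (fe : forall i, f i \is e.-homog) (ge : g \is e.-homog).

Definition box := {ffun 'I_s -> 'I_M}.

(* The monomial b in the functions f_i / g, cleared of denominators. *)
Definition box_form (b : box) : {mpoly K[N.+1]} :=
  (\prod_i f i ^+ b i) * g ^+ (s * M - \sum_i b i).

Lemma sum_box_leq (b : box) : (\sum_i b i <= s * M)%N.
Proof.
apply: leq_trans (_ : \sum_(i < s) M <= _)%N; last by rewrite sum_nat_const card_ord.
by apply: leq_sum => i _; apply: ltnW.
Qed.

Lemma box_form_homog b : box_form b \is (e * (s * M)).-homog.
Proof.
rewrite -[X in (_ * X)%N](subnKC (sum_box_leq b)) mulnDr; apply: dhomogM.
  by rewrite big_distrr; apply: dhomog_prod_ord => i; apply: dhomogMn.
exact: dhomogMn.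
Qed.

Definition box_poly (c : box -> K) : {mpoly K[s]} :=
  \sum_b c b *: 'X_[[multinom (b i : nat) | i < s]].

Lemma box_poly_neq0 c : (exists b, c b != 0) -> box_poly c != 0.
Proof.
move=> [b cb]; apply: contraNneq cb => /(congr1 (mcoeff [multinom (b i : nat) | i < s])).
rewrite mcoeff0 raddf_sum /= (bigD1 b) //= mcoeffZ mcoeffX eqxx mulr1.
rewrite big1 ?addr0 => [->//|b' bb']; rewrite mcoeffZ mcoeffX.
case: eqP => [/mnmP E|_]; last by rewrite mulr0.
case/eqP: bb'; apply/ffunP => i; apply: val_inj.
by have := E i; rewrite !mnmE.
Qed.

Lemma box_polyE c (v : 'rV[K]_N.+1) : g.@[v ord0] != 0 ->
  (\sum_b c b *: box_form b).@[v ord0] = 0 ->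
  (box_poly c).@[fun i => (f i).@[v ord0] / g.@[v ord0]] = 0.
Proof.
move=> gv; rewrite raddf_sum /= => H.
apply: (mulfI (expf_neq0 (s * M) gv)); rewrite mulr0 -[RHS]H.
rewrite raddf_sum mulr_sumr; apply: eq_bigr => b _ /=.
rewrite !mevalZ mevalX mulrCA; congr (_ * _); rewrite mevalM rmorphXn rmorph_prod /=.
under [in RHS]eq_bigr => i _ do rewrite rmorphXn /=.
under [in LHS]eq_bigr => i _ do rewrite mnmE exprMn.
rewrite big_split /= mulrCA; congr (_ * _).
rewrite -{1}(subnK (sum_box_leq b)) exprD -mulrA prodrXr exprVn mulfV ?mulr1 //.
by rewrite expf_neq0.
Qed.

(** Both upper bounds on dimension end here: a linear relation on [Z] among the $M^s$ cleared
    monomials contradicts algebraic independence, so counting for large [M] suffices. *)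
Lemma box_dependent (Z : set (projpoint K N)) c : (exists b, c b != 0) ->
  vanishes_on (\sum_b c b *: box_form b) Z ->
  ~ (forall F : {mpoly K[s]},
       (forall (z : projpoint K N) (v : 'rV[K]_N.+1),
          Z z -> v \in pline z -> g.@[v ord0] != 0 ->
          F.@[fun i => (f i).@[v ord0] / g.@[v ord0]] = 0) -> F = 0).
Proof.
move=> c0 GZ indep; have := box_poly_neq0 c0; rewrite (indep (box_poly c)) ?eqxx //.
by move=> z v Zz vz gv; apply: box_polyE => //; apply: (GZ z).
Qed.

End Box.

Section Hypersurface.

Variables (K : closedFieldType) (N : nat).

Lemma hypersurface_dim (Z : set (projpoint K N)) h c s : (0 < N)%N ->
  h \is c.-homog -> h != 0 -> vanishes_on h Z -> alg_indep_functions Z s ->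
  (s < N)%N.
Proof.
case: N Z h => // m Z h _ hc h0 hZ [e [f [g [fe ge _ indep]]]]; rewrite ltnNge; apply/negP => Ns.
(* Since $E+1\le(es+1)M$, this choice gives $c(E+1)^m\le c(es+1)^mM^m<M^{m+1}$. *)
pose M := (c * (e * s).+1 ^ m).+1.
pose E := (e * (s * M))%N.
have key : (c * (E.+1) ^ m < M ^ s)%N.
  apply: leq_trans (_ : M ^ m.+1 <= _)%N; last by rewrite leq_pexp2l.
  rewrite expnS; apply: leq_ltn_trans (_ : c * ((e * s).+1 ^ m * M ^ m) < _)%N.
    rewrite leq_mul2l -expnMn leq_expl ?orbT // /E; nia.
  by rewrite mulnA ltn_pmul2r ?expn_gt0.
have binE : ('C(m + E, m) <= E.+1 ^ m)%N by rewrite addnC bin_leq_exp.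
have cB : #|{: box s M}| = (M ^ s)%N by rewrite card_ffun !card_ord.
(* If $E<c$ there are no multiples of [h] in degree [E], but then the space of all forms is already
   small enough: $(E+1)^{m+1}\le c(E+1)^m$. *)
have [cE|Ec] := leqP c E; last first.
  have [|a [a0 aE]] := homog_relation (box_form_homog (M := M) fe ge).
    rewrite cB; apply: leq_ltn_trans key; rewrite addnC.
    apply: leq_trans (bin_leq_exp _ _) _; rewrite expnS.
    by rewrite leq_mul2r Ec orbT.
  apply: (box_dependent a0 _ indep) => z _ v _.
  by rewrite aE meval0.
(* The multiples of [h] are added to the family, so that a relation becomes one modulo [h]. *)
pose I := (box s M + 'I_(veronese_N m.+1 (E - c)).+1)%type.
pose P (i : I) : {mpoly K[m.+2]} := match i with
  | inl b => box_form f g b | inr j => 'X_[mon j] * h end.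
have PE i : P i \is E.-homog.
  case: i => [b|j]; first exact: box_form_homog.
  by rewrite -[X in X.-homog](subnK cE); apply: dhomogM => //; exact: mon_homog.
have [|a [[i ai] aE]] := homog_relation PE.
  rewrite card_sum cB card_ord /veronese_N prednK ?bin_gt0 ?leq_addl //.
  rewrite -[X in (_ < _ + X)%N]bin_sub ?leq_addl // addnK.
  apply: leq_ltn_trans (bin_diff_leq _ cE) _; rewrite addnC ltn_add2r.
  by apply: leq_ltn_trans key; rewrite leq_mul2l binE orbT.
pose u := \sum_j a (inr j) *: 'X_[mon j].
pose G := \sum_b a (inl b) *: box_form f g b.
have Gu : G + u * h = 0.
  rewrite -[RHS]aE big_sumType /=; congr (_ + _).
  by rewrite mulr_suml; apply: eq_bigr => j _; rewrite -scalerAl.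
(* A relation among multiples of [h] alone would read [u * h = 0] with [h != 0], and so be
   trivial. *)
have a0 : exists b, a (inl b) != 0.
  apply: contrapT => nb.
  have ab b : a (inl b) = 0 by apply/eqP; apply: contraT => ?; case: nb; exists b.
  case: i ai => [b|j]; first by rewrite ab eqxx.
  have G0 : G = 0 by rewrite /G big1 // => b _; rewrite ab scale0r.
  move/eqP: Gu; rewrite G0 add0r mulf_eq0 (negPf h0) orbF => /eqP.
  move/(congr1 (mcoeff (mon j))); rewrite mcoeff0 raddf_sum /= (bigD1 j) //=.
  rewrite mcoeffZ mcoeffX eqxx mulr1 big1 ?addr0 => [->|l lj]; first by rewrite eqxx.
  by rewrite mcoeffZ mcoeffX (inj_eq (@mon_inj _ _)) (negPf lj) mulr0.
apply: (box_dependent a0 _ indep) => z Zz v vz.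
have := congr1 (meval (v ord0)) Gu; rewrite meval0 mevalD mevalM (hZ z Zz v vz).
by rewrite mulr0 addr0.
Qed.

End Hypersurface.

Section SecantDimension.

Variables (K : closedFieldType) (n d k : nat).
Hypotheses (d_gt0 : (0 < d)%N) (k_gt0 : (0 < k)%N).
Local Notation N := (veronese_N n d).

Lemma dhomog_comp m r e c (F : {mpoly K[m]}) (lq : m.-tuple {mpoly K[r]}) :
  F \is e.-homog -> (forall i, tnth lq i \is c.-homog) ->
  F \mPo lq \is (c * e).-homog.
Proof.
move=> /dhomogP Fe lqc; rewrite comp_mpolyE big_seq; apply: rpred_sum => mm /Fe /= me.
apply: rpredZ; rewrite -[X in (_ * X)%N]me mdegE big_distrr.
by apply: dhomog_prod_ord => i; apply: dhomogMn.
Qed.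

Let m := (k * n.+1).-1.

Lemma mSE : (k * n.+1 = m.+1)%N.
Proof. by rewrite /m prednK // muln_gt0 k_gt0. Qed.

Definition pvar (l : 'I_k) (i : 'I_n.+1) : 'I_m.+1 := cast_ord mSE (mxvec_index l i).

Definition param : N.+1.-tuple {mpoly K[m.+1]} :=
  [tuple \sum_(l < k) \prod_(i < n.+1) 'X_(pvar l i) ^+ (mon j) i | j < N.+1].

Lemma param_homog j : tnth param j \is d.-homog.
Proof.
rewrite tnth_mktuple; apply: rpred_sum => l _.
have H e : (\sum_i mon j i)%N = e ->
    \prod_(i < n.+1) 'X_(pvar l i) ^+ (mon j) i \is [in K[m.+1], e.-homog].
  move=> <-; apply: dhomog_prod_ord => i.
  rewrite -[X in _ \is X.-homog]mul1n; apply: dhomogMn.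
  by rewrite dhomogX; apply/eqP/mdeg1.
by apply: H; rewrite -mdegE mdeg_mon.
Qed.

Lemma comp_param F : F \mPo param = 0 -> vanS k fullv F.
Proof.
move=> F0 x _.
pose y (j : 'I_m.+1) : K := mxvec (\matrix_(l < k) x l) ord0 (cast_ord (esym mSE) j).
have := congr1 (meval y) F0; rewrite meval0 comp_mpoly_meval => H.
rewrite -[RHS]H; apply: meval_eq => j.
rewrite tnth_mktuple raddf_sum summxE; apply: eq_bigr => l _ /=.
rewrite rmorph_prod mxE; apply: eq_bigr => i _ /=.
by rewrite rmorphXn /= mevalXU /y /pvar cast_ordK mxvecE mxE.
Qed.

(** Pulled back along [param], box monomials become forms of degree [E] in only [m + 1 = k (n + 1)]
    variables; [M] is chosen so that $M^{m+1}$ exceeds the dimension of that space. *)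
Lemma secant_dim_leq (Z : set (projpoint K N)) s :
  (forall e F, F \is e.-homog -> vanS k fullv F -> vanishes_on F Z) ->
  alg_indep_functions Z s -> (s < k * n.+1)%N.
Proof.
move=> FZ [e [f [g [fe ge _ indep]]]]; rewrite mSE ltnNge; apply/negP => ms.
pose M := ((d * e * s).+1 ^ m).+1.
pose E := (d * (e * (s * M)))%N.
have key : ('C(m + E, m) < #|{: box s M}|)%N.
  rewrite card_ffun !card_ord addnC; apply: leq_ltn_trans (bin_leq_exp _ _) _.
  apply: leq_trans (_ : M ^ m.+1 <= _)%N; last by rewrite leq_pexp2l.
  rewrite expnS; apply: leq_ltn_trans (_ : (d * e * s).+1 ^ m * M ^ m < _)%N.
    rewrite -expnMn leq_expl // /E; nia.
  by rewrite ltn_pmul2r ?expn_gt0.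
have PE (b : box s M) : box_form f g b \mPo param \is E.-homog.
  by apply: dhomog_comp; [exact: box_form_homog | exact: param_homog].
have [a [a0 aE]] := homog_relation PE key.
apply: (box_dependent a0 _ indep); apply: (FZ (e * (s * M))%N).
  by apply: rpred_sum => b _; apply: rpredZ; exact: box_form_homog.
apply: comp_param; rewrite raddf_sum /= -[RHS]aE; apply: eq_bigr => b _.
by rewrite comp_mpolyZ.
Qed.

End SecantDimension.

(** * Smoothness of secant varieties *)

Section Dominance.

Variables (K : fieldType) (K0 : [pchar K] =i pred0).

Lemma along_homogZ m e (F : {mpoly K[m]}) (c : {poly K}) P : F \is e.-homog ->
  along F (c *: P) = c ^+ e * along F P.
Proof.
move=> Fe; apply/eqP; rewrite -subr_eq0; apply/eqP.
apply: (poly_root_off K0 (oner_neq0 _)) => t _.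
rewrite hornerD hornerN hornerM horner_exp !horner_along.
have -> : curve_at (c *: P) t = c.[t] *: curve_at P t.
  by apply/rowP => j; rewrite !mxE hornerM.
by rewrite (meval_homogZ _ _ Fe) subrr.
Qed.

(* A polynomial vanishing on every curve through z0 of arbitrary tangent vector
   is zero: look at the lowest degree homogeneous part of its Taylor expansion
   at z0. *)
Lemma mpoly_curves_eq0 m (G : {mpoly K[m]}) (z0 : 'rV[K]_m) :
  (forall h : 'rV[K]_m, exists P : 'rV[{poly K}]_m,
     [/\ curve_at P 0 = z0, \row_j (P ord0 j)^`().[0] = h & along G P = 0]) ->
  G = 0.
Proof.
move=> curves; apply/eqP; apply: contraT => G0.
pose G' := G \mPo [tuple 'X_i + (z0 ord0 i)%:MP | i < m].
have G'E (v : 'rV[K]_m) : G'.@[v ord0] = G.@[(v + z0) ord0].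
  rewrite comp_mpoly_meval; apply: meval_eq => i.
  by rewrite tnth_mktuple mevalD mevalXU mevalC mxE.
have G'0 : G' != 0.
  have [v Gv] := mpoly_fun_neq0 K0 G0; apply: contraNneq Gv => e.
  by rewrite -(subrK z0 v) -G'E e meval0.
have part := pihomog_partitionE (mf := mdeg) (leqnn (msize G')).
have ex : exists i, (pihomog mdeg i G') != 0.
  apply: contrapT => h; case/eqP: G'0; rewrite [LHS]part big1 // => i _.
  by apply/eqP; apply: contraT => hi; case: h; exists (val i).
pose mu := ex_minn ex.
have [Gmu mu_min] : pihomog mdeg mu G' != 0 /\
    forall i, (i < mu)%N -> pihomog mdeg i G' = 0.
  rewrite /mu; case: ex_minnP => i Gi imin; split => // j ji.
  by apply/eqP; apply: contraT => /imin; rewrite leqNgt ji.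
case/eqP: Gmu; apply: (mpoly_fun_eq0 K0) => h.
have [P [P0 P1 GP]] := curves h.
have [Q PQ] : exists Q : 'rV[{poly K}]_m,
    forall j, P ord0 j - (z0 ord0 j)%:P = Q ord0 j * 'X.
  exists (\row_j ((P ord0 j - (z0 ord0 j)%:P) %/ 'X)) => j.
  rewrite mxE divpK // -['X]subr0 -polyC0 dvdp_XsubCl /root hornerD hornerN hornerC.
  by rewrite -P0 mxE subrr.
have Q0 : curve_at Q 0 = h.
  rewrite -P1; apply/rowP => j; rewrite !mxE.
  have := congr1 (fun q : {poly K} => q^`().[0]) (PQ j).
  rewrite derivB derivC subr0 derivM derivX mulr1 => ->.
  by rewrite hornerD hornerM hornerX mulr0 add0r.
have along0 : along G' ('X *: Q) = 0.
  apply: (poly_root_off K0 (oner_neq0 _)) => t _; rewrite horner_along G'E.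
  have := congr1 (fun q : {poly K} => q.[t]) GP; rewrite horner_along horner0 => <-.
  apply: meval_eq => j; rewrite !mxE mulrC.
  by rewrite -PQ hornerD hornerN hornerC subrK.
have along_sum : along G' ('X *: Q) =
    \sum_(i < msize G') 'X^i * along (pihomog mdeg i G') Q.
  rewrite {1}part /along raddf_sum; apply: eq_bigr => i _ /=.
  by rewrite -/(along _ _) (along_homogZ _ _ (pihomogP _ _ _)).
(* The pullback divided by $t^{\mu}$; parts below [mu] are zero, so the truncated exponent is
   harmless. At [t = 0] only the part of degree [mu] evaluated at [h] remains. *)
pose R := \sum_(i < msize G') 'X^(i - mu) * along (pihomog mdeg i G') Q.
have R0 : R = 0.
  have XR : 'X^mu * R = 0.
    rewrite -along0 along_sum mulr_sumr; apply: eq_bigr => i _.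
    have [mi|im] := leqP mu i; first by rewrite mulrA -exprD subnKC.
    by rewrite mu_min // /along raddf0 !mulr0.
  by move/eqP: XR; rewrite mulf_eq0 expf_eq0 polyX_eq0 andbF => /eqP.
have mu_lt : (mu < msize G')%N.
  rewrite ltnNge; apply: contraNN G'0 => mle; rewrite [X in X == _]part big1 // => i _.
  by rewrite mu_min // (leq_trans _ mle).
have := congr1 (fun q : {poly K} => q.[0]) R0; rewrite horner0 horner_sum.
rewrite (bigD1 (Ordinal mu_lt)) //= subnn expr0 mul1r big1 ?addr0.
  by rewrite horner_along Q0.
move=> i imu; have [mi|im] := leqP mu i; last first.
  by rewrite mu_min // /along raddf0 mulr0 horner0.
rewrite hornerM hornerXn expr0n subn_eq0 leqNgt ltn_neqAle mi andbT.
by rewrite eq_sym -[(i == mu :> nat)]/(i == Ordinal mu_lt) imu mul0r.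
Qed.

Lemma minor_rank m p (A : 'M[K]_(m, p)) r (f : 'I_r -> 'I_m) (g : 'I_r -> 'I_p) :
  \det (mxsub f g A) != 0 -> (r <= \rank A)%N.
Proof.
move=> det0; have -> : r = \rank (mxsub f g A).
  by rewrite mxrank_unit // unitmxE unitfE.
have -> : mxsub f g A = rowsub f 1%:M *m A *m colsub g 1%:M.
  by rewrite mulmx_colsub mulmx1 mul_rowsub_mx mul1mx -mxsub_comp.
apply: leq_trans (mxrankM_maxl _ _) _; exact: mxrankM_maxr.
Qed.

(** Replaces the infinitely many differentials of equations at a point by finitely many that span
    them; an independent family is enlarged until it can grow no more. *)
Lemma max_covectors m (S : 'rV[K]_m -> Prop) :
  exists r (B : 'M[K]_(r, m)), [/\ row_free B, forall i, S (row i B) &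
    forall u, S u -> (u <= B)%MS].
Proof.
suff H c : forall r (B : 'M[K]_(r, m)), row_free B -> (forall i, S (row i B)) ->
    (m - r <= c)%N -> exists r (B : 'M[K]_(r, m)), [/\ row_free B,
      forall i, S (row i B) & forall u, S u -> (u <= B)%MS].
  apply: (H m 0 (0 : 'M_(0, m))); last by rewrite subn0.
    by rewrite /row_free mxrank0.
  by case.
elim: c => [|c IH] r B Bf BS cr.
  exists r, B; split => // u _.
  have rm : (r <= m)%N by rewrite -(eqP Bf) rank_leq_col.
  apply: submx_full; rewrite /row_full (eqP Bf) eqn_leq rm /=.
  by rewrite -subn_eq0 -leqn0.
case: (pselect (forall u, S u -> (u <= B)%MS)) => [h|]; first by exists r, B.
move/existsNP => [u /not_implyP[Su /negP uB]].
apply: (IH (r + 1)%N (col_mx B u)).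
- have rk : (\rank B < \rank (col_mx B u))%N -> row_free (col_mx B u).
    rewrite /row_free eqn_leq rank_leq_row /= (eqP Bf) => h.
    by rewrite [X in (X <= _)%N]addn1.
  apply/rk/rank_ltmx; rewrite ltmxE col_mx_sub (negPf uB) andbF andbT.
  by rewrite -addsmxE addsmxSl.
- move=> i; case: (splitP i) => j ij.
    have -> : i = lshift 1 j by apply: val_inj.
    by rewrite rowKu.
  have -> : i = rshift r j by apply: val_inj.
  by rewrite rowKd; rewrite (ord1 j) row_id.
by rewrite addn1 subnS -subn1 leq_subLR add1n.
Qed.

End Dominance.

Section SecantGeometry.

Variables (K : closedFieldType) (K0 : [pchar K] =i pred0) (n d k : nat).
Hypotheses (d_gt0 : (0 < d)%N) (k_gt0 : (0 < k)%N).
Local Notation N := (veronese_N n d).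
Local Notation sigma := (secant k (veronese_variety K n d)).
Implicit Types (x : 'I_k -> 'rV[K]_n.+1) (y : 'M[K]_(k, n.+1)).

Definition psum x : 'rV[K]_N.+1 := \sum_l veronese_vec d (x l).

Definition dpsum x y : 'rV[K]_N.+1 := \sum_l dver d (x l) (row l y).

Definition immersive x := forall y, dpsum x y = 0 -> y = 0.

Definition jac x : 'M[K]_(k * n.+1, N.+1) :=
  \matrix_r dpsum x (vec_mx (delta_mx 0 r)).

Lemma mul_jac x (v : 'rV[K]_(k * n.+1)) : v *m jac x = dpsum x (vec_mx v).
Proof.
have dD y1 y2 : dpsum x (y1 + y2) = dpsum x y1 + dpsum x y2.
  rewrite /dpsum -big_split; apply: eq_bigr => l _; rewrite linearD.
  by apply/rowP => j; rewrite !mxE dirdDr.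
have dZ c y : dpsum x (c *: y) = c *: dpsum x y.
  rewrite /dpsum scaler_sumr; apply: eq_bigr => l _; rewrite linearZ.
  by apply/rowP => j; rewrite !mxE dirdZr.
rewrite mulmx_sum_row [in RHS](row_sum_delta v) linear_sum.
have d0 : dpsum x 0 = 0 by rewrite -(scale0r (0 : 'M_(k, n.+1))) dZ scale0r.
rewrite (big_morph _ dD d0); apply: eq_bigr => r _.
by rewrite rowK linearZ dZ.
Qed.

Lemma immersive_free x : immersive x -> row_free (jac x).
Proof.
move=> xi; rewrite -kermx_eq0; apply/eqP/row_matrixP => r.
rewrite row0 -[LHS]vec_mxK (xi (vec_mx _)) ?linear0 //.
by rewrite -mul_jac -row_mul mulmx_ker row0.
Qed.

Definition segment x x' : 'I_k -> 'rV[{poly K}]_n.+1 :=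
  fun l => ray (x l) (x' l - x l).

Definition psum_curve (X : 'I_k -> 'rV[{poly K}]_n.+1) : 'rV[{poly K}]_N.+1 :=
  \sum_l vcurve d (X l).

Lemma psum_curve_at X t : curve_at (psum_curve X) t = psum (fun l => curve_at (X l) t).
Proof. by rewrite curve_at_sum; apply: eq_bigr => l _; rewrite vcurve_at. Qed.

Lemma segment_at0 x x' l : curve_at (segment x x' l) 0 = x l.
Proof. by rewrite ray_at scale0r addr0. Qed.

Lemma segment_at1 x x' l : curve_at (segment x x' l) 1 = x' l.
Proof. by rewrite ray_at scale1r addrC subrK. Qed.

Lemma psum_curve_at0 x x' : curve_at (psum_curve (segment x x')) 0 = psum x.
Proof. by rewrite psum_curve_at; apply: eq_bigr => l _; rewrite segment_at0. Qed.

Lemma psum_curve_at1 x x' : curve_at (psum_curve (segment x x')) 1 = psum x'.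
Proof. by rewrite psum_curve_at; apply: eq_bigr => l _; rewrite segment_at1. Qed.

(** An invertible maximal minor of the Jacobian at [x0] selects coordinates in which curves through
    [psum x0] have arbitrary velocity, so no polynomial relation holds between them. *)
Lemma dominant_coordinates x0 r : immersive x0 -> (k * n.+1)%N = r ->
  exists c : 'I_r -> 'I_N.+1, forall G : {mpoly K[r]}, G != 0 ->
    exists x, G.@[fun i => psum x ord0 (c i)] != 0.
Proof.
move=> xi e; subst r.
have [f [c fc]] : exists (f : 'I_(k * n.+1) -> 'I_(k * n.+1))
    (c : 'I_(k * n.+1) -> 'I_N.+1), \det (mxsub f c (jac x0)) != 0.
  by apply: unit_minor; rewrite (eqP (immersive_free xi)).
exists c => G G0; apply: contrapT => nx; case/eqP: G0.
apply: (mpoly_curves_eq0 K0 (z0 := \row_i psum x0 ord0 (c i))) => h.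
pose M := mxsub f c (jac x0).
have Mu : M \in unitmx by rewrite unitmxE unitfE.
(* The parameter velocity whose image has the prescribed selected coordinates [h]. *)
pose u := h *m invmx M *m rowsub f 1%:M.
have uE : colsub c (u *m jac x0) = h.
  rewrite -mulmx_colsub /u -mulmxA mul_rowsub_mx mul1mx -mxsub_comp.
  by rewrite -[RHS](mulmxKV Mu).
pose y := vec_mx u.
pose Pc := psum_curve (fun l => ray (x0 l) (row l y)).
have Pc_at t : curve_at Pc t = psum (fun l => x0 l + t *: row l y).
  rewrite psum_curve_at; apply: eq_bigr => l _; by rewrite ray_at.
exists (\row_i Pc ord0 (c i)); split.
- apply/rowP => i; rewrite !mxE.
  have := congr1 (fun v : 'rV_N.+1 => v ord0 (c i)) (Pc_at 0).
  rewrite {1}mxE => ->; rewrite !summxE; apply: eq_bigr => l _.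
  by rewrite scale0r addr0.
- rewrite -uE mul_jac; apply/rowP => i; rewrite !mxE !summxE.
  rewrite (raddf_sum (@deriv K)) horner_sum; apply: eq_bigr => l _.
  have := congr1 (fun v : 'rV_N.+1 => v ord0 (c i))
    (vcurve_deriv d (ray (x0 l) (row l y)) 0).
  by rewrite ray_at ray_deriv scale0r addr0 {1}mxE => ->.
apply: (poly_root_off K0 (oner_neq0 _)) => t _; rewrite horner_along.
apply/eqP; apply: contraT => Gt; case: nx.
exists (fun l => x0 l + t *: row l y); apply: contraNneq Gt => <-.
apply/eqP/meval_eq => i; rewrite !mxE -Pc_at; by rewrite mxE.
Qed.

Lemma fullv_neq0 : fullv != 0%VS :> {vspace 'rV[K]_n.+1}.
Proof. by rewrite -dimv_eq0 dimvf. Qed.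

Lemma psum_secant x (v0 : psum x != 0) : sigma (mkpt v0).
Proof.
rewrite veronese_varietyE; apply/secant_mkptE => //; first exact: fullv_neq0.
by move=> e F Fe FS; apply: FS => l; exact: memvf.
Qed.

Lemma vanS_sigma e F : F \is e.-homog -> (vanishes_on F sigma <-> vanS k fullv F).
Proof. rewrite veronese_varietyE; apply: vanS_secant => //; exact: fullv_neq0. Qed.

Lemma sigma_inS p : sigma p <-> inS k fullv (vpick (pline p)).
Proof. rewrite veronese_varietyE; apply: secantP => //; exact: fullv_neq0. Qed.

Lemma vanishes_at_vpick m e (F : {mpoly K[m.+1]}) (p : projpoint K m) :
  F \is e.-homog -> F.@[(vpick (pline p)) ord0] = 0 -> vanishes_at F p.
Proof.
move=> Fe F0 v; rewrite pline_vpick => /vlineP[c ->].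
by rewrite (meval_homogZ _ _ Fe) F0 mulr0.
Qed.

Lemma psum_neq0_vanS F : ~ vanS k fullv F -> exists x, F.@[(psum x) ord0] != 0.
Proof.
move=> nF; apply: contrapT => nx; apply: nF => x _.
by apply/eqP; apply: contraT => Fx; case: nx; exists x.
Qed.

(** One of the [m + 1] independent coordinates of the cone becomes the common denominator, leaving
    [m] functions on the projective variety. *)
Lemma sigma_alg_indep m x0 : immersive x0 -> (k * n.+1)%N = m.+1 ->
  alg_indep_functions sigma m.
Proof.
move=> xi e; have [c cP] := dominant_coordinates xi e.
have X1 i : 'X_i \is [in K[N.+1], 1.-homog] by rewrite dhomogX; apply/eqP/mdeg1.
exists 1%N, (fun i => 'X_(c (lift ord0 i))), 'X_(c ord0); split => //.
  move=> /(vanS_sigma (X1 _)) X0.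
  have [|x] := cP 'X_ord0.
    apply: contraTneq isT => e0; have := congr1 (meval (fun=> 1)) e0.
    by rewrite mevalXU meval0 => /eqP; rewrite oner_eq0.
  rewrite mevalXU => /eqP; apply; have := X0 x (fun l => memvf _).
  by rewrite mevalXU.
move=> F FZ; apply/eqP; apply: contraT => F0.
pose D := msize F.
(* The homogenization of [F] with one additional factor, so that [G] can be non-zero only where the
   denominator is. *)
pose G : {mpoly K[m.+1]} := 'X_ord0 * \sum_(mm <- msupp F)
  F@_mm *: ((\prod_i 'X_(lift ord0 i) ^+ mm i) * 'X_ord0 ^+ (D - mdeg mm)).
have GE (z : 'I_m.+1 -> K) : z ord0 != 0 ->
    G.@[z] = z ord0 ^+ D.+1 * F.@[fun i => z (lift ord0 i) / z ord0].
  move=> z0; rewrite mevalM mevalXU exprS -mulrA; congr (_ * _).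
  rewrite raddf_sum [F.@[_]]mevalE mulr_sumr; apply: eq_big_seq => mm mmF /=.
  rewrite mevalZ mulrCA; congr (_ * _); rewrite mevalM rmorphXn rmorph_prod /=.
  under eq_bigr => i _ do rewrite rmorphXn /= mevalXU.
  under [in RHS]eq_bigr => i _ do rewrite exprMn.
  rewrite big_split /= mulrCA; congr (_ * _); rewrite mevalXU.
  have mD : (mdeg mm <= D)%N by apply/ltnW/msize_mdeg_lt.
  rewrite -{2}(subnK mD) exprD -mulrA prodrXr -mdegE exprVn mulfV ?mulr1 //.
  by rewrite expf_neq0.
have G0 : G != 0.
  have [v Fv] := mpoly_fun_neq0 K0 F0; apply: contraNneq Fv => G0.
  pose z (i : 'I_m.+1) : K := if unlift ord0 i is Some j then v ord0 j else 1.
  have z0 : z ord0 = 1 by rewrite /z unlift_none.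
  have := GE z; rewrite z0 oner_neq0 => /(_ isT); rewrite G0 meval0 expr1n mul1r.
  move=> ->; apply/eqP/meval_eq => i; by rewrite /z liftK divr1.
have [x Gx] := cP G G0.
have z0 : psum x ord0 (c ord0) != 0.
  by apply: contraNneq Gx => z0; rewrite mevalM mevalXU z0 mul0r.
have v0 : psum x != 0 by apply: contraNneq z0 => ->; rewrite mxE.
move: Gx; rewrite GE // mulf_eq0 negb_or => /andP[_ /eqP]; case.
have := FZ (mkpt v0) (psum x) (@psum_secant x v0) (memv_line _).
rewrite mevalXU => /(_ z0) H; rewrite -[RHS]H; apply: meval_eq => i.
by rewrite mevalXU.
Qed.

Lemma sigma_closed : zariski_closed sigma.
Proof.
move=> p pS e F Fe FB; apply: (pS e F Fe) => q qS; exact: (qS e F Fe FB).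
Qed.

(** The equation of [A] is multiplied by a coordinate that is non-zero at [p], so that its
    non-vanishing yields a non-zero vector even when the equation is constant. *)
Lemma closed_separates (A : set (projpoint K N)) : zariski_closed A ->
  ~ (sigma `<=` A) ->
  exists (F : {mpoly K[N.+1]}) x, [/\ vanishes_on F A, F.@[(psum x) ord0] != 0 &
    forall v : 'rV[K]_N.+1, F.@[v ord0] != 0 -> v != 0].
Proof.
move=> Ac; move/existsNP => [p /not_implyP[pS pA]].
have : ~ (zariski_closure A p) by move=> /Ac.
move/existsNP => [e /existsNP[F /not_implyP[Fe /not_implyP[FA Fp]]]].
have Fv : F.@[(vpick (pline p)) ord0] != 0.
  by apply/eqP => /(vanishes_at_vpick Fe).
have /rV0Pn[j vj] := vpick_projpoint_neq0 p.
have X1 : 'X_j \is [in K[N.+1], 1.-homog] by rewrite dhomogX; apply/eqP/mdeg1.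
have FX : ~ vanS k fullv (F * 'X_j).
  move/sigma_inS: pS => pS /(pS _ _ (dhomogM Fe X1)) /eqP.
  by rewrite mevalM mevalXU mulf_eq0 (negPf Fv) (negPf vj).
have [x Fx] := psum_neq0_vanS FX.
exists (F * 'X_j), x; split => //.
  by move=> q qA v vq; rewrite mevalM (FA q qA v vq) mul0r.
by move=> v; apply: contraNneq => ->; rewrite mevalM mevalXU mxE mulr0.
Qed.

Lemma psum_neq0 : exists x, psum x != 0.
Proof.
pose l0 := Ordinal k_gt0; pose v : 'rV[K]_n.+1 := delta_mx 0 0.
exists (fun l => if l == l0 then v else 0).
rewrite /psum (bigD1 l0) //= big1 ?addr0 => [|l /negPf ->]; last exact: veronese_vec0.
apply: veronese_vec_neq0; apply/rV0Pn; exists 0.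
by rewrite mxE !eqxx oner_neq0.
Qed.

(** The parameters form an affine space: on a segment joining a parameter off [A] to one off [B],
    both equations restrict to non-zero polynomials, hence some parameter avoids both sets. *)
Lemma sigma_irreducible : zariski_irreducible sigma.
Proof.
split; first by have [x x0] := psum_neq0; exists (mkpt x0); exact: psum_secant.
move=> A B Ac Bc AB; apply: contrapT => /not_orP[nA nB].
have [F [x [FA Fx Fn]]] := closed_separates Ac nA.
have [G [x' [GB Gx _]]] := closed_separates Bc nB.
pose P := psum_curve (segment x x').
have FG : along F P * along G P != 0.
  rewrite mulf_neq0 //.
    by apply: contraNneq Fx => e; rewrite -(psum_curve_at0 x x') -horner_along -/P e horner0.
  by apply: contraNneq Gx => e; rewrite -(psum_curve_at1 x x') -horner_along -/P e horner0.
have [t] := poly_nonroot K0 FG.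
rewrite hornerM mulf_eq0 negb_or !horner_along psum_curve_at => /andP[Ft Gt].
case: (AB _ (@psum_secant _ (Fn _ Ft))) => [/FA|/GB] /(_ _ (memv_line _)) /eqP.
  by rewrite (negPf Ft).
by rewrite (negPf Gt).
Qed.

Lemma sigma_sub_dim Z s : Z `<=` sigma -> alg_indep_functions Z s -> (s < k * n.+1)%N.
Proof.
move=> Zs; apply: secant_dim_leq => // e F Fe /(vanS_sigma Fe) FS p /Zs; exact: FS.
Qed.

Lemma sigma_local_dim m x0 p : immersive x0 -> (k * n.+1)%N = m.+1 -> sigma p ->
  local_dim sigma p m.
Proof.
move=> xi e pS; split.
  exists sigma; split => //.
  - exact: sigma_closed.
  - exact: sigma_irreducible.
  split; first exact: (sigma_alg_indep xi e).
  by move=> s /(sigma_sub_dim (@subset_refl _ _)); rewrite e.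
by move=> Z s _ _ Zs _ [/(sigma_sub_dim Zs) + _]; rewrite e.
Qed.

(* Lower semicontinuity of the rank of the differentials at p, along a segment of
   parameters joining a point where they keep their rank to x0. *)
Lemma sigma_tangent_lower x0 p : immersive x0 -> sigma p ->
  exists T, is_tangent_cone sigma p T /\ (k * n.+1 <= \dim T)%N.
Proof.
move=> xi pS; set v0 := vpick (pline p).
pose S (u : 'rV[K]_N.+1) := exists e (F : {mpoly K[N.+1]}),
  [/\ F \is e.-homog, vanS k fullv F & u = \row_i F^`M(i).@[v0 ord0]].
have [c [B [Bf BS BSu]]] := max_covectors S.
pose T : {vspace 'rV[K]_N.+1} := lker (linfun (mulmxr B^T)).
have TE w : (w \in T) = (w *m B^T == 0) by rewrite memv_ker lfunE.
have dirdrow F w : dird F v0 w = (w *m (\row_i F^`M(i).@[v0 ord0])^T) ord0 ord0.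
  by rewrite mxE; apply: eq_bigr => i _; rewrite !mxE mulrC.
have tanT : is_tangent_cone sigma p T.
  move=> w; rewrite TE; split => [/eqP wB e F Fe /(vanS_sigma Fe) FS v|h].
    rewrite pline_vpick -/v0 => /vlineP[a ->]; rewrite -/(dird F (a *: v0) w).
    rewrite (dirdZl _ _ _ Fe) dirdrow.
    have /submxP[C ->] : (\row_i F^`M(i).@[v0 ord0] <= B)%MS.
      by apply: BSu; exists e, F.
    by rewrite trmx_mul mulmxA wB mul0mx mxE mulr0.
  apply/eqP/rowP => i; rewrite [RHS]mxE; have [e [F [Fe FS rE]]] := BS i.
  have := h e F Fe ((vanS_sigma Fe).2 FS) v0 (memv_pick _).
  rewrite -/(dird F v0 w) dirdrow -rE => <-.
  by rewrite !mxE; apply: eq_bigr => j _; rewrite !mxE.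
exists T; split => //.
have [ef efP] := fin_all_exists BS.
have [Fs FsP] := fin_all_exists efP.
have [f [g fg]] : exists (f : 'I_c -> 'I_c) (g : 'I_c -> 'I_N.+1),
    \det (mxsub f g B) != 0 by apply: unit_minor; rewrite (eqP Bf).
(* The minor of the chosen differentials is itself a form; being non-zero at [p], it is non-zero at
   some sum [psum x1]. *)
pose Md : {mpoly K[N.+1]} := \det (\matrix_(i, j) (Fs (f i))^`M(g j)).
have MdE (v : 'rV[K]_N.+1) : Md.@[v ord0] =
    \det (mxsub f g (\matrix_(i < c) \row_j (Fs i)^`M(j).@[v ord0])).
  rewrite /Md -det_map_mx; congr (\det _); by apply/matrixP => i j; rewrite !mxE.
have Mdh : Md \is (\sum_i (ef (f i)).-1)%N.-homog.
  apply: dhomog_det => i j; rewrite mxE; apply: dhomog_mderiv.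
  by case: (FsP (f i)).
have [x1 Mx1] : exists x, Md.@[(psum x) ord0] != 0.
  apply: psum_neq0_vanS => MS; move/sigma_inS: pS => /(_ _ _ Mdh MS) /eqP.
  rewrite MdE; have -> : \matrix_(i < c) \row_j (Fs i)^`M(j).@[v0 ord0] = B.
    by apply/row_matrixP => i; rewrite rowK; case: (FsP i).
  by rewrite (negPf fg).
have [f' [g' fg']] : exists (f : 'I_(k * n.+1) -> 'I_(k * n.+1))
    (g : 'I_(k * n.+1) -> 'I_N.+1), \det (mxsub f g (jac x0)) != 0.
  by apply: unit_minor; rewrite (eqP (immersive_free xi)).
pose X := segment x1 x0; pose P := psum_curve X.
pose Jp : 'M[{poly K}]_(k * n.+1, N.+1) := \matrix_(r, j) \sum_l \sum_i
  along ('X_[mon j])^`M(i) (X l) *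
  (row l (vec_mx (delta_mx 0 r)) ord0 i)%:P.
have JpE t : \matrix_(r, j) (Jp r j).[t] = jac (fun l => curve_at (X l) t).
  apply/matrixP => r j; rewrite !mxE summxE horner_sum; apply: eq_bigr => l _.
  rewrite horner_sum mxE; apply: eq_bigr => i _.
  by rewrite hornerM hornerC horner_along.
pose q := along Md P * \det (mxsub f' g' Jp).
have hq t : (\det (mxsub f' g' Jp)).[t] =
    \det (mxsub f' g' (jac (fun l => curve_at (X l) t))).
  rewrite horner_det; congr (\det _); rewrite -JpE.
  by apply/matrixP => i j; rewrite !mxE.
have q0 : q != 0.
  rewrite mulf_neq0 //.
    apply: contraNneq Mx1 => e.
    by rewrite -(psum_curve_at0 x1 x0) -horner_along -/P e horner0.
  apply: contraNneq fg' => e; have := hq 1; rewrite e horner0.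
  have -> : (fun l => curve_at (X l) 1) = x0 by apply: funext => l; exact: segment_at1.
  by move=> <-.
have [t] := poly_nonroot K0 q0; rewrite hornerM mulf_eq0 negb_or hq horner_along.
rewrite psum_curve_at; set x := fun l => _ => /andP[Mx Jx].
pose A : 'M[K]_(c, N.+1) := \matrix_i \row_j (Fs i)^`M(j).@[(psum x) ord0].
have rA : (c <= \rank A)%N by apply: (minor_rank (f := f) (g := g)); rewrite -MdE.
have rJ : (k * n.+1 <= \rank (jac x))%N by exact: minor_rank Jx.
(* By Terracini the differentials kill the image of the Jacobian, so [c + k (n + 1) <= N + 1],
   whereas [T] has codimension at most [c]. *)
have JA : jac x *m A^T = 0.
  apply/matrixP => r i; rewrite [RHS]mxE.
  have [_ FS _] := FsP i.
  transitivity (dird (Fs i) (psum x) (dpsum x (vec_mx (delta_mx 0 r)))).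
    rewrite mxE; apply: eq_bigr => j _; by rewrite !mxE mulrC.
  have -> : dird (Fs i) (psum x) (dpsum x (vec_mx (delta_mx 0 r))) =
      \sum_l dird (Fs i) (psum x) (dver d (x l) (row l (vec_mx (delta_mx 0 r)))).
    rewrite /dpsum (big_morph (dird (Fs i) (psum x)) (dirdDr _ _) (_ : _ = 0)) //.
    by rewrite -(scale0r (0 : 'rV_N.+1)) dirdZr mul0r.
  rewrite big1 // => l _.
  have := terracini K0 d_gt0 FS (fun=> 1) x l (row l (vec_mx (delta_mx 0 r))).
  by under eq_bigr => l' _ do rewrite scale1r.
have := mulmx0_rank_max JA; rewrite mxrank_tr => rr.
have := limg_ker_dim (linfun (mulmxr B^T) : 'Hom('rV[K]_N.+1, 'rV[K]_c)) fullv.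
rewrite capfv dimvf /dim /= mul1n -/T => dT.
have : (\dim (linfun (mulmxr B^T) @: {: 'rV[K]_N.+1})%VS <= c)%N.
  by apply: leq_trans (dimvS (subvf _)) _; rewrite dimvf /dim /= mul1n.
rewrite -(leq_add2r c (k * n.+1)%N) => h; apply: leq_trans (leq_add rJ rA) _.
by apply: leq_trans rr _; rewrite -[X in (X <= _)%N]dT leq_add2l.
Qed.

Lemma sigma_smooth x0 p : immersive x0 -> sigma p ->
  (forall T, is_tangent_cone sigma p T -> (\dim T <= k * n.+1)%N) ->
  smooth_at sigma p.
Proof.
move=> xi pS up; split => //.
have e : (k * n.+1)%N = (k * n.+1).-1.+1 by rewrite prednK // muln_gt0 k_gt0.
have [T [tT dT]] := sigma_tangent_lower xi pS.
exists (k * n.+1).-1, T; split => //; first exact: (sigma_local_dim xi e).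
by rewrite -e; apply/eqP; rewrite eqn_leq (up T tT).
Qed.

End SecantGeometry.

(** * Configurations with injective differential *)

Section ImmersivePoints.

Variables (K : closedFieldType) (K0 : [pchar K] =i pred0).

Lemma dirdM m (F G : {mpoly K[m]}) (v w : 'rV[K]_m) :
  dird (F * G) v w = dird F v w * G.@[v ord0] + F.@[v ord0] * dird G v w.
Proof.
rewrite /dird mulr_suml mulr_sumr -big_split; apply: eq_bigr => i _ /=.
rewrite mderivM mevalD !mevalM mulrDl; congr (_ + _); last by rewrite mulrA.
by rewrite mulrAC.
Qed.

Lemma dirdX m (j : 'I_m) (v w : 'rV[K]_m) : dird ('X_j) v w = w ord0 j.
Proof.
rewrite /dird (bigD1 j) //= mderivX mnm1E eqxx scale1r.
have -> : (U_(j) - U_(j) = 0 :> 'X_{1..m})%MM.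
  by apply/mnmP => i; rewrite mnmBE subnn mnm0E.
rewrite mpolyX0 meval1 mul1r big1 ?addr0 // => i ij.
by rewrite mderivX mnm1E eq_sym (negPf ij) scale0r meval0 mul0r.
Qed.

Lemma dird_sq m (F G : {mpoly K[m]}) (v w : 'rV[K]_m) : F.@[v ord0] = 0 ->
  dird (F ^+ 2 * G) v w = 0.
Proof. by move=> Fv; rewrite expr2 !dirdM mevalM Fv !(mul0r, mulr0, addr0). Qed.

(* Multiplying f_l by the coordinates isolates the l-th component of the kernel
   of the differential, up to the direction x_l, which Euler's formula kills. *)
Lemma immersive_criterion n d k (x : 'I_k -> 'rV[K]_n.+1)
    (f : 'I_k -> {mpoly K[n.+1]}) : (1 < d)%N ->
  (forall l, f l \is d.-1.-homog) -> (forall l, (f l).@[x l ord0] != 0) ->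
  (forall l l', l' != l -> (f l).@[x l' ord0] = 0 /\
     forall y, dird (f l) (x l') y = 0) ->
  immersive d x.
Proof.
move=> d1 fh fx fsing y dy0; apply/row_matrixP => l; rewrite row0.
set yl := row l y.
have E j : dird (f l) (x l) yl * x l ord0 j + (f l).@[x l ord0] * yl ord0 j = 0.
  have Xd : f l * 'X_j \is d.-homog.
    have -> : d = (d.-1 + 1)%N by rewrite addn1 prednK // ltnW.
    by apply: dhomogM => //; rewrite dhomogX; apply/eqP/mdeg1.
  have := congr1 (fun w => pair w (f l * 'X_j)) dy0.
  rewrite pair0l /dpsum pair_suml (bigD1 l) //= big1 ?addr0 => [|l' ll'].
    by rewrite pair_dver // dirdM mevalXU dirdX.
  have [f0 f'0] := fsing l l' ll'.
  by rewrite pair_dver // dirdM f0 f'0 !mul0r addr0.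
pose c := - (dird (f l) (x l) yl / (f l).@[x l ord0]).
have yE : yl = c *: x l.
  apply/rowP => j; rewrite [RHS]mxE; apply: (mulfI (fx l)).
  have /eqP := E j; rewrite addrC addr_eq0 => /eqP ->.
  by rewrite /c mulNr mulrN; congr (- _); rewrite [_ / _ * _]mulrAC mulrCA mulfV // mulr1.
have x0 : x l != 0.
  apply: contraNneq (fx l) => ->; rewrite -[0](scale0r (0 : 'rV_n.+1)).
  rewrite (meval_homogZ _ _ (fh l)) expr0n.
  by case: d d1 {fh fx fsing dy0 E yE} => [|[|d']] //= _; rewrite mul0r.
have /rV0Pn[j xj] := x0.
have := E j; rewrite yE dirdZr (dird_euler K0 _ (fh l)) mxE.
have -> : c * (d.-1%:R * (f l).@[x l ord0]) * x l ord0 j +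
    (f l).@[x l ord0] * (c * x l ord0 j) =
    c * (d%:R * ((f l).@[x l ord0] * x l ord0 j)).
  have -> : (d%:R : K) = d.-1%:R + 1 by rewrite natr1 prednK // ltnW.
  rewrite mulrDl mul1r mulrDr !mulrA; congr (_ + _).
  by rewrite [_ * c]mulrC.
move=> /eqP; rewrite !mulf_eq0 (negPf (fx l)) (negPf xj) ((pcharf0P K).1 K0).
by rewrite eqn0Ngt (ltnW d1) !orbF => /eqP ->; rewrite scale0r.
Qed.

(** Vanishing doubly at the other [k - 1] points costs degree [2 (k - 1)] out of [d - 1], which is
    the condition [2 k <= d + 1]. The power [e] of the first coordinate, equal to 1 at all the
    points, fills up the degree. *)
Lemma immersive_collinear n d k : (0 < n)%N -> (1 < d)%N -> (0 < k)%N ->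
  (2 * k <= d + 1)%N -> exists x : 'I_k -> 'rV[K]_n.+1, immersive d x.
Proof.
move=> n0 d1 k0 kd.
pose x (l : 'I_k) : 'rV[K]_n.+1 := delta_mx 0 0 + l%:R *: delta_mx 0 (i1 n).
pose a (l : 'I_k) : {mpoly K[n.+1]} := 'X_(i1 n) - l%:R *: 'X_ord0.
pose e := (d.-1 - 2 * k.-1)%N.
pose f (l : 'I_k) : {mpoly K[n.+1]} := 'X_ord0 ^+ e * \prod_l' (a l') ^+ (2 * (l' != l)).
have x_0 l : x l ord0 ord0 = 1.
  by rewrite !mxE !eqxx [ord0 == i1 n]eq_sym (i1_neq0 n0) mulr0 addr0.
have x_1 l : x l ord0 (i1 n) = l%:R.
  by rewrite !mxE !eqxx (i1_neq0 n0) mulr1 add0r.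
have aE l l' : (a l).@[x l' ord0] = l'%:R - l%:R.
  by rewrite /a mevalB mevalZ !mevalXU x_0 x_1 mulr1.
have X1 i : 'X_i \is [in K[n.+1], 1.-homog] by rewrite dhomogX; apply/eqP/mdeg1.
have fprod l l' : l' != l -> exists r, f l = a l' ^+ 2 * r.
  move=> ll'; exists ('X_ord0 ^+ e * \prod_(l0 | l0 != l') (a l0) ^+ (2 * (l0 != l))).
  by rewrite /f (bigD1 l') //= ll' mulrCA.
exists x; apply: (immersive_criterion (f := f)) => // [l|l|l l' ll'].
- have Hd : (\sum_(l' < k) 1 * (2 * (l' != l)) = 2 * k.-1)%N.
    rewrite (bigD1 l) //= eqxx muln0 add0n.
    under eq_bigr => l' ll' do rewrite ll'.
    by rewrite sum_nat_const cardC1 card_ord mulnC.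
  have -> : d.-1 = (1 * e + \sum_(l' < k) 1 * (2 * (l' != l)))%N.
    by rewrite Hd /e mul1n subnK //; lia.
  apply: dhomogM; first by apply: dhomogMn.
  apply: dhomog_prod_ord => l'; apply: dhomogMn.
  by apply: rpredB; [exact: X1 | apply: rpredZ; exact: X1].
- rewrite /f mevalM rmorphXn /= mevalXU x_0 expr1n mul1r rmorph_prod.
  apply/prodf_neq0 => l' _; rewrite rmorphXn /= aE.
  have [->|ll'] := eqVneq l' l; first by rewrite muln0 expr0 oner_neq0.
  by rewrite expf_neq0 // subr_eq0 (inj_eq (natf_inj K0)) eq_sym.
have [r ->] := fprod l l' ll'; have al : (a l').@[x l' ord0] = 0 by rewrite aE subrr.
by split => [|y]; [rewrite mevalM rmorphXn /= al expr0n mul0r | rewrite dird_sq].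
Qed.

Lemma immersive_basis n d : (3 < d)%N ->
  immersive d (fun l : 'I_n.+1 => delta_mx 0 l : 'rV[K]_n.+1).
Proof.
move=> d3; apply: (immersive_criterion (f := fun l => 'X_l ^+ 2 * 'X_l ^+ (d - 3))).
- by rewrite (ltn_trans _ d3).
- move=> l; have X1 : 'X_l \is [in K[n.+1], 1.-homog] by rewrite dhomogX; apply/eqP/mdeg1.
  have -> : d.-1 = (1 * 2 + 1 * (d - 3))%N by lia.
  by apply: dhomogM; apply: dhomogMn.
- by move=> l; rewrite mevalM !rmorphXn /= !mevalXU mxE !eqxx !expr1n mulr1 oner_neq0.
move=> l l' ll'.
have Xl : ('X_l).@[(delta_mx 0 l' : 'rV[K]_n.+1) ord0] = 0.
  by rewrite mevalXU mxE [l == l']eq_sym (negPf ll') andbF.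
split=> [|y]; last exact: dird_sq.
by rewrite mevalM rmorphXn /= Xl expr0n mul0r.
Qed.

End ImmersivePoints.

Section NormalForm.

Variables (K : closedFieldType) (K0 : [pchar K] =i pred0) (n d : nat).
Hypothesis n_gt0 : (0 < n)%N.
Local Notation N := (veronese_N n d).
Variables (U : 'M[K]_n.+1) (Uu : U \in unitmx).

Definition xim (m : 'X_{1..n.+1}) : {mpoly K[n.+1]} := \prod_j xi U j ^+ m j.

Lemma xim_homog m : xim m \is (mdeg m).-homog.
Proof.
rewrite mdegE; apply: dhomog_prod_ord => j.
by rewrite -[X in _ \is X.-homog]mul1n; apply: dhomogMn; exact: xi_homog.
Qed.

Lemma ximD m1 m2 : xim (m1 + m2)%MM = xim m1 * xim m2.
Proof.
by rewrite /xim -big_split; apply: eq_bigr => j _; rewrite mnmDE exprD.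
Qed.

Lemma ximU j : xim U_(j)%MM = xi U j.
Proof.
rewrite /xim (bigD1 j) //= mnm1E eqxx expr1 big1 ?mulr1 // => i ij.
by rewrite mnm1E eq_sym (negPf ij) expr0.
Qed.

Lemma xim_split (m : 'X_{1..n.+1}) j : m j != 0%N ->
  xim m = xi U j * xim (m - U_(j))%MM /\ mdeg m = (mdeg (m - U_(j))%MM).+1.
Proof.
rewrite -lep1mP => /submK mE; split; first by rewrite -{1}mE ximD ximU mulrC.
by rewrite -{1}mE mdegD mdeg1 addn1.
Qed.

Lemma xim_bin (m : 'X_{1..n.+1}) : (forall j : 'I_n.+1, (1 < j)%N -> m j = 0%N) ->
  xim m = bmon U (mdeg m) (m (i1 n)) /\ (m (i1 n) <= mdeg m)%N.
Proof.
move=> m0.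
have gt1 (j : 'I_n.+1) : j != ord0 -> j != i1 n -> (1 < j)%N.
  rewrite -!val_eqE /= i1E //; case: (nat_of_ord j) => [|[|]] //.
have md : mdeg m = (m ord0 + m (i1 n))%N.
  rewrite mdegE (bigD1 ord0) //= (bigD1 (i1 n)) ?i1_neq0 //= big1 ?addn0 // => j.
  by move=> /andP[j0 j1]; rewrite m0 // gt1.
split; last by rewrite md leq_addl.
rewrite /bmon md addnK /xim (bigD1 ord0) //= (bigD1 (i1 n)) ?i1_neq0 //=.
rewrite big1 ?mulr1 // => j /andP[j0 j1].
by rewrite m0 ?expr0 // gt1.
Qed.

Lemma mnm_split a (m : 'X_{1..n.+1}) : (a <= mdeg m)%N ->
  exists m1 m2, m = (m1 + m2)%MM /\ mdeg m1 = a.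
Proof.
elim: a => [|a IH] am; first by exists 0%MM, m; rewrite add0m mdeg0.
have [m1 [m2 [mE m1a]]] := IH (ltnW am).
have [j mj] : exists j, m2 j != 0%N.
  apply: contrapT => h; have m20 : m2 = 0%MM.
    apply/mnmP => j; rewrite mnm0E; apply/eqP; apply: contraT => ?.
    by case: h; exists j.
  by move: am; rewrite mE mdegD m1a m20 mdeg0 addn0 ltnn.
exists (m1 + U_(j))%MM, (m2 - U_(j))%MM; split; last by rewrite mdegD mdeg1 m1a addn1.
by rewrite mE -addmA [(U_(j) + _)%MM]addmC submK // lep1mP.
Qed.

Lemma xim_span f : f \is d.-homog ->
  exists c : 'I_N.+1 -> K, f = \sum_j c j *: xim (mon j).
Proof.
move=> fd.
pose Y := [tuple \sum_(j < n.+1) U j i *: 'X_j | i < n.+1] : n.+1.-tuple {mpoly K[n.+1]}.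
have gd : f \mPo Y \is d.-homog.
  rewrite -[d]mul1n; apply: dhomog_comp => // i; rewrite tnth_mktuple.
  by apply: rpred_sum => j _; apply: rpredZ; rewrite dhomogX; apply/eqP/mdeg1.
exists (fun j => (f \mPo Y)@_(mon j)).
pose X := [tuple xi U j | j < n.+1].
have fE : f = (f \mPo Y) \mPo X.
  apply: (mpoly_fun_inj K0) => v; rewrite !comp_mpoly_meval; apply: meval_eq => i.
  rewrite tnth_mktuple raddf_sum /= [in LHS](xi_coord Uu v) summxE.
  by apply: eq_bigr => j _; rewrite mevalZ mevalXU tnth_mktuple !mxE mulrC.
rewrite [LHS]fE {1}(homog_mon gd) raddf_sum; apply: eq_bigr => j _ /=.
rewrite comp_mpolyZ comp_mpolyX; congr (_ *: _); apply: eq_bigr => i _.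
by rewrite tnth_mktuple.
Qed.

(** A monomial in the dual coordinates has no, one, or at least two factors vanishing on the line.
    In the last case two of them can be distributed over factors of degrees [d1] and [d2], where a
    catalecticant detects them. *)
Lemma normal_form d1 d2 (w : 'rV[K]_N.+1) : (0 < d1)%N -> (0 < d2)%N ->
  (d1 + d2)%N = d ->
  (forall (j j' : 'I_n.+1) G H, (1 < j)%N -> (1 < j')%N ->
     G \is d1.-1.-homog -> H \is d2.-1.-homog ->
     pair w ((xi U j * G) * (xi U j' * H)) = 0) ->
  (forall i, (i <= d)%N -> pair w (bmon U d i) = 0) ->
  (forall (j : 'I_n.+1) i, (1 < j)%N -> (i <= d.-1)%N ->
     pair w (xi U j * bmon U d.-1 i) = 0) ->
  w = 0.
Proof.
move=> d10 d20 dE wJ wb wx; apply: pair_nondeg => f /xim_span[c ->].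
rewrite pair_sumr big1 // => l _; rewrite pairZr; suff -> : pair w (xim (mon l)) = 0.
  by rewrite mulr0.
move: (mdeg_mon l); set m := mon l => md.
case: (pselect (forall j : 'I_n.+1, (1 < j)%N -> m j = 0%N)) => [/xim_bin[-> +]|].
  by rewrite md; exact: wb.
move/existsNP => [j /not_implyP[j1 /eqP mj]]; have [-> md'] := xim_split mj.
set m' := (m - U_(j))%MM in md' *.
have m'd : mdeg m' = d.-1 by rewrite -md md'.
case: (pselect (forall j : 'I_n.+1, (1 < j)%N -> m' j = 0%N)) => [/xim_bin[-> +]|].
  by rewrite m'd; exact: wx.
move/existsNP => [j' /not_implyP[j'1 /eqP m'j]]; have [-> md''] := xim_split m'j.
set m'' := (m' - U_(j'))%MM in md'' *.
have [|m1 [m2 [mE m1d]]] := @mnm_split d1.-1 m''; first by lia.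
have m2d : mdeg m2 = d2.-1.
  by have := mdegD m1 m2; rewrite -mE m1d => h; lia.
have := wJ j j' (xim m1) (xim m2) j1 j'1; rewrite -m1d -m2d.
move=> /(_ (xim_homog _) (xim_homog _)) <-.
by rewrite mE ximD [X in _ = pair w X]mulrACA mulrA.
Qed.

End NormalForm.

(** * Tangent spaces at subsecant points *)

Section TangentBounds.

Variables (K : closedFieldType) (K0 : [pchar K] =i pred0) (n d : nat).
Hypotheses (n_gt0 : (0 < n)%N) (d_gt0 : (0 < d)%N).
Local Notation N := (veronese_N n d).
Implicit Types (L : {vspace 'rV[K]_n.+1}) (f g h : {mpoly K[n.+1]}).
Implicit Types (p w : 'rV[K]_N.+1) (U : 'M[K]_n.+1) (T : {vspace 'rV[K]_N.+1}).

Definition pair_mx (I : finType) (G : I -> {mpoly K[n.+1]}) : 'M[K]_(N.+1, #|I|) :=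
  \matrix_(j, i) (G (enum_val i))@_(mon j).

Lemma mul_pair_mx (I : finType) (G : I -> {mpoly K[n.+1]}) w i :
  (w *m pair_mx G) ord0 i = pair w (G (enum_val i)).
Proof. by rewrite mxE; apply: eq_bigr => j _; rewrite mxE. Qed.

Lemma dim_le_pairs (I : finType) (G : I -> {mpoly K[n.+1]}) T :
  (forall w, w \in T -> (forall i, pair w (G i) = 0) -> w = 0) ->
  (\dim T <= #|I|)%N.
Proof.
move=> H; apply: (dim_le_forms (A := pair_mx G)) => w wT wG; apply: H => // i.
by rewrite -(enum_rankK i) -mul_pair_mx wG mxE.
Qed.

Lemma dim_ge_pairs (I : finType) (G : I -> {mpoly K[n.+1]}) T :
  (forall c : I -> K, (forall w, w \in T -> pair w (\sum_i c i *: G i) = 0) ->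
     forall i, c i = 0) ->
  (#|I| <= \dim T)%N.
Proof.
move=> H; apply: (dim_ge_forms (A := pair_mx G)) => c cT.
apply/colP => i; rewrite [RHS]mxE -(enum_valK i).
apply: (H (fun i => c (enum_rank i) ord0)) => w wT.
have := congr1 (fun M : 'M_1 => M ord0 ord0) (cT w wT); rewrite [RHS]mxE => <-.
rewrite mxE pair_sumr (reindex (@enum_val I predT)) /=; last first.
  by apply: onW_bij; exact: enum_val_bij.
apply: eq_bigr => j _.
by rewrite enum_valK pairZr mul_pair_mx mulrC.
Qed.

(** The index [i0] has the unique largest shift and an invertible coefficient, so the values below
    [dg i0] determine the rest. A general index type admits pairs, as needed for $g^2$. *)
Lemma recurrence_zero (I : finType) (c : I -> K) (dg : I -> nat) i0 D (tau : nat -> K) :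
  c i0 != 0 -> (forall i, i != i0 -> (dg i < dg i0)%N) ->
  (forall m, (m < dg i0)%N -> (m <= D)%N -> tau m = 0) ->
  (forall j, (dg i0 + j <= D)%N -> \sum_i c i * tau (dg i + j)%N = 0) ->
  forall m, (m <= D)%N -> tau m = 0.
Proof.
move=> c0 dg0 init rec m; elim/ltn_ind: m => m IH mD.
have [mi|im] := ltnP m (dg i0); first exact: init.
have := rec (m - dg i0)%N; rewrite subnKC // => /(_ mD).
rewrite (bigD1 i0) //= subnKC // big1 => [|i ii0].
  by move/eqP; rewrite addr0 mulf_eq0 (negPf c0) => /eqP.
by rewrite IH ?mulr0 //; have := dg0 i ii0; lia.
Qed.

(** A non-singular block of size [k] is bordered by [f] and [h], both apolar to [p]; the resulting
    minor is an equation of $\sigma_k$ whose differential [catdet_tangent] computes. *)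
Lemma tangent_kills k d1 d2 U T (q : projpoint K N) p w f h : (0 < k)%N ->
  (d1 + d2 = d)%N -> (k <= d1.+1)%N -> (k <= d2.+1)%N ->
  is_tangent_cone (secant k (veronese_variety K n d)) q T -> p \in pline q ->
  \det (\matrix_(i < k, j < k) pair p (bmon U d1 i * bmon U d2 j)) != 0 ->
  f \is d1.-homog -> h \is d2.-homog ->
  (forall h', h' \is d2.-homog -> pair p (f * h') = 0) ->
  (forall f', f' \is d1.-homog -> pair p (f' * h) = 0) ->
  w \in T -> pair w (f * h) = 0.
Proof.
move=> k0 dE kd1 kd2 tT pq Hdet fd hd fp hp wT.
pose F (i : 'I_k.+1) := if unlift ord_max i is Some j then bmon U d1 j else f.
pose H (i : 'I_k.+1) := if unlift ord_max i is Some j then bmon U d2 j else h.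
have Fd i : F i \is d1.-homog.
  rewrite /F; case: unliftP => [j _|_] //; apply: bmon_homog.
  by rewrite -ltnS (leq_trans (ltn_ord j)).
have Hd i : H i \is d2.-homog.
  rewrite /H; case: unliftP => [j _|_] //; apply: bmon_homog.
  by rewrite -ltnS (leq_trans (ltn_ord j)).
have Fm : F ord_max = f by rewrite /F unlift_none.
have Hm : H ord_max = h by rewrite /H unlift_none.
rewrite -{1}Fm -Hm; apply: (catdet_tangent (p := p)).
- by move=> j; rewrite Fm fp.
- by move=> i; rewrite Hm hp.
- apply: contraNneq Hdet => <-; apply/eqP; congr (\det _).
  by apply/matrixP => i j; rewrite !mxE /F /H !liftK.
have /tT wT' := wT.
have CS := catdet_vanS dE Fd Hd (L := fullv).
exact: (wT' _ _ (catdet_homog d F H) ((vanS_sigma d_gt0 k0 (catdet_homog d F H)).2 CS) p pq).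
Qed.

(** The minors of size [k.+1] vanish on the secant cone, so an apolar form of degree [k] exists even
    where the size of the catalecticant does not force one. *)
Lemma apolar_top L U k p : frame_of L U -> inS k L p -> (k <= d)%N ->
  exists g x, [/\ g \is k.-homog, x \in L, g.@[x ord0] != 0 &
    forall h, h \is (d - k).-homog -> pair p (g * h) = 0].
Proof.
move=> FU pS kd; have pU := inS_killsL FU pS.
apply: (apolar_exists K0 n_gt0 FU pU kd); rewrite ltnNge; apply/negP => /unit_minor.
move=> [a [b]]; set M := mxsub _ _ _ => M0.
pose f (i : 'I_k.+1) := bmon U k (a i); pose h (j : 'I_k.+1) := bmon U (d - k) (b j).
have fk i : f i \is k.-homog by apply: bmon_homog; rewrite -ltnS.
have hk i : h i \is (d - k).-homog by apply: bmon_homog; rewrite -ltnS.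
have := pS _ _ (catdet_homog d f h) (catdet_vanS (subnKC kd) fk hk (L := L)).
rewrite meval_catdet => /eqP; rewrite [X in \det X](_ : _ = M) ?(negPf M0) //.
by apply/matrixP => i j; rewrite !mxE.
Qed.

Lemma apolar_frame L k p : \dim L = 2%N -> inS k L p -> (0 < k <= d)%N ->
  exists U (c : 'I_k.+1 -> K), [/\ frame_of L U, c ord_max != 0 &
    forall j, (j <= d - k)%N -> \sum_i c i * pair p (bmon U d (i + j)) = 0].
Proof.
move=> dL pS /andP[k0 kd]; have [V FV] := frame_exists n_gt0 dL.
have [g [x [gk xL gx pg]]] := apolar_top FV pS kd.
have x0 : x != 0 by apply: (homog_nonroot_neq0 gk _ gx).
have [U [FU r1]] := frame1 n_gt0 dL xL x0; have [Uu _] := FU.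
have pU := inS_killsL FU pS.
exists U, (fun i => bcoef U g i); split => //.
  have := bin_eval K0 U 0 1 gk; rewrite scale0r add0r scale1r r1 => ge.
  move: gx; rewrite ge big_ord_recr /= big1 => [|i _]; last first.
    by rewrite expr0n subn_eq0 leqNgt ltn_ord mul0r mulr0.
  by rewrite add0r subnn expr0 expr1n !mulr1.
move=> j jd; pose b := \sum_(i < k.+1) bcoef U g i *: bmon U k i.
have bk : b \is k.-homog.
  by apply: rpred_sum => i _; apply: rpredZ; apply: bmon_homog; rewrite -ltnS.
transitivity (pair p (b * bmon U (d - k) j)).
  rewrite mulr_suml pair_sumr; apply: eq_bigr => i _.
  by rewrite -scalerAl pairZr bmonM ?subnKC // -ltnS.
have -> : b = g - (g - b) by rewrite subKr.
rewrite mulrBl pairBr pg ?bmon_homog // sub0r pU ?oppr0 //.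
  by rewrite -[X in X.-homog](subnKC kd) dhomogM ?bmon_homog // rpredB.
by move=> u v; rewrite mevalM bin_reduce ?mul0r.
Qed.

(** A kernel vector of the Hankel block is a form of degree [k - 1] annihilating the first terms;
    the recurrence of order [k] propagates this to all terms, and the form would put [p] in the
    smaller secant variety. *)
Lemma hankel_neq0 L U k p (c : 'I_k.+1 -> K) : \dim L = 2%N -> frame_of L U ->
  inS k L p -> (1 < k)%N -> (2 * k <= d + 1)%N -> c ord_max != 0 ->
  (forall j, (j <= d - k)%N -> \sum_i c i * pair p (bmon U d (i + j)) = 0) ->
  ~ inS k.-1 fullv p ->
  \det (\matrix_(i < k, j < k) pair p (bmon U d (i + j))) != 0.
Proof.
move=> dL FU pS k1 kd c0 cp npS; apply/eqP => det0; apply: npS.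
have pU := inS_killsL FU pS.
set M := \matrix_(_, _) _ in det0.
have [b [b0 bM]] : exists b : 'I_k -> K, (exists i, b i != 0) /\
    forall j, \sum_i b i * M i j = 0.
  exact: det0_row_kernel.
have rho0 j : (j <= d - k.-1)%N -> \sum_i b i * pair p (bmon U d (i + j)) = 0.
  apply: (recurrence_zero (i0 := ord_max) (c := c) (dg := fun i => nat_of_ord i)
    (tau := fun j => \sum_i b i * pair p (bmon U d (i + j)))) => //=.
  - by move=> i; rewrite -val_eqE /= => ik; have := ltn_ord i; lia.
  - move=> m mk _; rewrite -[RHS](bM (Ordinal mk)); apply: eq_bigr => i _.
    by rewrite mxE.
  move=> l ld.
  under eq_bigr => i _ do rewrite mulr_sumr.
  rewrite exchange_big big1 // => i _ /=.
  under eq_bigr => i' _ do rewrite mulrCA addnCA.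
  rewrite -mulr_sumr cp ?mulr0 //; have := ltn_ord i; lia.
have [e kE] : exists e, k = e.+1 by exists k.-1; rewrite prednK // ltnW.
subst k; have ed : (e <= d)%N by lia.
have [g [x [ge xL gx pg]]] := apolar_of_coef K0 n_gt0 FU pU ed b0 rho0.
apply: (inS_mono d_gt0 (leqnn e) (subvf L)).
apply: (apolar_border_rank K0 n_gt0 d_gt0 dL _ _ ge xL gx pg); first by lia.
by move=> f; apply: inS_kills pS.
Qed.

Lemma xi_vanL U (j : 'I_n.+1) g : U \in unitmx -> (1 < j)%N -> vanL U (xi U j * g).
Proof. by move=> Uu j1 a b; rewrite mevalM xij_onL // mul0r. Qed.

Lemma vanL_mulr U f g : vanL U f -> vanL U (f * g).
Proof. by move=> fU a b; rewrite mevalM fU mul0r. Qed.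

(* The catalecticant of bidegree (k, d - k) gives T <= (J^2 + g J + g^2)^perp, where
   J is the ideal of the line and g the apolar form of degree k of p. *)
Lemma tangent_upper_collinear L k (q : projpoint K N) p T : \dim L = 2%N -> p \in pline q ->
  inS k L p -> ~ inS k.-1 fullv p -> (2 < k)%N -> (2 * k <= d + 1)%N ->
  is_tangent_cone (secant k (veronese_variety K n d)) q T ->
  (\dim T <= k * n.+1)%N.
Proof.
move=> dL pq pS npS k2 kd tT.
have kd' : (0 < k <= d)%N by lia.
have [U [c [FU c0 cp]]] := apolar_frame dL pS kd'.
have [Uu _] := FU; have pU := inS_killsL FU pS.
have Hdet := hankel_neq0 dL FU pS (ltnW k2) kd c0 cp npS.
pose g := \sum_(i < k.+1) c i *: bmon U k i.
have gk : g \is k.-homog.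
  by apply: rpred_sum => i _; apply: rpredZ; apply: bmon_homog; rewrite -ltnS.
have kd1 : (k + (d - k) = d)%N by lia.
have pg : forall h, h \is (d - k).-homog -> pair p (g * h) = 0.
  apply: (apolar_bin K0 n_gt0 FU pU _ gk); first by lia.
  move=> j jd; rewrite mulr_suml pair_sumr -[RHS](cp j jd); apply: eq_bigr => i _.
  by rewrite -scalerAl pairZr bmonM ?kd1 // -ltnS.
have kills f h w : f \is k.-homog -> h \is (d - k).-homog ->
    (forall h', h' \is (d - k).-homog -> pair p (f * h') = 0) ->
    (forall f', f' \is k.-homog -> pair p (f' * h) = 0) ->
    w \in T -> pair w (f * h) = 0.
  apply: (tangent_kills (U := U) _ kd1 _ _ tT pq); [by lia..|].
  rewrite [X in \det X](_ : _ = \matrix_(i < k, j < k) pair p (bmon U d (i + j))) //.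
  apply/matrixP => i j; rewrite !mxE bmonM ?kd1 //.
    by have := ltn_ord i; lia.
  by have := ltn_ord j; lia.
(* Initial values for the recurrences: [2 k] binary ones for $g^2$, available as [2 k - 1 <= d], and
   [k] for [g] in each of the [n - 1] directions off the line. *)
pose G (r : 'I_k * 'I_n.+1) := if r.2 == ord0 then bmon U d r.1 else
  if r.2 == i1 n then bmon U d (k + r.1) else xi U r.2 * bmon U d.-1 r.1.
have -> : (k * n.+1 = #|{: 'I_k * 'I_n.+1}|)%N by rewrite card_prod !card_ord.
apply: (dim_le_pairs (G := G)) => w wT wG.
have xij (j : 'I_n.+1) e h : (1 < j)%N -> (0 < e)%N -> h \is e.-1.-homog ->
    xi U j * h \is e.-homog.
  move=> j1 e0 he; have -> : e = (1 + e.-1)%N by lia.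
  by apply: dhomogM => //; exact: xi_homog.
have killl f h : f \is k.-homog -> h \is (d - k).-homog -> vanL U f ->
    pair p (f * h) = 0.
  move=> fk hk fL; apply: pU; last exact: vanL_mulr.
  by rewrite -kd1; apply: dhomogM.
have killr f h : f \is k.-homog -> h \is (d - k).-homog -> vanL U h ->
    pair p (f * h) = 0.
  move=> fk hk hL; apply: pU; last by rewrite mulrC; exact: vanL_mulr.
  by rewrite -kd1; apply: dhomogM.
apply: (normal_form K0 n_gt0 Uu (d1 := k) (d2 := (d - k)%N)) => //; [by lia..| | |].
- move=> j j' A B j1 j'1 Ak Bk; apply: kills => //.
  + by apply: xij => //; lia.
  + by apply: xij => //; lia.
  + move=> h' hk; apply: killl => //; last exact: xi_vanL.
    by apply: xij => //; lia.
  move=> f' fk; apply: killr => //; last exact: xi_vanL.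
  by apply: xij => //; lia.
(* Forms restricted to the line: annihilation of multiples of $g^2$ is a recurrence of order
   [2 k]. *)
- apply: (recurrence_zero (i0 := (ord_max, ord_max) : 'I_k.+1 * 'I_k.+1)
    (c := fun r => c r.1 * c r.2) (dg := fun r => (r.1 + r.2)%N)
    (tau := fun i => pair w (bmon U d i))) => /=.
  + by rewrite mulf_neq0.
  + move=> [i i']; rewrite xpair_eqE negb_and -!val_eqE /= => ii.
    by have := ltn_ord i; have := ltn_ord i'; lia.
  + move=> m mk _; have [mk'|km] := ltnP m k.
      by have := wG (Ordinal mk', ord0).
    have mk' : (m - k < k)%N by lia.
    have := wG (Ordinal mk', i1 n); rewrite /G /= i1_neq0 // eqxx.
    by rewrite subnKC.
  move=> j jd.
  have jd2 : (j <= d - k - k)%N by lia.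
  have -> : \sum_(r : 'I_k.+1 * 'I_k.+1) c r.1 * c r.2 * pair w (bmon U d (r.1 + r.2 + j)) =
      pair w (g * (g * bmon U (d - k - k) j)).
    rewrite mulr_suml pair_sumr -(pair_bigA _ (fun i i' => c i * c i' *
      pair w (bmon U d (i + i' + j)))) /=.
    apply: eq_bigr => i _; rewrite mulr_suml mulr_sumr pair_sumr; apply: eq_bigr => i' _.
    rewrite -!scalerAl -scalerAr !pairZr mulrA !bmonM ?addnA //.
    - by congr (_ * pair w (bmon U _ _)); lia.
    - by rewrite -ltnS.
    - by have := ltn_ord i'; lia.
    - by rewrite -ltnS.
  have gb : g * bmon U (d - k - k) j \is (d - k).-homog.
    have -> : (d - k = k + (d - k - k))%N by lia.
    by apply: dhomogM => //; rewrite addKn; apply: bmon_homog.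
  apply: kills => // f' fk; rewrite mulrCA pg //.
  have -> : (d - k = k + (d - k - k))%N by lia.
  by apply: dhomogM => //; rewrite addKn; apply: bmon_homog.
move=> j i j1; have j0 : (j == ord0) = false by rewrite -val_eqE /=; case: (nat_of_ord j) j1.
have ji1 : (j == i1 n) = false.
  by rewrite -val_eqE /= i1E //; case: (nat_of_ord j) j1 => [|[]].
(* One factor off the line: annihilation of $gJ$ is a recurrence of order [k]. *)
move: i; apply: (recurrence_zero (i0 := ord_max : 'I_k.+1)
    (c := c) (dg := fun r => nat_of_ord r)
    (tau := fun i => pair w (xi U j * bmon U d.-1 i))) => //=.
- by move=> i; rewrite -val_eqE /=; have := ltn_ord i; lia.
- by move=> m mk _; have := wG (Ordinal mk, j); rewrite /G /= j0 ji1.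
move=> l ld; have ld2 : (l <= (d - k).-1)%N by lia.
have -> : \sum_(i < k.+1) c i * pair w (xi U j * bmon U d.-1 (i + l)) =
    pair w (g * (xi U j * bmon U (d - k).-1 l)).
  rewrite mulr_suml pair_sumr; apply: eq_bigr => i _.
  have ik : (i <= k)%N by rewrite -ltnS.
  rewrite -scalerAl pairZr [bmon U k i * _]mulrCA bmonM //.
  by congr (_ * pair w (_ * bmon U _ _)); lia.
have hb : xi U j * bmon U (d - k).-1 l \is (d - k).-homog.
  by apply: xij => //; [lia | apply: bmon_homog].
apply: kills => // f' fk; apply: killr => //; exact: xi_vanL.
Qed.

End TangentBounds.

Section SaturatedLine.

Variables (K : closedFieldType) (K0 : [pchar K] =i pred0) (n d : nat).
Hypotheses (n_gt0 : (0 < n)%N) (d_gt0 : (0 < d)%N).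
Local Notation N := (veronese_N n d).
Implicit Types (L : {vspace 'rV[K]_n.+1}) (p w : 'rV[K]_N.+1) (U : 'M[K]_n.+1).
Implicit Types (T : {vspace 'rV[K]_N.+1}).

Lemma dird_xi U j (v w : 'rV[K]_n.+1) : dird (xi U j) v w = (xi U j).@[w ord0].
Proof.
rewrite /xi dird_sum raddf_sum; apply: eq_bigr => l _ /=.
by rewrite dirdX mevalZ mevalXU.
Qed.

Definition off_line (j : 'I_n.-1) : 'I_n.+1 := inord j.+2.

Lemma off_lineE j : off_line j = j.+2 :> nat.
Proof. by rewrite inordK //; have := ltn_ord j; lia. Qed.

(* Coordinates on the space S^(d-1) L . V, of dimension (d + 1) + (n - 1) d. *)
Definition line_form U (r : 'I_d.+1 + 'I_n.-1 * 'I_d) : {mpoly K[n.+1]} :=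
  match r with
  | inl i => bmon U d i
  | inr ji => xi U (off_line ji.1) * bmon U d.-1 ji.2
  end.

Lemma card_line_form : #|{: 'I_d.+1 + 'I_n.-1 * 'I_d}| = (d.+1 + n.-1 * d)%N.
Proof. by rewrite card_sum card_prod !card_ord. Qed.

Lemma line_form_homog U r : line_form U r \is d.-homog.
Proof.
case: r => [i|[j i]] /=; first by apply: bmon_homog; rewrite -ltnS.
have dE : (1 + d.-1)%N = d by lia.
rewrite -[X in _ \is X.-homog]dE; apply: dhomogM; first exact: xi_homog.
by apply: bmon_homog; have := ltn_ord i; lia.
Qed.

(** A combination killed by [T] has zero differential at every point of the line. The direction of
    the point itself isolates the binary part, by Euler; the frame vectors off the line isolate the
    remaining coefficients. *)
Lemma tangent_line_lower L T : \dim L = 2%N ->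
  (forall x y, x \in L -> x != 0 -> dver d x y \in T) ->
  (d.+1 + n.-1 * d <= \dim T)%N.
Proof.
move=> dL LT; have [U FU] := frame_exists n_gt0 dL; have [Uu _] := FU.
rewrite -card_line_form; apply: (dim_ge_pairs (G := line_form U)) => c cT.
pose pt t := row ord0 U + t *: row (i1 n) U.
have ptL t : pt t \in L by rewrite /pt -[row ord0 U]scale1r; exact: frame_onL.
have pt0 t : pt t != 0.
  apply/eqP => e; have := xi0_onL n_gt0 Uu 1 t.
  by rewrite scale1r -/(pt t) e meval_xi mul0mx mxE => /esym/eqP; rewrite oner_eq0.
have fh : \sum_i c i *: line_form U i \is d.-homog.
  by apply: rpred_sum => i _; apply: rpredZ; exact: line_form_homog.
have fd t y : \sum_i c i * dird (line_form U i) (pt t) y = 0.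
  rewrite -dird_sum -(pair_dver _ _ fh).
  exact: (cT _ (LT _ y (ptL t) (pt0 t))).
have xi_pt j t : (xi U (off_line j)).@[(pt t) ord0] = 0.
  by rewrite /pt -[row ord0 U]scale1r xij_onL // off_lineE.
have cl i : c (inl i) = 0.
  apply/eqP; apply: contraT => ci.
  have [t] := bmon_comb_neq0 K0 n_gt0 (U := U) d 0 (c := fun i => c (inl i)) Uu (ex_intro _ i ci).
  rewrite -/(pt t) => /eqP; case.
  have := fd t (pt t); rewrite -dird_sum (dird_euler K0 _ fh) => /eqP.
  rewrite mulf_eq0 ((pcharf0P K).1 K0) eqn0Ngt d_gt0 /= => /eqP.
  rewrite big_sumType /= mevalD => fpt; rewrite -[RHS]fpt -[LHS]addr0; congr (_ + _).
  rewrite raddf_sum big1 // => [[j l]] _ /=.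
  by rewrite mevalZ mevalM xi_pt mul0r mulr0.
case=> [//|[j i]]; apply/eqP; apply: contraT => ci.
have [t] := bmon_comb_neq0 K0 n_gt0 (U := U) d.-1 0 (c := fun i => c (inr (j, i)))
  Uu (ex_intro _ i ci).
rewrite -/(pt t) => /eqP; case.
have := fd t (row (off_line j) U); rewrite big_sumType /= big1 ?add0r; last first.
  by move=> l _; rewrite cl mul0r.
have -> : \sum_r c (inr r) * dird (line_form U (inr r)) (pt t) (row (off_line j) U) =
    \sum_j' \sum_l c (inr (j', l)) *
      dird (xi U (off_line j') * bmon U d.-1 l) (pt t) (row (off_line j) U).
  by rewrite pair_bigA; apply: eq_bigr => -[].
move=> fj; rewrite -[RHS]fj raddf_sum /=.
rewrite [RHS](bigD1 j) //= [X in _ = _ + X]big1 ?addr0 => [|j' jj'].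
  apply: eq_bigr => l _; rewrite mevalZ dirdM dird_xi xi_row // eqxx mul1r.
  by rewrite xi_pt mul0r addr0.
rewrite big1 // => l _; rewrite dirdM dird_xi xi_row // xi_pt mul0r addr0.
have -> : (off_line j == off_line j') = false.
  by apply/negP; rewrite -val_eqE /= !off_lineE eqSS eqSS eq_sym => /eqP/val_inj/eqP; apply/negP.
by rewrite mul0r mulr0.
Qed.

(* Here p has no apolar form of degree k - 1 on the line, so the catalecticant of
   bidegree (k - 1, k - 1) only gives T <= (J^2)^perp = S^(d-1) L . V. *)
Lemma tangent_upper_even L k (q : projpoint K N) p T : \dim L = 2%N -> p \in pline q ->
  inS k L p -> ~ inS k.-1 fullv p -> (1 < k)%N -> (2 * k = d + 2)%N ->
  is_tangent_cone (secant k (veronese_variety K n d)) q T ->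
  (\dim T <= d.+1 + n.-1 * d)%N.
Proof.
move=> dL pq pS npS k1 kd tT.
have [U FU] := frame_exists n_gt0 dL; have [Uu _] := FU; have pU := inS_killsL FU pS.
have [e kE] : exists e, k = e.+1 by exists k.-1; rewrite prednK // ltnW.
have ee : (e + e = d)%N by lia.
have ed : (d - e = e)%N by lia.
have det0 : \det (\matrix_(i < k, j < k) pair p (bmon U e i * bmon U e j)) != 0.
  apply/eqP => det0; apply: npS.
  set M := \matrix_(_, _) _ in det0.
  have [b [b0 bM]] : exists b : 'I_k -> K, (exists i, b i != 0) /\
      forall j, \sum_i b i * M i j = 0.
    exact: det0_row_kernel.
  subst k; have ed' : (e <= d)%N by lia.
  have [|g [x [ge xL gx pg]]] := apolar_of_coef K0 n_gt0 FU pU ed' b0.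
    rewrite ed => j je; have je' : (j < e.+1)%N by [].
    rewrite -[RHS](bM (Ordinal je')); apply: eq_bigr => i _.
    by rewrite mxE bmonM ?ee // -ltnS.
  apply: (inS_mono d_gt0 (leqnn e) (subvf L)).
  apply: (apolar_border_rank K0 n_gt0 d_gt0 dL _ _ ge xL gx pg); first by lia.
  by move=> f; apply: inS_kills pS.
rewrite -card_line_form; apply: (dim_le_pairs (G := line_form U)) => w wT wG.
have killl f h : f \is e.-homog -> h \is e.-homog -> vanL U f -> pair p (f * h) = 0.
  move=> fk hk fL; apply: pU; last exact: vanL_mulr.
  by rewrite -ee; apply: dhomogM.
have xij (j : 'I_n.+1) h : h \is e.-1.-homog -> xi U j * h \is e.-homog.
  move=> he; have -> : e = (1 + e.-1)%N by lia.
  by apply: dhomogM => //; exact: xi_homog.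
apply: (normal_form K0 n_gt0 Uu (d1 := e) (d2 := e)) => //; [by lia..| | |].
- move=> j j' A B j1 j'1 Ak Bk.
  apply: (tangent_kills (U := U) d_gt0 _ ee _ _ tT pq det0) => //; try lia.
  + exact: xij.
  + exact: xij.
  + move=> h' hk; apply: killl => //; [exact: xij | exact: xi_vanL].
  move=> f' fk; rewrite mulrC; apply: killl => //; [exact: xij | exact: xi_vanL].
- by move=> i id; have := wG (inl (Ordinal (id : (i < d.+1)%N))).
move=> j i j1 id.
have jl : (j - 2 < n.-1)%N by have := ltn_ord j; lia.
have il : (i < d)%N by lia.
have := wG (inr (Ordinal jl, Ordinal il)); rewrite /=.
suff -> : off_line (Ordinal jl) = j by [].
by apply: val_inj; rewrite /= off_lineE /=; lia.
Qed.

End SaturatedLine.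

(** * The cases of the theorem *)

Section SubsecantLines.

Variables (K : closedFieldType) (K0 : [pchar K] =i pred0) (n d k : nat).
Hypotheses (n_gt1 : (1 < n)%N) (d_gt2 : (2 < d)%N) (k_gt2 : (2 < k)%N).
Local Notation N := (veronese_N n d).
Local Notation sigma j := (secant j (veronese_variety K n d)).
Local Notation Sigma := (subsecant_lines K n d k).

Let n_gt0 : (0 < n)%N := ltnW n_gt1.
Let d_gt0 : (0 < d)%N := ltnW (ltnW d_gt2).
Let k_gt0 : (0 < k)%N := ltnW (ltnW k_gt2).
Let k1_gt0 : (0 < k.-1)%N.
Proof. by rewrite -ltnS prednK // ltnW. Qed.

Lemma subsecantP (p : projpoint K N) : Sigma p ->
  exists2 L : {vspace 'rV[K]_n.+1}, \dim L = 2%N &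
    forall v, v \in pline p -> inS k L v.
Proof.
by move=> [L /= dL pL]; exists L => //; apply/secantE => //; exact: line_neq0.
Qed.

Lemma subsecant_sub_sigma p : Sigma p -> sigma k p.
Proof.
move=> /subsecantP[L dL pL]; apply/sigma_inS => //.
by apply: (inS_mono d_gt0 (leqnn k) (subvf L)); apply/pL/memv_pick.
Qed.

Lemma sigma_predP (p : projpoint K N) : sigma k.-1 p <-> inS k.-1 fullv (vpick (pline p)).
Proof. exact: sigma_inS. Qed.

Lemma subsecant_smooth p : (2 * k <= d + 1)%N -> Sigma p -> ~ sigma k.-1 p ->
  smooth_at (sigma k) p.
Proof.
move=> kd pS /sigma_predP np; have pk := subsecant_sub_sigma pS.
have [L dL pL] := subsecantP pS.
have [x xi] := immersive_collinear K0 n_gt0 (ltnW d_gt2) k_gt0 kd.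
apply: (sigma_smooth K0 d_gt0 k_gt0 xi pk) => T.
exact: (tangent_upper_collinear K0 n_gt0 d_gt0 dL (memv_pick _) (pL _ (memv_pick _)) np).
Qed.

(** What smoothness provides against an upper bound on dimension: [\dim T - 1] independent functions
    on a subset of $\sigma_k$. *)
Lemma smooth_dim_bound (p : projpoint K N) : smooth_at (sigma k) p ->
  exists T : {vspace 'rV[K]_N.+1}, exists Z : set (projpoint K N),
    [/\ is_tangent_cone (sigma k) p T, Z `<=` sigma k &
        alg_indep_functions Z (\dim T).-1 /\ (0 < \dim T)%N].
Proof.
move=> [_ [r [T [[[Z [_ _ Zs _ [Zr _]]] _] tT dT]]]].
by exists T, Z; split => //; rewrite dT.
Qed.

Lemma subsecant_singular : (2 * k = d + 2)%N -> (k, d, n) <> (3, 4, 2)%N ->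
  Sigma `<=` Sing (sigma k).
Proof.
move=> kd kdn p pS; split; first exact: subsecant_sub_sigma.
have [L dL pL] := subsecantP pS.
move=> /smooth_dim_bound[T [Z [tT Zs [Zi T0]]]].
have Tlow : (d.+1 + n.-1 * d <= \dim T)%N.
  apply: (tangent_line_lower K0 n_gt0 d_gt0 dL) => x y xL x0; apply/tT => e F Fe.
  move=> /(vanS_sigma d_gt0 k_gt0 Fe) FS v vp.
  have kills f : f \is d.-homog -> (forall x, x \in L -> f.@[x ord0] = 0) ->
    pair v f = 0 by apply: inS_kills (pL v vp).
  exact: (tangent_line K0 n_gt0 d_gt0 y dL (ltnW k_gt2) kd kills Fe FS xL x0).
have := sigma_sub_dim d_gt0 k_gt0 Zs Zi; rewrite prednK // leqNgt => /negP; apply.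
apply: leq_trans Tlow.
have {}kdn : (3 < k)%N || (2 < n)%N.
  apply: contra_notT kdn; rewrite negb_or -!leqNgt => /andP[k3 n2].
  have -> : k = 3 by apply/eqP; rewrite eqn_leq k3.
  have -> : n = 2 by apply/eqP; rewrite eqn_leq n2.
  congr (_, _, _); lia.
have [m nE] : exists m, n = m.+1 by exists n.-1; lia.
have [e kE] : exists e, k = e.+1 by exists k.-1; lia.
(* With [d = 2 e] the excess $(d+1)+(n-1)d-k(n+1)$ equals $m(e-1)-1$, which is positive unless
   [m = 1] and [e = 2]. *)
have h : (2 <= m * (e - 1))%N by case/orP: kdn => h; nia.
have -> : d = (2 * e)%N by lia.
by rewrite kE nE /=; nia.
Qed.

Lemma subsecant_not_sub : (2 * k = d + 2)%N -> ~ (Sigma `<=` sigma k.-1).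
Proof.
move=> kd; have [L [dL FL]] := frame_line n_gt0 (unitmx1 K n.+1).
have [e kE] : exists e, k = e.+1 by exists k.-1; rewrite prednK.
have dE : d = (2 * e)%N by lia.
have e0 : (0 < e)%N by lia.
have [pL np] := bvec_middle K0 n_gt0 d_gt0 FL dE e0.
have v0 : bvec d (1%:M : 'M[K]_n.+1) e != 0.
  apply/eqP => v0; apply: np => e' F Fe FS; rewrite v0.
  have := FS (fun=> 0) (fun _ => mem0v _).
  by rewrite big1 // => l _; rewrite veronese_vec0.
move=> /(_ (mkpt v0)); rewrite veronese_varietyE => h; apply: np.
suff : inS k.-1 fullv (bvec d (1%:M : 'M[K]_n.+1) e) by rewrite kE.
apply/(secant_mkptE d_gt0 k1_gt0 (fullv_neq0 K n) v0); apply: h.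
exists L => //=; apply/secant_mkptE => //; first exact: line_neq0.
by rewrite kE.
Qed.

Lemma subsecant_sub_pred : (d + 3 <= 2 * k)%N -> Sigma `<=` sigma k.-1.
Proof.
move=> dk p /subsecantP[L dL pL]; apply/sigma_predP.
have dE := odd_double_half d; have od : (odd d <= 1)%N by case: (odd d).
(* [d./2.+1] is the least [a] with [2 a > d], and [d + 3 <= 2 k] makes it at most [k - 1]. *)
apply: (inS_mono d_gt0 (k' := d./2.+1) (L' := L)); [by lia | exact: subvf |].
apply: (binary_border_rank K0 n_gt0 d_gt0 dL (k' := k)); [by lia.. |].
exact/pL/memv_pick.
Qed.

Lemma veronese_N_gt0 : (0 < N)%N.
Proof.
rewrite /veronese_N -ltnS prednK ?bin_gt0 ?leq_addl //.
have -> : (n + d = (n.-1 + d.-1.+1).+1)%N by lia.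
have -> : d = d.-1.+1 by lia.
by rewrite binS; apply: (@leq_add 1 1); rewrite bin_gt0; lia.
Qed.

(** On $\sigma_{k-1}$ the tangent space is everything by [tangent_full], so smoothness would give
    [N] independent functions on a subset of $\sigma_k$; a proper $\sigma_k$ lies on a hypersurface,
    which excludes this. *)
Lemma subsecant_singular_pred : sigma k <> setT -> Sigma `<=` sigma k.-1 ->
  Sigma `<=` Sing (sigma k).
Proof.
move=> sT Ss p pS; split; first exact: subsecant_sub_sigma.
move=> /smooth_dim_bound[T [Z [tT Zs [Zi T0]]]].
have pk : forall v, v \in pline p -> inS k.-1 fullv v.
  have := Ss p pS; rewrite veronese_varietyE => h.
  by apply/(secantE d_gt0 k1_gt0 (fullv_neq0 K n)).
have Tfull : T = fullv.
  apply/eqP; rewrite eqEsubv subvf; apply/subvP => w _; apply/tT => e F Fe.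
  move=> /(vanS_sigma d_gt0 k_gt0 Fe) FS v vp.
  have FS' : vanS k.-1.+1 fullv F by rewrite prednK.
  exact: (tangent_full K0 d_gt0 Fe FS' (pk v vp)).
have Zi' : alg_indep_functions Z N.
  have dN : \dim {: 'rV[K]_N.+1} = N.+1 by rewrite dimvf /dim /= mul1n.
  by move: Zi; rewrite Tfull dN.
have [q nq] : exists q, ~ sigma k q.
  apply: contrapT => h; apply: sT; apply/seteqP; split => // q _.
  by apply: contrapT => hq; apply: h; exists q.
have [F [e [Fe FS Fq]]] : exists (F : {mpoly K[N.+1]}) e,
    [/\ F \is e.-homog, vanS k fullv F & F.@[(vpick (pline q)) ord0] != 0].
  apply: contrapT => h; apply: nq; apply/sigma_inS => // e F Fe FS.
  by apply/eqP; apply: contraT => Fq; case: h; exists F, e.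
have F0 : F != 0 by apply: contraNneq Fq => ->; rewrite meval0.
have FZ : vanishes_on F Z.
  by move=> z /Zs; apply: (vanS_sigma d_gt0 k_gt0 Fe).2.
by have := hypersurface_dim veronese_N_gt0 Fe F0 FZ Zi'; rewrite ltnn.
Qed.

End SubsecantLines.

(** The bound of [tangent_upper_even] is $5+4=9=k(n+1)$. The immersive point consists of the
    coordinate points, since [2 k <= d + 1] fails for collinear ones. *)
Lemma subsecant_smooth_342 (K : closedFieldType) (K0 : [pchar K] =i pred0) p :
  subsecant_lines K 2 4 3 p -> ~ secant 2 (veronese_variety K 2 4) p ->
  smooth_at (secant 3 (veronese_variety K 2 4)) p.
Proof.
move=> pS np; have [L dL pL] := subsecantP (isT : (2 < 4)%N) (isT : (2 < 3)%N) pS.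
have pk := subsecant_sub_sigma (isT : (2 < 4)%N) (isT : (2 < 3)%N) pS.
have xi : immersive 4 (fun l : 'I_3 => delta_mx 0 l : 'rV[K]_3).
  exact: immersive_basis.
have sm := @sigma_smooth K K0 2 4 3 isT isT _ p xi pk.
apply: sm => T tT.
apply: (tangent_upper_even K0 _ _ dL (memv_pick _) (pL _ (memv_pick _)) _ _ _ tT) => //.
by move=> h; apply: np; apply/sigma_inS.
Qed.

Theorem theorem1 (R : realType) (n d k : nat)
    (hn : (2 <= n)%N) (hd : (3 <= d)%N) (hk : (3 <= k)%N) :
  let C : closedFieldType := R[i] in
  let sigma (j : nat) := secant j (veronese_variety C n d) in
  let Sigma := subsecant_lines C n d k in
  ((k, d, n) <> (3, 4, 2)%N ->
     [/\ (* (i) k <= (d + 1) / 2 *)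
         ((2 * k <= d + 1)%N ->
            forall p, (Sigma `\` sigma (k - 1)%N) p -> smooth_at (sigma k) p),
         (* (ii) k = (d + 2) / 2 *)
         ((2 * k = d + 2)%N ->
            Sigma `<=` Sing (sigma k) /\ ~ (Sigma `<=` sigma (k - 1)%N))
       & (* (iii) k >= (d + 3) / 2 *)
         ((d + 3 <= 2 * k)%N ->
            Sigma `<=` sigma (k - 1)%N /\
            (sigma k <> setT -> Sigma `<=` Sing (sigma k)))]) /\
  ((k, d, n) = (3, 4, 2)%N ->
     (* (iv) *)
     forall p, (subsecant_lines C 2 4 3
                  `\` secant 2 (veronese_variety C 2 4)) p ->
       smooth_at (secant 3 (veronese_variety C 2 4)) p).
Proof.
move=> C sigma Sigma.
have C0 : [pchar C] =i pred0 by exact: Num.Theory.pchar_num.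
rewrite subn1; split=> [kdn|_ p [pS np]]; last exact: subsecant_smooth_342.
split=> [kd p [pS np]|kd|kd].
- exact: subsecant_smooth.
- by split; [exact: subsecant_singular | exact: subsecant_not_sub].
have Ss : Sigma `<=` sigma k.-1 by exact: subsecant_sub_pred.
by split=> // sT; exact: subsecant_singular_pred.
Qed.
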